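(* Consider the Schwarzschild spacetime of mass $M>0$ in isotropic coordinates $(y^0,y^1,y^2,y^3)$, let $\gamma>0$ and $\beta$ satisfy $\gamma^2-\beta^2\gamma^2=1$, and let $\Sigma_{r_0}$ be the coordinate spheres \[\gamma y^0-\beta\gamma y^3=0,\qquad (y^1)^2+(y^2)^2+(\gamma y^3-\beta\gamma y^0)^2=r_0^2\] of the boosted slice, parametrized by $(\theta,\phi)$ via $y^0=\beta\gamma r_0\cos\theta$, $y^1=r_0\sin\theta\sin\phi$, $y^2=r_0\sin\theta\cos\phi$, $y^3=\gamma r_0\cos\theta$. For $r_0$ large let $X_{r_0}=(0,u\sin\phi,u\cos\phi,v)$ be the isometric embedding of $\Sigma_{r_0}$ into $\mathbb{R}^3\subset\mathbb{R}^{3,1}$, with $u=u(r_0,\theta)=r_0\sin\theta+O(1)$ and $v=v(r_0,\theta)=r_0\cos\theta+O(1)$. Then for every $T_0=(\sqrt{1+|a|^2},a^1,a^2,a^3)$, $|a|^2=\sum_{i=1}^3(a^i)^2$, the quasilocal energy satisfies \[\lim_{r_0\to\infty}E(\Sigma_{r_0},X_{r_0},T_0)=\sqrt{1+|a|^2}\,\gamma M+a^3\beta\gamma M .\] Among all such $T_0$ the minimum of this expression is achieved at $T_0=(\gamma,0,0,-\beta\gamma)$ and the minimum value is $M$; thus the limit of the quasilocal energy-momentum (the minimum value times the minimizing $T_0$) is $M(\gamma,0,0,-\beta\gamma)$.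
   Context: The Schwarzschild metric in isotropic coordinates is $-\frac1{F^2}(dy^0)^2+\frac1{G^2}\sum_{i=1}^3(dy^i)^2$ with $F^2=\frac{(1+\frac{M}{2\rho})^2}{(1-\frac{M}{2\rho})^2}$, $G^2=\frac1{(1+\frac M{2\rho})^4}$, $\rho^2=\sum_{i=1}^3(y^i)^2$, and $\partial/\partial y^0$ is future directed. Quasilocal energy: $\mathbb{R}^{3,1}$ is Minkowski space with signature $(-,+,+,+)$, and $\mathbb{R}^3=\{0\}\times\mathbb{R}^3$. For a spacelike 2-surface $\Sigma$ in a spacetime $N$, an isometric embedding $X:\Sigma\hookrightarrow\mathbb{R}^{3,1}$ and a constant future timelike unit vector $T_0$, put $\tau=-\langle X,T_0\rangle$; let $H$, $H_0$ be the mean curvature vectors of $\Sigma$ in $N$ and of $X(\Sigma)$ in $\mathbb{R}^{3,1}$ (the trace $\sum_a(\nabla_{e_a}e_a)^\perp$ of the second fundamental form), assumed spacelike, with $|H|=\sqrt{\langle H,H\rangle}$, $|H_0|=\sqrt{\langle H_0,H_0\rangle}$. Let $J$ be the unique future-directed timelike normal vector field with $\langle J,H\rangle=0$, $-\langle J,J\rangle=\langle H,H\rangle$, and $J_0$ the analogous field for $H_0$. With $\nabla\tau,\Delta\tau$ the gradient and Laplacian in the induced metric (and $\nabla\tau$ pushed forward by the embeddings), \[\begin{aligned}E(\Sigma,X,T_0)=\frac1{8\pi}\int_\Sigma\Big(&\sqrt{|H_0|^2(1+|\nabla\tau|^2)+(\Delta\tau)^2}-\sqrt{|H|^2(1+|\nabla\tau|^2)+(\Delta\tau)^2}\\&-\Delta\tau\Big[\sinh^{-1}\Big(\tfrac{\Delta\tau}{\sqrt{1+|\nabla\tau|^2}|H_0|}\Big)-\sinh^{-1}\Big(\tfrac{\Delta\tau}{\sqrt{1+|\nabla\tau|^2}|H|}\Big)\Big]\\&-\Big\langle\nabla^{\mathbb{R}^{3,1}}_{\nabla\tau}\tfrac{J_0}{|H_0|},\tfrac{H_0}{|H_0|}\Big\rangle+\Big\langle\nabla^N_{\nabla\tau}\tfrac{J}{|H|},\tfrac{H}{|H|}\Big\rangle\Big)dv_\Sigma.\end{aligned}\]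 *)

(* Defs.v *)
From Stdlib Require Import Reals Lra ClassicalEpsilon FunctionalExtensionality.
From Coquelicot Require Import Coquelicot.
Open Scope R_scope.

(** * Vectors and metrics in a coordinate chart of a spacetime *)

Inductive idx := i0 | i1 | i2 | i3.

Definition idx_eqb (i j : idx) : bool :=
  match i, j with
  | i0, i0 | i1, i1 | i2, i2 | i3, i3 => true
  | _, _ => false
  end.

Definition vec := idx -> R.

Definition vec4 (a b c d : R) : vec :=
  fun i => match i with i0 => a | i1 => b | i2 => c | i3 => d end.

Definition sum4 (f : idx -> R) : R := f i0 + f i1 + f i2 + f i3.

Definition vscal (c : R) (V : vec) : vec := fun i => c * V i.

Definition upd (p : vec) (i : idx) (t : R) : vec :=
  fun j => if idx_eqb i j then t else p j.

(** The Minkowski and the Schwarzschild metric are both diagonal in the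
    coordinates used here, so a metric is given by its diagonal coefficients:
    [N] stands for [sum_i N p i (dy^i)^2] at the point [p]. The vector
    [d/dy^0] is future directed. *)
Definition metric := vec -> idx -> R.

Definition gcomp (N : metric) (p : vec) (i j : idx) : R :=
  if idx_eqb i j then N p i else 0.

Definition ip (N : metric) (p V W : vec) : R :=
  sum4 (fun i => N p i * V i * W i).

Definition dgcomp (N : metric) (i j k : idx) (p : vec) : R :=
  Derive (fun t => gcomp N (upd p i t) j k) (p i).

(** [christoffel N p k i j] is [Gamma^k_(ij)] of the Levi-Civita connection;
    the inverse metric has the diagonal coefficients [/ N p k]. *)
Definition christoffel (N : metric) (p : vec) (k i j : idx) : R :=
  / (2 * N p k) * (dgcomp N i j k p + dgcomp N j i k p - dgcomp N k i j p).

Definition timelike (N : metric) (p V : vec) : Prop := ip N p V V < 0.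

Definition future_directed (N : metric) (p V : vec) : Prop :=
  ip N p V (vec4 1 0 0 0) < 0.

Definition minkowski : metric :=
  fun _ => vec4 (-1) 1 1 1.

Definition rho (y : vec) : R := sqrt (y i1 ^ 2 + y i2 ^ 2 + y i3 ^ 2).

Definition Fsq (M : R) (y : vec) : R :=
  (1 + M / (2 * rho y)) ^ 2 / (1 - M / (2 * rho y)) ^ 2.

Definition Gsq (M : R) (y : vec) : R :=
  1 / (1 + M / (2 * rho y)) ^ 4.

Definition schwarzschild (M : R) : metric :=
  fun y => vec4 (- (1 / Fsq M y)) (1 / Gsq M y) (1 / Gsq M y) (1 / Gsq M y).

(** * Geometry of a parametrized 2-sphere *)

(** A surface is parametrized by [(theta, phi)], [0 <= theta <= PI], and is
    [2 PI]-periodic in [phi]. The local formulas below are meant for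
    [0 < theta < PI]; the poles [theta = 0, PI] have measure zero. *)
Definition surface := R -> R -> vec.

Inductive tidx := Th | Ph.

Definition sum2 (f : tidx -> R) : R := f Th + f Ph.

Definition pd (a : tidx) (f : R -> R -> R) (th ph : R) : R :=
  match a with
  | Th => Derive (fun t => f t ph) th
  | Ph => Derive (fun t => f th t) ph
  end.

Definition vpd (a : tidx) (V : R -> R -> vec) (th ph : R) : vec :=
  fun i => pd a (fun t p => V t p i) th ph.

Definition induced (N : metric) (S : surface) (a b : tidx) (th ph : R) : R :=
  ip N (S th ph) (vpd a S th ph) (vpd b S th ph).

Definition detind (N : metric) (S : surface) (th ph : R) : R :=
  induced N S Th Th th ph * induced N S Ph Ph th ph
  - induced N S Th Ph th ph * induced N S Ph Th th ph.

Definition inv_induced (N : metric) (S : surface) (a b : tidx) (th ph : R) : R :=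
  match a, b with
  | Th, Th => induced N S Ph Ph th ph / detind N S th ph
  | Ph, Ph => induced N S Th Th th ph / detind N S th ph
  | _, _ => - induced N S a b th ph / detind N S th ph
  end.

Definition area_element (N : metric) (S : surface) (th ph : R) : R :=
  sqrt (detind N S th ph).

(** Components of the gradient of [f] on the surface. *)
Definition grad (N : metric) (S : surface) (f : R -> R -> R)
    (a : tidx) (th ph : R) : R :=
  sum2 (fun b => inv_induced N S a b th ph * pd b f th ph).

Definition grad_sq (N : metric) (S : surface) (f : R -> R -> R) (th ph : R) : R :=
  sum2 (fun a => sum2 (fun b =>
    induced N S a b th ph * grad N S f a th ph * grad N S f b th ph)).

Definition laplacian (N : metric) (S : surface) (f : R -> R -> R) (th ph : R) : R :=
  / area_element N S th ph *
  sum2 (fun a => pd a (fun t p => area_element N S t p * grad N S f a t p) th ph).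

(** Covariant derivative, along the [a]-th coordinate direction of the surface,
    of a vector field [V] defined along the surface. *)
Definition covd (N : metric) (S : surface) (a : tidx) (V : surface)
    (th ph : R) : vec :=
  fun k => vpd a V th ph k +
    sum4 (fun i => sum4 (fun j =>
      christoffel N (S th ph) k i j * vpd a S th ph i * V th ph j)).

Definition normal_part (N : metric) (S : surface) (th ph : R) (V : vec) : vec :=
  fun k => V k -
    sum2 (fun a => sum2 (fun b =>
      inv_induced N S a b th ph * ip N (S th ph) V (vpd a S th ph)
      * vpd b S th ph k)).

(** The trace is taken with the inverse induced metric, which is
    the sum over an orthonormal tangent frame. *)
Definition mean_curv (N : metric) (S : surface) : surface :=
  fun th ph k =>
    sum2 (fun a => sum2 (fun b =>
      inv_induced N S a b th ph *
      normal_part N S th ph (covd N S a (vpd b S) th ph) k)).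

Definition mean_curv_norm (N : metric) (S : surface) (th ph : R) : R :=
  sqrt (ip N (S th ph) (mean_curv N S th ph) (mean_curv N S th ph)).

Definition is_J (N : metric) (S : surface) (th ph : R) (J : vec) : Prop :=
  let p := S th ph in
  let H := mean_curv N S th ph in
  (forall a, ip N p J (vpd a S th ph) = 0) /\
  timelike N p J /\ future_directed N p J /\
  ip N p J H = 0 /\
  - ip N p J J = ip N p H H.

(** Where the surface and its mean curvature vector are spacelike, [is_J] has
    exactly one solution, so that the choice below is no choice. *)
Definition Jfield (N : metric) (S : surface) : surface :=
  fun th ph => epsilon (inhabits (vec4 0 0 0 0)) (is_J N S th ph).

Definition spacelike_surface (N : metric) (S : surface) (th ph : R) : Prop :=
  0 < induced N S Th Th th ph /\ 0 < detind N S th ph.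

Definition spacelike_mean_curv (N : metric) (S : surface) (th ph : R) : Prop :=
  0 < ip N (S th ph) (mean_curv N S th ph) (mean_curv N S th ph).

(** [< nabla_w (J / |H|), H / |H| >] for the tangent vector with components [w]. *)
Definition normal_connection (N : metric) (S : surface) (w : tidx -> R)
    (th ph : R) : R :=
  let Junit := fun t p => vscal (/ mean_curv_norm N S t p) (Jfield N S t p) in
  let Hunit := vscal (/ mean_curv_norm N S th ph) (mean_curv N S th ph) in
  ip N (S th ph)
    (fun k => sum2 (fun a => w a * covd N S a Junit th ph k))
    Hunit.

(** * Isometric embeddings into Minkowski space *)

Definition smooth_on (D : R -> R -> Prop) (f : R -> R -> R) : Prop :=
  forall x y, D x y -> forall n, ex_diff_n f n x y.

(** Smoothness on the sphere, in the atlas made of [(theta, phi)] away from the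
    poles and [(sin theta sin phi, sin theta cos phi)] on the two open
    hemispheres. *)
Definition smooth_on_sphere (f : R -> R -> R) : Prop :=
  smooth_on (fun th _ => 0 < th < PI) f /\
  (exists g, smooth_on (fun x y => x ^ 2 + y ^ 2 < 1) g /\
     forall th ph, 0 <= th < PI / 2 ->
       f th ph = g (sin th * sin ph) (sin th * cos ph)) /\
  (exists g, smooth_on (fun x y => x ^ 2 + y ^ 2 < 1) g /\
     forall th ph, PI / 2 < th <= PI ->
       f th ph = g (sin th * sin ph) (sin th * cos ph)).

(** [X] is the composition of the parametrization [S] with an embedding of the
    surface into Minkowski space: by the second clause it is well defined and
    injective on the surface, by the third it is isometric (at the poles by
    continuity), hence an immersion. *)
Definition isometric_embedding (N : metric) (S X : surface) : Prop :=
  (forall i, smooth_on_sphere (fun th ph => X th ph i)) /\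
  (forall th ph th' ph', 0 <= th <= PI -> 0 <= th' <= PI ->
     (X th ph = X th' ph' <-> S th ph = S th' ph')) /\
  (forall th ph a b, 0 < th < PI ->
     induced minkowski X a b th ph = induced N S a b th ph).

(** * Quasilocal energy *)

Definition time_function (X : surface) (T0 : vec) (th ph : R) : R :=
  - ip minkowski (X th ph) (X th ph) T0.

Definition energy_density (N : metric) (S X : surface) (T0 : vec)
    (th ph : R) : R :=
  let tau := time_function X T0 in
  let g2 := 1 + grad_sq N S tau th ph in
  let lap := laplacian N S tau th ph in
  let gradtau := fun a => grad N S tau a th ph in
  let H := mean_curv_norm N S th ph in
  let H0 := mean_curv_norm minkowski X th ph in
  sqrt (H0 ^ 2 * g2 + lap ^ 2) - sqrt (H ^ 2 * g2 + lap ^ 2)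
  - lap * (arcsinh (lap / (sqrt g2 * H0)) - arcsinh (lap / (sqrt g2 * H)))
  - normal_connection minkowski X gradtau th ph
  + normal_connection N S gradtau th ph.

Definition energy_integrand (N : metric) (S X : surface) (T0 : vec)
    (th ph : R) : R :=
  energy_density N S X T0 th ph * area_element N S th ph.

Definition quasilocal_energy (N : metric) (S X : surface) (T0 : vec) : R :=
  1 / (8 * PI) *
  RInt (fun th => RInt (energy_integrand N S X T0 th) 0 (2 * PI)) 0 PI.

(** [RInt], [sqrt] and [Jfield] are total; this says that the quasilocal energy
    makes sense. *)
Definition energy_defined (N : metric) (S X : surface) (T0 : vec) : Prop :=
  (forall th ph, 0 < th < PI ->
     spacelike_surface N S th ph /\ spacelike_mean_curv N S th ph /\
     spacelike_mean_curv minkowski X th ph) /\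
  (forall th, 0 < th < PI ->
     ex_RInt (energy_integrand N S X T0 th) 0 (2 * PI)) /\
  ex_RInt (fun th => RInt (energy_integrand N S X T0 th) 0 (2 * PI)) 0 PI.

(** * Observers and energy-momentum *)

Definition observer (a1 a2 a3 : R) : vec :=
  vec4 (sqrt (1 + (a1 ^ 2 + a2 ^ 2 + a3 ^ 2))) a1 a2 a3.

Definition is_observer (T0 : vec) : Prop :=
  exists a1 a2 a3, T0 = observer a1 a2 a3.

Definition is_minimizer (E : vec -> R) (T0 : vec) : Prop :=
  is_observer T0 /\ forall T, is_observer T -> E T0 <= E T.

Definition is_energy_momentum (E : vec -> R) (P : vec) : Prop :=
  exists T0, is_minimizer E T0 /\
    (forall T, is_minimizer E T -> T = T0) /\
    P = vscal (E T0) T0.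

(** * The boosted coordinate spheres *)

Definition boosted_sphere (beta gamma r0 : R) : surface :=
  fun th ph => vec4 (beta * gamma * r0 * cos th) (r0 * sin th * sin ph)
                    (r0 * sin th * cos ph) (gamma * r0 * cos th).

Definition rotational (u v : R -> R) : surface :=
  fun th ph => vec4 0 (u th * sin ph) (u th * cos ph) (v th).

Lemma polar_coordinates (s x y : R) : 0 <= s -> x ^ 2 + y ^ 2 = s ^ 2 ->
  exists ph, 0 <= ph <= 2 * PI /\ x = s * sin ph /\ y = s * cos ph.
Proof.
intros hs h; pose proof PI_RGT_0.
destruct (Req_dec s 0) as [s0|s0].
{ exists 0; rewrite s0 in *; split; [lra|split; nra]. }
assert (sp : 0 < s) by lra.
assert (hy : y = s * (y / s)) by (field; lra).
assert (hx : x = s * (x / s)) by (field; lra).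
set (c := y / s) in *; set (d := x / s) in *.
assert (e : d ^ 2 + c ^ 2 = 1).
{ apply (Rmult_eq_reg_l (s ^ 2)); [|nra]. rewrite <- h at 2. rewrite hx, hy; ring. }
assert (hc : -1 <= c <= 1) by nra.
pose proof (acos_bound c). pose proof (cos_acos c hc) as ca.
pose proof (sin_acos c hc) as sa.
assert (hd : 1 - Rsqr c = Rsqr d) by (unfold Rsqr; nra).
rewrite hd, sqrt_Rsqr_abs in sa.
destruct (Rle_dec 0 d).
- exists (acos c); rewrite Rabs_pos_eq in sa by lra.
  rewrite sa, ca; split; [lra|split; assumption].
- exists (2 * PI - acos c); rewrite Rabs_left in sa by lra.
  rewrite sin_minus, cos_minus, sin_2PI, cos_2PI, sa, ca.
  split; [lra|split; lra].
Qed.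

Lemma boosted_sphereP (beta gamma r0 : R) (y : vec) :
  0 < gamma -> gamma ^ 2 - beta ^ 2 * gamma ^ 2 = 1 -> 0 < r0 ->
  (gamma * y i0 - beta * gamma * y i3 = 0 /\
   y i1 ^ 2 + y i2 ^ 2 + (gamma * y i3 - beta * gamma * y i0) ^ 2 = r0 ^ 2)
  <->
  (exists th ph, 0 <= th <= PI /\ 0 <= ph <= 2 * PI /\
     y = boosted_sphere beta gamma r0 th ph).
Proof.
intros hg hb hr; split.
- intros [h1 h2].
  assert (e0 : y i0 = beta * y i3) by nra.
  set (z := gamma * y i3 - beta * gamma * y i0) in *.
  assert (e3 : y i3 = gamma * z).
  { unfold z; rewrite e0.
    replace (gamma * (gamma * y i3 - beta * gamma * (beta * y i3)))
      with ((gamma ^ 2 - beta ^ 2 * gamma ^ 2) * y i3) by ring.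
    rewrite hb; ring. }
  assert (hz : z = r0 * (z / r0)) by (field; lra).
  set (c := z / r0) in *.
  assert (hc : -1 <= c <= 1).
  { assert (z ^ 2 <= r0 ^ 2) by nra.
    assert (c ^ 2 <= 1); [|nra].
    apply (Rmult_le_reg_l (r0 ^ 2)); [nra|].
    replace (r0 ^ 2 * c ^ 2) with ((r0 * c) ^ 2) by ring. rewrite <- hz; lra. }
  pose proof (acos_bound c). pose proof (cos_acos c hc) as ca.
  assert (sp : 0 <= sin (acos c)) by (apply sin_ge_0; lra).
  pose proof (sin2_cos2 (acos c)) as sc. unfold Rsqr in sc; rewrite ca in sc.
  destruct (polar_coordinates (r0 * sin (acos c)) (y i1) (y i2))
    as [ph [hph [hx hy]]]; [nra| |].
  { replace ((r0 * sin (acos c)) ^ 2)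
      with (r0 ^ 2 * (sin (acos c) * sin (acos c))) by ring.
    replace (sin (acos c) * sin (acos c)) with (1 - c * c) by lra.
    rewrite hz in h2; nra. }
  exists (acos c), ph; split; [assumption|split; [assumption|]].
  apply functional_extensionality; intros []; unfold boosted_sphere, vec4.
  + rewrite e0, e3, ca, hz at 1; ring.
  + exact hx.
  + exact hy.
  + rewrite e3, ca, hz at 1; ring.
- intros [th [ph [_ [_ ->]]]]; unfold boosted_sphere, vec4; split; [ring|].
  replace (gamma * (gamma * r0 * cos th) - beta * gamma * (beta * gamma * r0 * cos th))
    with ((gamma ^ 2 - beta ^ 2 * gamma ^ 2) * r0 * cos th) by ring.
  rewrite hb.
  pose proof (sin2_cos2 th) as h1; pose proof (sin2_cos2 ph) as h2.
  unfold Rsqr in h1, h2.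
  replace ((r0 * sin th * sin ph) ^ 2 + (r0 * sin th * cos ph) ^ 2)
    with (r0 ^ 2 * (sin th * sin th) * (sin ph * sin ph + cos ph * cos ph)) by ring.
  rewrite h2.
  replace (r0 ^ 2 * (sin th * sin th) * 1 + (1 * r0 * cos th) ^ 2)
    with (r0 ^ 2 * (sin th * sin th + cos th * cos th)) by ring.
  rewrite h1; ring.
Qed.

(* Main.v *)
(** With [r] the radius, [e = M / (2 r)] and all lengths divided by [r], the boosted sphere, its
    embedding and their mean curvatures are explicit functions of [(e, theta)]: the isometry and
    the asymptotics of [u], [v] determine [u] and [v'], since neither [u] nor [v'] vanishes
    between the poles.

    The embedding lies in [R^3], so [J_0 / |H_0| = d/dt] is parallel,
    [|grad tau|^2 = |a|^2 - n^2] and [lap tau = |H_0| n] with [n] the normal component of the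
    spatial part [a] of the observer. The first terms of the energy density are then
    [phi |H_0| - phi |H|] with [phi' h = sqrt (1 + |grad tau|^2 + (lap tau / h)^2)], which is
    [sqrt (1 + |a|^2) (|H_0| - |H|)] up to [O(r^-3)]. The connection form of the normal bundle of
    the sphere is a multiple of [dtheta], computed in a normal frame adapted to the boosted
    slice. Uniform first order expansions in [e] reduce the limit to two elementary integrals. *)

(* The area element is of order [r^2] and the energy density is built from terms of order [1/r], so
   one factor [r = M / (2 e)] is left over: the two mean curvatures agree at order zero in [e], and
   the limit is read off from first order coefficients. The connection term is itself of order [e]
   but contains the theta derivative of the rapidity; hence the expansions must control that
   derivative as well as the values. The poles are the other obstacle, since the formulas for a
   surface of revolution divide by [sin theta]. The profile functions are written with these zeros
   cancelled, so for small [e] they are regular on the whole line and no cut-off near the poles is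
   needed, while the geometric identities are used between the poles only. The horizontal part of
   the observer enters the connection term through a function of [phi] of mean zero, which is why
   only [a^3] appears linearly in the limit. The coefficients and the final primitive are checked
   modulo three relations: [sin^2 + cos^2 = 1], [zz_sqr] and [ga^2 = 1 + b^2]. *)
Require Import Defs.
From Stdlib Require Import Reals Lra Psatz ClassicalEpsilon FunctionalExtensionality.
From Coquelicot Require Import Coquelicot.
Open Scope R_scope.

(** * Uniform first order expansions *)

(** The estimate is uniform on the whole line and includes continuity, so that integrals over a
    fixed interval converge at the same rate. The bound on [F0] makes the notion stable under
    products. *)
Definition ulim (F : R -> R -> R) (F0 : R -> R) : Prop :=
  exists C e0, 0 <= C /\ 0 < e0 /\ (forall x, Rabs (F0 x) <= C) /\
    forall e, 0 < e < e0 -> forall x,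
      continuous (F e) x /\ Rabs (F e x - F0 x) <= C * e.

(** The values are controlled to second order, the theta derivative only to rate [e]: this is enough
    for the derivative of the rapidity and is preserved by products and by composition with smooth
    functions. *)
Definition jet (F : R -> R -> R) (F0 F1 : R -> R) : Prop :=
  exists F' F0', ulim F' F0' /\ (forall x, is_derive F0 x (F0' x)) /\
  exists C e0, 0 <= C /\ 0 < e0 /\
    (forall x, Rabs (F0 x) <= C /\ Rabs (F1 x) <= C) /\
    forall e, 0 < e < e0 -> forall x,
      is_derive (F e) x (F' e x) /\
      Rabs (F e x - F0 x - e * F1 x) <= C * e ^ 2.

Lemma Rabs_mult_le a b A B : Rabs a <= A -> Rabs b <= B -> Rabs (a * b) <= A * B.
Proof.
intros; rewrite Rabs_mult; apply Rmult_le_compat; auto using Rabs_pos.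
Qed.

Lemma Rabs_plus_le a b A B : Rabs a <= A -> Rabs b <= B -> Rabs (a + b) <= A + B.
Proof. intros; eapply Rle_trans; [apply Rabs_triang|lra]. Qed.

Lemma ulim_ext F G F0 G0 : ulim F F0 ->
  (forall e x, 0 < e -> F e x = G e x) -> (forall x, F0 x = G0 x) -> ulim G G0.
Proof.
intros [C [e0 [h1 [h2 [h3 h4]]]]] hF h0; exists C, e0; repeat split; auto.
- intros x; rewrite <- h0; apply h3.
- apply (continuous_ext (F e)); [intros; apply hF; tauto|]. now apply h4.
- rewrite <- h0, <- hF by tauto; now apply h4.
Qed.

Lemma ulim_const_e (h : R -> R) C : (forall x, Rabs (h x) <= C) ->
  (forall x, continuous h x) -> ulim (fun _ x => h x) h.
Proof.
intros hC hc; assert (h0 := hC 0); pose proof (Rabs_pos (h 0)).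
exists C, 1; repeat split; try lra; auto.
replace (h x - h x) with 0 by ring; rewrite Rabs_R0; apply Rmult_le_pos; lra.
Qed.

Lemma ulim_plus F G F0 G0 : ulim F F0 -> ulim G G0 ->
  ulim (fun e x => F e x + G e x) (fun x => F0 x + G0 x).
Proof.
intros [C [e0 [h1 [h2 [h3 h4]]]]] [D [e1 [k1 [k2 [k3 k4]]]]].
exists (C + D), (Rmin e0 e1).
assert (Rmin e0 e1 <= e0) by apply Rmin_l.
assert (Rmin e0 e1 <= e1) by apply Rmin_r.
split; [lra|split; [now apply Rmin_glb_lt|split]].
- intros x; now apply Rabs_plus_le.
- intros e he x; destruct (h4 e ltac:(lra) x), (k4 e ltac:(lra) x); split.
  + now apply (continuous_plus (V := R_NormedModule)).
  + replace (F e x + G e x - (F0 x + G0 x))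
      with ((F e x - F0 x) + (G e x - G0 x)) by ring.
    rewrite Rmult_plus_distr_r; now apply Rabs_plus_le.
Qed.

Lemma ulim_mult F G F0 G0 : ulim F F0 -> ulim G G0 ->
  ulim (fun e x => F e x * G e x) (fun x => F0 x * G0 x).
Proof.
intros [C [e0 [h1 [h2 [h3 h4]]]]] [D [e1 [k1 [k2 [k3 k4]]]]].
exists (C * D + C * D + C * D), (Rmin 1 (Rmin e0 e1)).
assert (Rmin 1 (Rmin e0 e1) <= 1) by apply Rmin_l.
assert (Rmin 1 (Rmin e0 e1) <= Rmin e0 e1) by apply Rmin_r.
assert (Rmin e0 e1 <= e0) by apply Rmin_l.
assert (Rmin e0 e1 <= e1) by apply Rmin_r.
assert (0 <= C * D) by now apply Rmult_le_pos.
split; [lra|split; [repeat apply Rmin_glb_lt; lra|split]].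
- intros x; apply (Rle_trans _ (C * D)); [now apply Rabs_mult_le|lra].
- intros e he x; destruct (h4 e ltac:(lra) x), (k4 e ltac:(lra) x); split.
  + now apply (continuous_mult (K := R_AbsRing)).
  + replace (F e x * G e x - F0 x * G0 x) with
      ((F e x - F0 x) * (G e x - G0 x) + F0 x * (G e x - G0 x) + (F e x - F0 x) * G0 x)
      by ring.
    rewrite !Rmult_plus_distr_r; apply Rabs_plus_le; [apply Rabs_plus_le|].
    * apply (Rle_trans _ ((C * e) * (D * e))); [now apply Rabs_mult_le|].
      replace (C * e * (D * e)) with (C * D * e * e) by ring.
      rewrite <- (Rmult_1_r (C * D * e)) at 2.
      apply Rmult_le_compat_l; [apply Rmult_le_pos|]; lra.
    * rewrite Rmult_assoc; apply Rabs_mult_le; auto.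
    * replace (C * D * e) with (C * e * D) by ring; apply Rabs_mult_le; auto.
Qed.

Lemma ulim_const k : ulim (fun _ _ => k) (fun _ => k).
Proof.
apply (ulim_const_e (fun _ => k) (Rabs k)); intros; [lra|apply continuous_const].
Qed.

Lemma ulim_minus F G F0 G0 : ulim F F0 -> ulim G G0 ->
  ulim (fun e x => F e x - G e x) (fun x => F0 x - G0 x).
Proof.
intros hF hG.
apply (ulim_ext (fun e x => F e x + -1 * G e x) _ (fun x => F0 x + -1 * G0 x)).
- apply ulim_plus; [assumption|]. apply (ulim_mult (fun _ _ => -1)); [apply ulim_const|assumption].
- intros; ring.
- intros; ring.
Qed.

Lemma jet_bounds F F0 F1 : jet F F0 F1 -> exists C e0, 0 <= C /\ 0 < e0 /\
  (forall x, Rabs (F0 x) <= C) /\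
  forall e, 0 < e < e0 -> forall x, Rabs (F e x - F0 x) <= C * e /\ Rabs (F e x) <= C.
Proof.
intros [F' [F0' [hu [hd [C [e0 [h1 [h2 [h3 h4]]]]]]]]].
exists (C + C + C), (Rmin 1 e0).
assert (Rmin 1 e0 <= 1) by apply Rmin_l.
assert (Rmin 1 e0 <= e0) by apply Rmin_r.
split; [lra|split; [apply Rmin_glb_lt; lra|split]].
- intros x; destruct (h3 x); lra.
- intros e he x; destruct (h4 e ltac:(lra) x) as [_ h], (h3 x) as [hx hy].
  assert (A : Rabs (F e x - F0 x) <= (C + C) * e).
  { replace (F e x - F0 x) with ((F e x - F0 x - e * F1 x) + e * F1 x) by ring.
    rewrite Rmult_plus_distr_r; apply Rabs_plus_le.
    - apply (Rle_trans _ (C * e ^ 2)); [assumption|].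
      apply Rmult_le_compat_l; nra.
    - rewrite (Rmult_comm C); apply Rabs_mult_le; [rewrite Rabs_pos_eq; lra|auto]. }
  assert ((C + C) * e <= C + C) by (rewrite <- (Rmult_1_r (C + C)) at 2; apply Rmult_le_compat_l; lra).
  split; [apply (Rle_trans _ _ _ A); apply Rmult_le_compat_r; lra|].
  replace (F e x) with ((F e x - F0 x) + F0 x) by ring.
  apply Rabs_plus_le; lra.
Qed.

Lemma is_derive_continuous (f : R -> R) x l : is_derive f x l -> continuous f x.
Proof. intros h; apply (ex_derive_continuous f x); now exists l. Qed.

Lemma jet_ulim F F0 F1 : jet F F0 F1 -> ulim F F0.
Proof.
intros hj; destruct (jet_bounds _ _ _ hj) as [C [e0 [h1 [h2 [h3 h4]]]]].
destruct hj as [F' [F0' [hu [hd [C' [e1 [_ [k2 [_ k4]]]]]]]]].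
exists C, (Rmin e0 e1).
assert (Rmin e0 e1 <= e0) by apply Rmin_l.
assert (Rmin e0 e1 <= e1) by apply Rmin_r.
split; [lra|split; [apply Rmin_glb_lt; lra|split; [assumption|]]].
intros e he x; destruct (h4 e ltac:(lra) x), (k4 e ltac:(lra) x) as [hd' _]; split; [|assumption].
eapply is_derive_continuous, hd'.
Qed.

Lemma jet_ext F F0 F1 G0 G1 : jet F F0 F1 ->
  (forall x, F0 x = G0 x) -> (forall x, F1 x = G1 x) -> jet F G0 G1.
Proof.
intros [F' [F0' [hu [hd [C [e0 [h1 [h2 [h3 h4]]]]]]]]] e0' e1'.
exists F', F0'; split; [assumption|split].
- intros x; apply (is_derive_ext F0); auto.
- exists C, e0; split; [assumption|split; [assumption|split]].
  + intros x; rewrite <- e0', <- e1'; apply h3.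
  + intros e he x; rewrite <- e0', <- e1'; now apply h4.
Qed.

Lemma jet_theta (h h' : R -> R) C : (forall x, Rabs (h x) <= C) ->
  (forall x, Rabs (h' x) <= C) -> (forall x, is_derive h x (h' x)) ->
  (forall x, continuous h' x) -> jet (fun _ x => h x) h (fun _ => 0).
Proof.
intros b1 b2 hd hc; exists (fun _ => h'), h'.
assert (0 <= C) by (apply (Rle_trans _ (Rabs (h 0))); auto using Rabs_pos).
split; [apply (ulim_const_e _ C); auto|split; [assumption|]].
exists C, 1; split; [assumption|split; [lra|split]].
- intros x; rewrite Rabs_R0; auto.
- intros e he x; split; [apply hd|].
  replace (h x - h x - e * 0) with 0 by ring; rewrite Rabs_R0.
  apply Rmult_le_pos; [lra|apply pow2_ge_0].
Qed.

Lemma jet_const k : jet (fun _ _ => k) (fun _ => k) (fun _ => 0).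
Proof.
apply (jet_theta (fun _ => k) (fun _ => 0) (Rabs k)); intros; try lra.
- rewrite Rabs_R0; apply Rabs_pos.
- apply is_derive_Reals, derivable_pt_lim_const.
- apply continuous_const.
Qed.

Lemma jet_e : jet (fun e _ => e) (fun _ => 0) (fun _ => 1).
Proof.
exists (fun _ _ => 0), (fun _ => 0).
split; [apply (ulim_const_e _ 0); intros; [rewrite Rabs_R0; lra|apply continuous_const]|].
split; [intros; apply is_derive_Reals, derivable_pt_lim_const|].
exists 1, 1; split; [lra|split; [lra|split]].
- intros x; rewrite Rabs_R0, Rabs_R1; lra.
- intros e he x; split; [apply is_derive_Reals, derivable_pt_lim_const|].
  replace (e - 0 - e * 1) with 0 by ring; rewrite Rabs_R0; nra.
Qed.

Lemma jet_plus F G F0 G0 F1 G1 : jet F F0 F1 -> jet G G0 G1 ->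
  jet (fun e x => F e x + G e x) (fun x => F0 x + G0 x) (fun x => F1 x + G1 x).
Proof.
intros [F' [F0' [hu [hd [C [e0 [h1 [h2 [h3 h4]]]]]]]]]
  [G' [G0' [gu [gd [D [e1 [g1 [g2 [g3 g4]]]]]]]]].
exists (fun e x => F' e x + G' e x), (fun x => F0' x + G0' x).
split; [now apply ulim_plus|split].
{ intros x; now apply (is_derive_plus (V := R_NormedModule)). }
exists (C + D), (Rmin e0 e1).
assert (Rmin e0 e1 <= e0) by apply Rmin_l.
assert (Rmin e0 e1 <= e1) by apply Rmin_r.
split; [lra|split; [apply Rmin_glb_lt; lra|split]].
- intros x; destruct (h3 x), (g3 x); split; now apply Rabs_plus_le.
- intros e he x; destruct (h4 e ltac:(lra) x), (g4 e ltac:(lra) x); split.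
  + now apply (is_derive_plus (V := R_NormedModule)).
  + replace (F e x + G e x - (F0 x + G0 x) - e * (F1 x + G1 x)) with
     ((F e x - F0 x - e * F1 x) + (G e x - G0 x - e * G1 x)) by ring.
    rewrite Rmult_plus_distr_r; now apply Rabs_plus_le.
Qed.

Lemma is_derive_mult_R (f g : R -> R) x a b : is_derive f x a -> is_derive g x b ->
  is_derive (fun t => f t * g t) x (a * g x + f x * b).
Proof.
intros; apply (is_derive_mult f g); auto; intros; apply Rmult_comm.
Qed.

Lemma jet_mult F G F0 G0 F1 G1 : jet F F0 F1 -> jet G G0 G1 ->
  jet (fun e x => F e x * G e x) (fun x => F0 x * G0 x)
    (fun x => F1 x * G0 x + F0 x * G1 x).
Proof.
intros jF jG.
assert (uF := jet_ulim _ _ _ jF); assert (uG := jet_ulim _ _ _ jG).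
destruct (jet_bounds _ _ _ jG) as [B [e2 [b1 [b2 [b3 b4]]]]].
destruct jF as [F' [F0' [hu [hd [C [e0 [h1 [h2 [h3 h4]]]]]]]]].
destruct jG as [G' [G0' [gu [gd [D [e1 [g1 [g2 [g3 g4]]]]]]]]].
exists (fun e x => F' e x * G e x + F e x * G' e x),
  (fun x => F0' x * G0 x + F0 x * G0' x).
split; [apply ulim_plus; apply ulim_mult; assumption|split].
{ intros x; now apply is_derive_mult_R. }
set (m := Rmin 1 (Rmin e2 (Rmin e0 e1))).
assert (m <= 1) by apply Rmin_l.
assert (m <= Rmin e2 (Rmin e0 e1)) by apply Rmin_r.
assert (Rmin e2 (Rmin e0 e1) <= e2) by apply Rmin_l.
assert (Rmin e2 (Rmin e0 e1) <= Rmin e0 e1) by apply Rmin_r.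
assert (Rmin e0 e1 <= e0) by apply Rmin_l.
assert (Rmin e0 e1 <= e1) by apply Rmin_r.
assert (cb : 0 <= C * B) by nra. assert (cd : 0 <= C * D) by nra.
exists (C * D + C * D + C * B + C * D + C * D), m.
split; [lra|split; [unfold m; repeat apply Rmin_glb_lt; lra|split]].
- intros x; destruct (h3 x), (g3 x); split.
  + apply (Rle_trans _ (C * D)); [now apply Rabs_mult_le|lra].
  + apply (Rle_trans _ (C * D + C * D)); [apply Rabs_plus_le; now apply Rabs_mult_le|lra].
- intros e he x; destruct (h4 e ltac:(lra) x) as [a1 a2], (g4 e ltac:(lra) x) as [a3 a4].
  destruct (b4 e ltac:(lra) x) as [_ a5]; destruct (h3 x) as [a6 a7], (g3 x) as [a8 a9].
  split; [now apply is_derive_mult_R|].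
  (* With [F = F0 + e F1 + rF] and [G = G0 + e G1 + rG] the error is
     [e^2 F1 G1 + rF G + F0 rG + e F1 rG], every term of which is at least of order [e^2]. *)
  replace (F e x * G e x - F0 x * G0 x - e * (F1 x * G0 x + F0 x * G1 x)) with
    (e ^ 2 * (F1 x * G1 x) + (F e x - F0 x - e * F1 x) * G e x
     + F0 x * (G e x - G0 x - e * G1 x) + e * (F1 x * (G e x - G0 x - e * G1 x))) by ring.
  assert (Rabs (e ^ 2) <= e ^ 2) by (rewrite Rabs_pos_eq; [lra|apply pow2_ge_0]).
  assert (Rabs e <= 1) by (rewrite Rabs_pos_eq; lra).
  replace ((C * D + C * D + C * B + C * D + C * D) * e ^ 2) with
    (e ^ 2 * (C * D) + C * e ^ 2 * B + C * (D * e ^ 2) + 1 * (C * (D * e ^ 2)) + C * D * e ^ 2) by ring.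
  assert (0 <= C * D * e ^ 2) by (apply Rmult_le_pos; [lra|apply pow2_ge_0]).
  eapply Rle_trans; [|apply Rplus_le_compat_l; eassumption]; rewrite Rplus_0_r.
  repeat (apply Rabs_plus_le); repeat (apply Rabs_mult_le; auto).
Qed.

Lemma jet_opp F F0 F1 : jet F F0 F1 ->
  jet (fun e x => - F e x) (fun x => - F0 x) (fun x => - F1 x).
Proof.
intros jF; assert (h := jet_mult _ _ _ _ _ _ (jet_const (-1)) jF).
destruct (jet_ext _ _ _ (fun x => - F0 x) (fun x => - F1 x) h)
  as [F' [F0' [hu [hd [C [e0 [h1 [h2 [h3 h4]]]]]]]]]; try (intros; simpl; ring).
exists F', F0'; split; [assumption|split; [assumption|]].
exists C, e0; split; [assumption|split; [assumption|split; [assumption|]]].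
intros e he x; destruct (h4 e he x) as [a a']; split.
- apply (is_derive_ext (fun x => -1 * F e x)); [intros t; change (-1 * F e t = - F e t :> R); ring|assumption].
- replace (- F e x) with (-1 * F e x) by ring; assumption.
Qed.

Lemma jet_minus F G F0 G0 F1 G1 : jet F F0 F1 -> jet G G0 G1 ->
  jet (fun e x => F e x - G e x) (fun x => F0 x - G0 x) (fun x => F1 x - G1 x).
Proof. intros; apply jet_plus; [assumption|now apply jet_opp]. Qed.

(** Since [F0] is at least [l], the values of [F e] stay above [l / 2] for small [e], and Taylor
    bounds for [phi] on that half-line suffice. They are asked for as inequalities because for the
    inverse and the square root they follow from exact identities. The linear growth of [phi] keeps
    [phi (F0 x)] bounded. *)
Lemma jet_comp (phi phi' : R -> R) F F0 F1 (l B : R) :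
  0 < l -> jet F F0 F1 -> (forall x, l <= F0 x) ->
  (forall y, 0 < y -> is_derive phi y (phi' y) /\ continuous phi' y) ->
  (forall y, l / 2 <= y -> Rabs (phi' y) <= B) ->
  (forall y y', l / 2 <= y -> l / 2 <= y' ->
     Rabs (phi' y - phi' y') <= B * Rabs (y - y') /\
     Rabs (phi y - phi y' - phi' y' * (y - y')) <= B * (y - y') ^ 2) ->
  (forall x, l <= x -> Rabs (phi x) <= B * (1 + x)) ->
  jet (fun e x => phi (F e x)) (fun x => phi (F0 x)) (fun x => phi' (F0 x) * F1 x).
Proof.
intros hl jF hF hphi hB hT hL.
destruct (jet_bounds _ _ _ jF) as [Q [e2 [b1 [b2 [b3 b4]]]]].
destruct jF as [F' [F0' [hu [hd [C [e0 [h1 [h2 [h3 h4]]]]]]]]].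
assert (B0 : 0 <= B) by (apply (Rle_trans _ (Rabs (phi' l))); [apply Rabs_pos|apply hB; lra]).
(* Below [e3] the deviation of [F e] from [F0], at most [Q * e], cannot exceed [l / 2]. *)
set (e3 := l / 2 / (Q + 1)).
assert (e3p : 0 < e3) by (apply Rdiv_lt_0_compat; lra).
set (m := Rmin 1 (Rmin e3 (Rmin e2 e0))).
assert (mp : 0 < m) by (unfold m; repeat apply Rmin_glb_lt; lra).
assert (m <= 1) by apply Rmin_l.
assert (m <= e3 /\ m <= e2 /\ m <= e0) as [me3 [me2 me0]].
{ assert (m <= Rmin e3 (Rmin e2 e0)) by apply Rmin_r.
  assert (Rmin e3 (Rmin e2 e0) <= e3) by apply Rmin_l.
  assert (Rmin e3 (Rmin e2 e0) <= Rmin e2 e0) by apply Rmin_r.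
  assert (Rmin e2 e0 <= e2) by apply Rmin_l.
  assert (Rmin e2 e0 <= e0) by apply Rmin_r. lra. }
assert (low0 : forall x, l / 2 <= F0 x) by (intros x; specialize (hF x); lra).
assert (low : forall e, 0 < e < m -> forall x, l / 2 <= F e x).
{ intros e he x.
  destruct (b4 e ltac:(lra) x) as [a _]. apply Rabs_le_between in a.
  assert (e * (Q + 1) <= l / 2).
  { replace (l / 2) with (e3 * (Q + 1)) by (unfold e3; field; lra).
    apply Rmult_le_compat_r; lra. }
  specialize (hF x); nra. }
assert (uphi : ulim (fun e x => phi' (F e x)) (fun x => phi' (F0 x))).
{ exists (B + B * Q), m. split; [nra|split; [assumption|split]].
  - intros x. apply (Rle_trans _ B); [apply hB, low0|nra].
  - intros e he x; specialize (low e he); split.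
    + apply (continuous_comp (F e) phi').
      * destruct (h4 e ltac:(lra) x) as [a _]; eapply is_derive_continuous, a.
      * apply hphi; specialize (low x); lra.
    + destruct (hT (F e x) (F0 x) (low x) (low0 x)) as [t _].
      destruct (b4 e ltac:(lra) x) as [a _].
      apply (Rle_trans _ _ _ t). apply (Rle_trans _ (B * (Q * e))); nra. }
exists (fun e x => F' e x * phi' (F e x)), (fun x => F0' x * phi' (F0 x)).
split; [now apply ulim_mult|split].
{ intros x; apply (is_derive_comp phi F0); [apply hphi; specialize (low0 x); lra|apply hd]. }
exists (B * (1 + Q) + B * C + B * Q ^ 2), m.
assert (0 <= B * (1 + Q)) by nra. assert (0 <= B * C) by nra.
assert (0 <= B * Q ^ 2) by (apply Rmult_le_pos; [lra|apply pow2_ge_0]).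
split; [lra|split; [assumption|split]].
- intros x; split.
  + apply (Rle_trans _ _ _ (hL _ (hF x))). assert (a := b3 x).
    apply Rabs_le_between in a. nra.
  + apply (Rle_trans _ (B * C)); [|lra]. apply Rabs_mult_le; [apply hB, low0|apply h3].
- intros e he x; specialize (low e he x); specialize (low0 x).
  destruct (h4 e ltac:(lra) x) as [a1 a2]; destruct (b4 e ltac:(lra) x) as [a3 _].
  split.
  { apply (is_derive_comp phi (F e)); [apply hphi; lra|assumption]. }
  destruct (hT (F e x) (F0 x) low low0) as [_ t].
  replace (phi (F e x) - phi (F0 x) - e * (phi' (F0 x) * F1 x)) with
   ((phi (F e x) - phi (F0 x) - phi' (F0 x) * (F e x - F0 x))
    + phi' (F0 x) * (F e x - F0 x - e * F1 x)) by ring.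
  assert (b := Rabs_mult_le _ _ _ _ (hB (F0 x) low0) a2).
  assert ((F e x - F0 x) ^ 2 <= (Q * e) ^ 2).
  { rewrite <- (pow2_abs (F e x - F0 x)). apply pow_incr; split; [apply Rabs_pos|assumption]. }
  assert (B * (F e x - F0 x) ^ 2 <= B * Q ^ 2 * e ^ 2).
  { rewrite Rmult_assoc; apply Rmult_le_compat_l; [assumption|]. lra. }
  assert (0 <= B * (1 + Q) * e ^ 2) by (apply Rmult_le_pos; [lra|apply pow2_ge_0]).
  eapply Rle_trans; [apply Rabs_plus_le; [exact t|exact b]|]. lra.
Qed.

Lemma jet_inv F F0 F1 l : 0 < l -> jet F F0 F1 -> (forall x, l <= F0 x) ->
  jet (fun e x => / F e x) (fun x => / F0 x) (fun x => - (/ F0 x) ^ 2 * F1 x).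
Proof.
intros hl jF hF.
set (k := 2 / l).
assert (kp : 0 < k) by (apply Rdiv_lt_0_compat; lra).
assert (ky : forall y, l / 2 <= y -> 0 < / y <= k).
{ intros y hy; split; [apply Rinv_0_lt_compat; lra|].
  replace k with (/ (l / 2)) by (unfold k; field; lra).
  apply Rinv_le_contravar; lra. }
apply (jet_comp Rinv (fun y => - (/ y) ^ 2) F F0 F1 l (k + k ^ 2 + 2 * k ^ 3)); auto.
- intros y hy; split.
  + auto_derive; [lra|field; lra].
  + apply (ex_derive_continuous (V := R_NormedModule)); auto_derive; lra.
- intros y hy; destruct (ky y hy); rewrite Rabs_Ropp, Rabs_pos_eq by apply pow2_ge_0.
  assert ((/ y) ^ 2 <= k ^ 2) by (apply pow_incr; lra).
  assert (0 < k ^ 3) by (apply pow_lt; lra). lra.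
- intros y y' hy hy'; destruct (ky y hy) as [p1 p2], (ky y' hy') as [q1 q2].
  assert (0 < k ^ 3) by (apply pow_lt; lra). assert (0 < k ^ 2) by (apply pow_lt; lra).
  set (i := / y) in *; set (i' := / y') in *.
  assert (yi : y * i = 1) by (unfold i; field; lra).
  assert (yi' : y' * i' = 1) by (unfold i'; field; lra).
  split.
  + replace (- i ^ 2 - - i' ^ 2) with ((i * i' * (i + i')) * (y - y')).
    2:{ replace (i * i' * (i + i') * (y - y')) with
         ((y * i) * i' * (i + i') - (y' * i') * i * (i + i')) by ring.
        rewrite yi, yi'; ring. }
    rewrite Rabs_mult; apply Rmult_le_compat_r; [apply Rabs_pos|].
    assert (0 < i * i') by nra. assert (i * i' <= k * k) by (apply Rmult_le_compat; lra).
    rewrite Rabs_pos_eq by nra.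
    assert (i * i' * (i + i') <= k * k * (k + k)) by (apply Rmult_le_compat; lra).
    replace (2 * k ^ 3) with (k * k * (k + k)) by ring. lra.
  (* The remainder is exact: [1/y - 1/y' + (y - y')/y'^2 = (y - y')^2 / (y y'^2)]. *)
  + replace (i - i' - - i' ^ 2 * (y - y')) with (i * i' ^ 2 * (y - y') ^ 2).
    2:{ replace (i * i' ^ 2 * (y - y') ^ 2) with
         ((y * i) * (y * i') * i' - 2 * (y * i) * (y' * i') * i' + (y' * i') ^ 2 * i) by ring.
        rewrite yi, yi'.
        replace (- i' ^ 2 * (y - y')) with (- (y * i') * i' + (y' * i') * i') by ring.
        rewrite yi'; ring. }
    assert (0 <= i' ^ 2 <= k ^ 2) by (split; [apply pow2_ge_0|apply pow_incr; lra]).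
    rewrite Rabs_pos_eq by (apply Rmult_le_pos; [nra|apply pow2_ge_0]).
    apply Rmult_le_compat_r; [apply pow2_ge_0|].
    assert (i * i' ^ 2 <= k * k ^ 2) by (apply Rmult_le_compat; lra).
    replace (2 * k ^ 3) with (k * k ^ 2 + k ^ 3) by ring. lra.
- intros y hy; destruct (ky y ltac:(lra)). rewrite Rabs_pos_eq by lra.
  assert (0 < k ^ 3) by (apply pow_lt; lra). assert (0 < k ^ 2) by (apply pow_lt; lra).
  nra.
Qed.

Lemma jet_sqrt F F0 F1 l : 0 < l -> jet F F0 F1 -> (forall x, l <= F0 x) ->
  jet (fun e x => sqrt (F e x)) (fun x => sqrt (F0 x))
    (fun x => / (2 * sqrt (F0 x)) * F1 x).
Proof.
intros hl jF hF.
set (k := / sqrt (l / 2)).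
assert (kp : 0 < k) by (apply Rinv_0_lt_compat, sqrt_lt_R0; lra).
assert (ky : forall y, l / 2 <= y -> 0 < sqrt y /\ sqrt y ^ 2 = y /\ 0 < / sqrt y <= k).
{ intros y hy; assert (0 < sqrt y) by (apply sqrt_lt_R0; lra).
  split; [assumption|split; [apply pow2_sqrt; lra|split]].
  - now apply Rinv_0_lt_compat.
  - apply Rinv_le_contravar; [apply sqrt_lt_R0; lra|apply sqrt_le_1; lra]. }
apply (jet_comp sqrt (fun y => / (2 * sqrt y)) F F0 F1 l (1 + k + k ^ 3)); auto.
- intros y hy; assert (0 < sqrt y) by now apply sqrt_lt_R0. split.
  + auto_derive; [lra|field; lra].
  + apply (ex_derive_continuous (V := R_NormedModule)); auto_derive; repeat split; lra.
- intros y hy; destruct (ky y hy) as [a [_ c]].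
  assert (0 < k ^ 3) by (apply pow_lt; lra).
  rewrite Rinv_mult, Rabs_pos_eq by lra. lra.
- intros y y' hy hy'; destruct (ky y hy) as [p1 [p2 p3]], (ky y' hy') as [q1 [q2 q3]].
  assert (0 < k ^ 3) by (apply pow_lt; lra).
  set (i := sqrt y) in *; set (i' := sqrt y') in *.
  assert (S : / (i + i') <= k).
  { apply (Rle_trans _ (/ i)); [|lra]. apply Rinv_le_contravar; lra. }
  assert (Sp : 0 < / (i + i')) by (apply Rinv_0_lt_compat; lra).
  assert (T : / i * / i' * / (i + i') <= k ^ 3).
  { replace (k ^ 3) with (k * k * k) by ring. apply Rmult_le_compat; try lra.
    - apply Rmult_le_pos; lra.
    - apply Rmult_le_compat; lra. }
  assert (Tp : 0 < / i * / i' * / (i + i')) by (repeat apply Rmult_lt_0_compat; lra).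
  split.
  + replace (/ (2 * i) - / (2 * i')) with (- (/ 2 * (/ i * / i' * / (i + i'))) * (y - y')).
    2:{ rewrite <- p2, <- q2. field. repeat split; lra. }
    rewrite Rabs_mult; apply Rmult_le_compat_r; [apply Rabs_pos|].
    rewrite Rabs_Ropp, Rabs_pos_eq by lra. lra.
  (* Rationalizing [sqrt y - sqrt y' = (y - y') / (sqrt y + sqrt y')] twice gives the Taylor
     remainder exactly. *)
  + replace (i - i' - / (2 * i') * (y - y'))
      with (- (/ 2 * (/ i' * / (i + i') * / (i + i'))) * (y - y') ^ 2).
    2:{ rewrite <- p2, <- q2. field. repeat split; lra. }
    rewrite Rabs_mult, (Rabs_pos_eq ((y - y') ^ 2)) by apply pow2_ge_0.
    apply Rmult_le_compat_r; [apply pow2_ge_0|].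
    assert (/ i' * / (i + i') * / (i + i') <= k ^ 3).
    { replace (k ^ 3) with (k * k * k) by ring. apply Rmult_le_compat; try lra.
      - apply Rmult_le_pos; lra.
      - apply Rmult_le_compat; lra. }
    assert (0 < / i' * / (i + i') * / (i + i')) by (repeat apply Rmult_lt_0_compat; lra).
    rewrite Rabs_Ropp, Rabs_pos_eq by lra. lra.
- intros y hy; destruct (ky y ltac:(lra)) as [a [a2 _]]. rewrite Rabs_pos_eq by lra.
  assert (0 < k ^ 3) by (apply pow_lt; lra).
  assert (sqrt y <= 1 + y) by nra.
  assert (0 <= (k + k ^ 3) * (1 + y)) by (apply Rmult_le_pos; lra). lra.
Qed.

Lemma jet_pow2 F F0 F1 : jet F F0 F1 ->
  jet (fun e x => F e x ^ 2) (fun x => F0 x ^ 2) (fun x => 2 * F0 x * F1 x).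
Proof.
intros h; apply (jet_ext _ (fun x => F0 x * (F0 x * 1)) (fun x => F1 x * (F0 x * 1) + F0 x * (F1 x * 1 + F0 x * 0))).
- simpl; apply jet_mult; [assumption|]. apply (jet_mult _ (fun _ _ => 1)); [assumption|apply jet_const].
- intros; ring.
- intros; ring.
Qed.

Lemma jet_pow3 F F0 F1 : jet F F0 F1 ->
  jet (fun e x => F e x ^ 3) (fun x => F0 x ^ 3) (fun x => 3 * F0 x ^ 2 * F1 x).
Proof.
intros h; apply (jet_ext _ (fun x => F0 x * F0 x ^ 2) (fun x => F1 x * F0 x ^ 2 + F0 x * (2 * F0 x * F1 x))).
- apply (jet_mult F (fun e x => F e x ^ 2)); [assumption|now apply jet_pow2].
- intros; ring.
- intros; ring.
Qed.

Lemma jet_pow4 F F0 F1 : jet F F0 F1 ->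
  jet (fun e x => F e x ^ 4) (fun x => F0 x ^ 4) (fun x => 4 * F0 x ^ 3 * F1 x).
Proof.
intros h; apply (jet_ext _ (fun x => F0 x * F0 x ^ 3) (fun x => F1 x * F0 x ^ 3 + F0 x * (3 * F0 x ^ 2 * F1 x))).
- apply (jet_mult F (fun e x => F e x ^ 3)); [assumption|now apply jet_pow3].
- intros; ring.
- intros; ring.
Qed.

Lemma ulim_eventually_gt F F0 l k : ulim F F0 -> (forall x, l <= F0 x) -> k < l ->
  exists e0, 0 < e0 /\ forall e, 0 < e < e0 -> forall x, k < F e x.
Proof.
intros [C [e0 [h1 [h2 [h3 h4]]]]] hl hk.
set (e1 := (l - k) / (C + 1)).
assert (e1p : 0 < e1) by (apply Rdiv_lt_0_compat; lra).
exists (Rmin e0 e1); split; [now apply Rmin_glb_lt|].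
assert (Rmin e0 e1 <= e0) by apply Rmin_l.
assert (Rmin e0 e1 <= e1) by apply Rmin_r.
intros e he x; destruct (h4 e ltac:(lra) x) as [_ a]; apply Rabs_le_between in a.
assert (e * (C + 1) < l - k).
{ replace (l - k) with (e1 * (C + 1)) by (unfold e1; field; lra).
  apply Rmult_lt_compat_r; lra. }
specialize (hl x); nra.
Qed.

(** Replaces the derivative hidden in [jet] by [Derive], the form in which it occurs in the
    geometric formulas. *)
Lemma jet_Derive F F0 F1 : jet F F0 F1 ->
  ulim (fun e x => Derive (F e) x) (fun x => Derive F0 x) /\
  exists e0, 0 < e0 /\ forall e, 0 < e < e0 -> forall x, ex_derive (F e) x.
Proof.
intros [F' [F0' [[D [e1 [k1 [k2 [k3 k4]]]]] [hd [C [e0 [h1 [h2 [_ h4]]]]]]]]].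
split.
- exists D, (Rmin e0 e1).
  assert (Rmin e0 e1 <= e0) by apply Rmin_l.
  assert (Rmin e0 e1 <= e1) by apply Rmin_r.
  split; [assumption|split; [now apply Rmin_glb_lt|split]].
  + intros x; rewrite (is_derive_unique _ _ _ (hd x)); apply k3.
  + intros e he x; destruct (k4 e ltac:(lra) x) as [a c].
    assert (E : forall t, F' e t = Derive (F e) t).
    { intros t; symmetry; apply is_derive_unique, h4; lra. }
    split.
    * apply (continuous_ext (F' e)); assumption.
    * rewrite <- E, (is_derive_unique _ _ _ (hd x)); assumption.
- exists e0; split; [assumption|]; intros e he x; exists (F' e x); now apply h4.
Qed.

(** * Surfaces of revolution in static conformally flat metrics *)

(* Vectors in the moving frame of the rotation about the [y^3] axis: [axv] lies in the plane of
   the time axis, the horizontal radius and the [y^3] axis, [rtv] is orthoradial. *)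
Definition axv (x0 xe x3 ph : R) : vec := vec4 x0 (xe * sin ph) (xe * cos ph) x3.
Definition rtv (xe ph : R) : vec := vec4 0 (xe * cos ph) (- (xe * sin ph)) 0.
Definition ax (V0 Ve V3 : R -> R) : surface := fun th ph => axv (V0 th) (Ve th) (V3 th) ph.
Definition rt (Ve : R -> R) : surface := fun th ph => rtv (Ve th) ph.

Definition spatial (p : vec) : vec := fun i => match i with i0 => 0 | _ => p i end.

Lemma vec4_eq (V : vec) a b c d :
  V i0 = a -> V i1 = b -> V i2 = c -> V i3 = d -> V = vec4 a b c d.
Proof. intros; apply functional_extensionality; intros []; assumption. Qed.

Lemma vec_ext (V W : vec) :
  V i0 = W i0 -> V i1 = W i1 -> V i2 = W i2 -> V i3 = W i3 -> V = W.
Proof. intros; apply functional_extensionality; intros []; assumption. Qed.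

Lemma surface_ext (V W : surface) : (forall t p, V t p = W t p) -> V = W.
Proof.
intros h; apply functional_extensionality; intros t.
apply functional_extensionality; intros p; apply h.
Qed.

Lemma Derive_sin_scal k x : Derive (fun p => k * sin p) x = k * cos x.
Proof. apply is_derive_unique; auto_derive; [easy|ring]. Qed.

Lemma Derive_cos_scal k x : Derive (fun p => k * cos p) x = - (k * sin x).
Proof. apply is_derive_unique; auto_derive; [easy|ring]. Qed.

Lemma vpd_Th_ax V0 Ve V3 :
  vpd Th (ax V0 Ve V3) = ax (Derive V0) (Derive Ve) (Derive V3).
Proof.
apply surface_ext; intros t p; unfold vpd, pd, ax, axv; apply vec4_eq; simpl; try reflexivity;
  now rewrite Derive_scal_l.
Qed.

Lemma vpd_Ph_ax V0 Ve V3 : vpd Ph (ax V0 Ve V3) = rt Ve.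
Proof.
apply surface_ext; intros t p; unfold vpd, pd, ax, rt, axv, rtv; apply vec4_eq; simpl.
- apply Derive_const.
- apply Derive_sin_scal.
- apply Derive_cos_scal.
- apply Derive_const.
Qed.

Lemma vpd_Ph_rt Ve : vpd Ph (rt Ve) = ax (fun _ => 0) (fun t => - Ve t) (fun _ => 0).
Proof.
apply surface_ext; intros t p; unfold vpd, pd, ax, rt, axv, rtv; apply vec4_eq; simpl.
- apply Derive_const.
- rewrite Derive_cos_scal; ring.
- rewrite Derive_opp, Derive_sin_scal; ring.
- apply Derive_const.
Qed.

Lemma sin_sqr' p : sin p * sin p = 1 - cos p * cos p.
Proof. pose proof (sin2_cos2 p) as h; unfold Rsqr in h; lra. Qed.

(** The gradients of [A] and [B] are [al] and [be] times the spatial position and the spatial part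
    of the metric is a multiple of the flat one, so the Christoffel symbols contract to flat
    products of [V] and [W] with each other and with the position. *)
Lemma chris_sum N p A B al be (V W : vec) k :
  A <> 0 -> B <> 0 -> N p = vec4 (- A) B B B ->
  (forall i j k, dgcomp N i j k p = if idx_eqb j k then
     match j with i0 => - al * spatial p i | _ => be * spatial p i end else 0) ->
  sum4 (fun i => sum4 (fun j => christoffel N p k i j * V i * W j)) =
  match k with
  | i0 => al / (2 * A) * (V i0 * (W i1 * p i1 + W i2 * p i2 + W i3 * p i3)
                          + W i0 * (V i1 * p i1 + V i2 * p i2 + V i3 * p i3))
  | _ => al / (2 * B) * (V i0 * W i0 * p k)
     + be / (2 * B) * (V k * (W i1 * p i1 + W i2 * p i2 + W i3 * p i3)
                       + W k * (V i1 * p i1 + V i2 * p i2 + V i3 * p i3)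
                       - (V i1 * W i1 + V i2 * W i2 + V i3 * W i3) * p k)
  end.
Proof.
intros hA hB hN hD; unfold sum4, christoffel; rewrite !hD, !hN.
destruct k; simpl; field; auto.
Qed.

(* Components of [Gamma(T, V)] for the metric [- A (dy^0)^2 + B |dy|^2] at a point [(y_e, y_3)]
   where [A] and [B] have the gradients [al y] and [be y]. *)
Definition gam0 (A al y_e y_3 T0 Te T3 V0 Ve V3 : R) : R :=
  al / (2 * A) * (T0 * (Ve * y_e + V3 * y_3) + V0 * (Te * y_e + T3 * y_3)).
Definition game (B al be y_e y_3 T0 Te T3 V0 Ve V3 : R) : R :=
  al / (2 * B) * (T0 * V0 * y_e)
  + be / (2 * B) * (Te * (Ve * y_e + V3 * y_3) + Ve * (Te * y_e + T3 * y_3)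
                    - (Te * Ve + T3 * V3) * y_e).
Definition gam3 (B al be y_e y_3 T0 Te T3 V0 Ve V3 : R) : R :=
  al / (2 * B) * (T0 * V0 * y_3)
  + be / (2 * B) * (T3 * (Ve * y_e + V3 * y_3) + V3 * (Te * y_e + T3 * y_3)
                    - (Te * Ve + T3 * V3) * y_3).

Ltac eta_Derive := repeat match goal with
  | |- context [Derive (fun x => ?f x) ?t] => progress change (Derive (fun x => f x) t) with (Derive f t)
  end.

Section Axial.

Variables (N : metric) (Y0 Ye Y3 A B al be : R -> R).
Let Y : surface := ax Y0 Ye Y3.

(** Stated only along the surface and between the poles, so that it covers both Schwarzschild along
    the boosted sphere and Minkowski along the embedding, where [al] and [be] are zero. *)
Definition axial_metric : Prop :=
  forall t p, 0 < t < PI -> 0 < A t /\ 0 < B t /\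
    N (Y t p) = vec4 (- A t) (B t) (B t) (B t) /\
    forall i j k, dgcomp N i j k (Y t p) = if idx_eqb j k then
     match j with i0 => - al t * spatial (Y t p) i | _ => be t * spatial (Y t p) i end else 0.

Hypothesis hN : axial_metric.

Let T0 := Derive Y0.
Let Te := Derive Ye.
Let T3 := Derive Y3.
Let Eth t := - A t * T0 t ^ 2 + B t * (Te t ^ 2 + T3 t ^ 2).
Let Gph t := B t * Ye t ^ 2.

Lemma ip_ax_ax t p a0 ae a3 c0 ce c3 : 0 < t < PI ->
  ip N (Y t p) (axv a0 ae a3 p) (axv c0 ce c3 p) =
  - A t * a0 * c0 + B t * (ae * ce + a3 * c3).
Proof.
intros ht; destruct (hN t p ht) as [_ [_ [h _]]].
unfold ip, sum4; rewrite h; simpl; ring [(sin_sqr' p)].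
Qed.

Lemma ip_ax_rt t p a0 ae a3 ce : 0 < t < PI ->
  ip N (Y t p) (axv a0 ae a3 p) (rtv ce p) = 0.
Proof.
intros ht; destruct (hN t p ht) as [_ [_ [h _]]].
unfold ip, sum4; rewrite h; simpl; ring.
Qed.

Lemma ip_rt_ax t p a0 ae a3 ce : 0 < t < PI ->
  ip N (Y t p) (rtv ce p) (axv a0 ae a3 p) = 0.
Proof.
intros ht; destruct (hN t p ht) as [_ [_ [h _]]].
unfold ip, sum4; rewrite h; simpl; ring.
Qed.

Lemma ip_rt_rt t p a c : 0 < t < PI ->
  ip N (Y t p) (rtv a p) (rtv c p) = B t * a * c.
Proof.
intros ht; destruct (hN t p ht) as [_ [_ [h _]]].
unfold ip, sum4; rewrite h; simpl; ring [(sin_sqr' p)].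
Qed.

Lemma vpd_Th_Y : vpd Th Y = ax T0 Te T3.
Proof. apply vpd_Th_ax. Qed.

Lemma vpd_Ph_Y : vpd Ph Y = rt Ye.
Proof. apply vpd_Ph_ax. Qed.

Lemma axE V0 Ve V3 t p : ax V0 Ve V3 t p = axv (V0 t) (Ve t) (V3 t) p.
Proof. reflexivity. Qed.

Lemma rtE Ve t p : rt Ve t p = rtv (Ve t) p.
Proof. reflexivity. Qed.

Lemma induced_axial a c t p : 0 < t < PI -> induced N Y a c t p =
  match a, c with Th, Th => Eth t | Ph, Ph => Gph t | _, _ => 0 end.
Proof.
intros ht; unfold induced.
destruct a, c; rewrite ?vpd_Th_Y, ?vpd_Ph_Y, ?axE, ?rtE.
- unfold Eth; rewrite ip_ax_ax by assumption; ring.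
- now apply ip_ax_rt.
- now apply ip_rt_ax.
- unfold Gph; rewrite ip_rt_rt by assumption; ring.
Qed.

Lemma detind_axial t p : 0 < t < PI -> detind N Y t p = Eth t * Gph t.
Proof. intros ht; unfold detind; rewrite !induced_axial by assumption; ring. Qed.

Hypothesis hE : forall t, 0 < t < PI -> 0 < Eth t.
Hypothesis hG : forall t, 0 < t < PI -> 0 < Gph t.

Lemma inv_induced_axial a c t p : 0 < t < PI -> inv_induced N Y a c t p =
  match a, c with Th, Th => / Eth t | Ph, Ph => / Gph t | _, _ => 0 end.
Proof.
intros ht; unfold inv_induced; rewrite detind_axial, !induced_axial by assumption.
specialize (hE t ht); specialize (hG t ht).
destruct a, c; field; lra.
Qed.

Lemma area_axial t p : 0 < t < PI -> area_element N Y t p = sqrt (Eth t * Gph t).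
Proof. intros ht; unfold area_element; now rewrite detind_axial. Qed.

Lemma covd_Th_ax V0 Ve V3 t p : 0 < t < PI ->
  covd N Y Th (ax V0 Ve V3) t p =
  axv (Derive V0 t + gam0 (A t) (al t) (Ye t) (Y3 t) (T0 t) (Te t) (T3 t) (V0 t) (Ve t) (V3 t))
    (Derive Ve t + game (B t) (al t) (be t) (Ye t) (Y3 t) (T0 t) (Te t) (T3 t) (V0 t) (Ve t) (V3 t))
    (Derive V3 t + gam3 (B t) (al t) (be t) (Ye t) (Y3 t) (T0 t) (Te t) (T3 t) (V0 t) (Ve t) (V3 t)) p.
Proof.
intros ht; destruct (hN t p ht) as [hA [hB [h1 h2]]].
unfold covd; rewrite vpd_Th_ax, vpd_Th_Y.
apply vec_ext;
  rewrite (chris_sum N (Y t p) (A t) (B t) (al t) (be t)) by (auto; lra);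
  unfold gam0, game, gam3, Y; simpl; ring [(sin_sqr' p)].
Qed.

Lemma covd_Ph_ax V0 Ve V3 t p : 0 < t < PI ->
  covd N Y Ph (ax V0 Ve V3) t p =
  rtv (Ve t + be t / (2 * B t) * (Ye t * (Ve t * Ye t + V3 t * Y3 t))) p.
Proof.
intros ht; destruct (hN t p ht) as [hA [hB [h1 h2]]].
unfold covd; rewrite vpd_Ph_ax, vpd_Ph_Y.
apply vec_ext;
  rewrite (chris_sum N (Y t p) (A t) (B t) (al t) (be t)) by (auto; lra);
  unfold Y; simpl; ring [(sin_sqr' p)].
Qed.

Lemma covd_Ph_rt V t p : 0 < t < PI ->
  covd N Y Ph (rt V) t p =
  axv 0 (- V t - be t / (2 * B t) * (Ye t * V t * Ye t))
    (- (be t / (2 * B t) * (Ye t * V t * Y3 t))) p.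
Proof.
intros ht; destruct (hN t p ht) as [hA [hB [h1 h2]]].
unfold covd; rewrite vpd_Ph_rt, vpd_Ph_Y.
apply vec_ext;
  rewrite (chris_sum N (Y t p) (A t) (B t) (al t) (be t)) by (auto; lra);
  unfold Y; simpl; ring [(sin_sqr' p)].
Qed.

Lemma normal_part_ax t p a0 ae a3 : 0 < t < PI ->
  normal_part N Y t p (axv a0 ae a3 p) =
  let m := (- A t * a0 * T0 t + B t * (ae * Te t + a3 * T3 t)) / Eth t in
  axv (a0 - m * T0 t) (ae - m * Te t) (a3 - m * T3 t) p.
Proof.
intros ht; unfold normal_part, sum2.
rewrite !vpd_Th_Y, !vpd_Ph_Y, !inv_induced_axial, !axE, !rtE by assumption.
rewrite ip_ax_ax, ip_ax_rt by assumption.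
apply vec_ext; simpl; unfold Rdiv; ring.
Qed.

Definition tr0 (t : R) : R :=
  / Eth t * (Derive T0 t + gam0 (A t) (al t) (Ye t) (Y3 t) (T0 t) (Te t) (T3 t) (T0 t) (Te t) (T3 t)).
Definition tre (t : R) : R :=
  / Eth t * (Derive Te t + game (B t) (al t) (be t) (Ye t) (Y3 t) (T0 t) (Te t) (T3 t) (T0 t) (Te t) (T3 t))
  - / Gph t * (Ye t + be t / (2 * B t) * (Ye t * Ye t * Ye t)).
Definition tr3 (t : R) : R :=
  / Eth t * (Derive T3 t + gam3 (B t) (al t) (be t) (Ye t) (Y3 t) (T0 t) (Te t) (T3 t) (T0 t) (Te t) (T3 t))
  - / Gph t * (be t / (2 * B t) * (Ye t * Ye t * Y3 t)).
Definition trt (t : R) : R :=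
  (- A t * tr0 t * T0 t + B t * (tre t * Te t + tr3 t * T3 t)) / Eth t.

Lemma mean_curv_axial t p : 0 < t < PI ->
  mean_curv N Y t p =
  axv (tr0 t - trt t * T0 t) (tre t - trt t * Te t) (tr3 t - trt t * T3 t) p.
Proof.
intros ht; unfold mean_curv, sum2; rewrite !inv_induced_axial by assumption.
rewrite vpd_Th_Y, vpd_Ph_Y, covd_Th_ax, covd_Ph_rt, !normal_part_ax by assumption.
unfold trt, tr0, tre, tr3; cbv zeta.
apply vec_ext; simpl; unfold Rdiv; ring.
Qed.

Lemma mean_curv_norm_axial t p H0 He H3 : 0 < t < PI ->
  mean_curv N Y t p = axv H0 He H3 p ->
  mean_curv_norm N Y t p = sqrt (- A t * H0 ^ 2 + B t * (He ^ 2 + H3 ^ 2)).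
Proof.
intros ht hH; unfold mean_curv_norm; rewrite hH, ip_ax_ax by assumption.
f_equal; ring.
Qed.

Lemma is_J_axv t p H0 He H3 j0 je j3 : 0 < t < PI ->
  mean_curv N Y t p = axv H0 He H3 p ->
  0 < - A t * H0 ^ 2 + B t * (He ^ 2 + H3 ^ 2) ->
  0 < j0 ->
  - A t * j0 * T0 t + B t * (je * Te t + j3 * T3 t) = 0 ->
  - A t * j0 * H0 + B t * (je * He + j3 * H3) = 0 ->
  A t * j0 ^ 2 - B t * (je ^ 2 + j3 ^ 2) = - A t * H0 ^ 2 + B t * (He ^ 2 + H3 ^ 2) ->
  is_J N Y t p (axv j0 je j3 p).
Proof.
intros ht hH hpos hj hT hjH hn; destruct (hN t p ht) as [hA [hB [h1 _]]].
unfold is_J; cbv zeta; rewrite hH; repeat split.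
- intros []; rewrite ?vpd_Th_Y, ?vpd_Ph_Y, ?axE, ?rtE.
  + now rewrite ip_ax_ax.
  + now rewrite ip_ax_rt.
- unfold timelike; rewrite ip_ax_ax by assumption. lra.
- unfold future_directed, ip, sum4; rewrite h1; simpl; nra.
- now rewrite ip_ax_ax.
- rewrite !ip_ax_ax by assumption; lra.
Qed.

(** The orthogonality relations are linear and determine [J] up to a factor; the norm fixes the
    square of the factor, and future direction its sign. *)
Lemma is_J_unique t p H0 He H3 J J' : 0 < t < PI ->
  mean_curv N Y t p = axv H0 He H3 p ->
  0 < - A t * H0 ^ 2 + B t * (He ^ 2 + H3 ^ 2) ->
  - A t * H0 * T0 t + B t * (He * Te t + H3 * T3 t) = 0 ->
  is_J N Y t p J -> is_J N Y t p J' -> J = J'.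
Proof.
intros ht hH hpos hHT; destruct (hN t p ht) as [hA [hB [h1 _]]].
specialize (hE t ht); specialize (hG t ht); unfold Eth, Gph in *.
assert (yn : Ye t <> 0) by (intros y; rewrite y in *; lra).
(* The determinant of the linear system. The meridian tangent and [H] are spacelike and orthogonal,
   so the product of their squared norms is positive; the identity below writes it as [B^2 d^2]
   minus a nonnegative term, which excludes [d = 0]. *)
set (d := Te t * H3 - T3 t * He).
assert (dn : d <> 0).
{ intros d0.
  assert (0 < (- A t * T0 t ^ 2 + B t * (Te t ^ 2 + T3 t ^ 2))
    * (- A t * H0 ^ 2 + B t * (He ^ 2 + H3 ^ 2))) by now apply Rmult_lt_0_compat.
  assert ((- A t * T0 t ^ 2 + B t * (Te t ^ 2 + T3 t ^ 2))
    * (- A t * H0 ^ 2 + B t * (He ^ 2 + H3 ^ 2)) =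
    (- A t * H0 * T0 t + B t * (He * Te t + H3 * T3 t)) ^ 2 + B t ^ 2 * d ^ 2
    - A t * B t * ((T0 t * He - Te t * H0) ^ 2 + (T0 t * H3 - T3 t * H0) ^ 2))
    by (unfold d; ring).
  rewrite hHT, d0 in *.
  assert (0 <= A t * B t * ((T0 t * He - Te t * H0) ^ 2 + (T0 t * H3 - T3 t * H0) ^ 2)).
  { apply Rmult_le_pos; [nra|]. apply Rplus_le_le_0_compat; apply pow2_ge_0. }
  lra. }
(* Cramer's rule for the ratios of the spatial components of [J] to its time component. *)
set (ce := A t / B t * (T0 t * H3 - T3 t * H0) / d).
set (c3 := A t / B t * (Te t * H0 - He * T0 t) / d).
assert (key : forall V, is_J N Y t p V -> 0 < V i0 /\
  V = axv (V i0) (ce * V i0) (c3 * V i0) p /\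
  V i0 ^ 2 * (- A t + B t * (ce ^ 2 + c3 ^ 2)) = - (- A t * H0 ^ 2 + B t * (He ^ 2 + H3 ^ 2))).
{ intros V [ho [_ [hf [hh hn]]]].
  unfold future_directed, ip, sum4 in hf; rewrite h1 in hf; simpl in hf.
  assert (V0 : 0 < V i0) by nra.
  assert (hp := ho Ph); assert (htt := ho Th); rewrite vpd_Th_Y, axE in htt; rewrite vpd_Ph_Y, rtE in hp.
  rewrite hH in hh, hn.
  set (x := V i1 * sin p + V i2 * cos p).
  assert (hc : V i1 * cos p = V i2 * sin p).
  { unfold ip, sum4 in hp; rewrite h1 in hp; simpl in hp.
    apply (Rmult_eq_reg_l (B t * Ye t)); [lra|]. apply Rmult_integral_contrapositive; lra. }
  assert (hs := sin_sqr' p).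
  (* Orthogonality to the orthoradial tangent vector, in the form [hc], puts [V] into the moving
     plane of the [axv] vectors. *)
  assert (hV : V = axv (V i0) x (V i3) p).
  { apply vec_ext; simpl; try reflexivity; unfold x.
    - replace ((V i1 * sin p + V i2 * cos p) * sin p) with
       (V i1 * (sin p * sin p) + cos p * (V i2 * sin p)) by ring.
      rewrite <- hc, hs; ring.
    - replace ((V i1 * sin p + V i2 * cos p) * cos p) with
       (V i2 * (cos p * cos p) + sin p * (V i1 * cos p)) by ring.
      rewrite hc. replace (sin p * (V i2 * sin p)) with (V i2 * (sin p * sin p)) by ring.
      rewrite hs; ring. }
  rewrite hV, ip_ax_ax in htt by assumption; rewrite hV, ip_ax_ax in hh by assumption.
  rewrite hV, !ip_ax_ax in hn by assumption.
  assert (ex : x = ce * V i0).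
  { apply (Rmult_eq_reg_r (B t * d)); [|apply Rmult_integral_contrapositive; lra].
    unfold ce. replace (A t / B t * (T0 t * H3 - T3 t * H0) / d * V i0 * (B t * d))
      with (A t * (T0 t * H3 - T3 t * H0) * V i0) by (field; lra).
    assert (c1 := f_equal (fun y => H3 * y) htt); assert (c2 := f_equal (fun y => T3 t * y) hh).
    unfold d; cbv beta in c1, c2; lra. }
  assert (e3 : V i3 = c3 * V i0).
  { apply (Rmult_eq_reg_r (B t * d)); [|apply Rmult_integral_contrapositive; lra].
    unfold c3. replace (A t / B t * (Te t * H0 - He * T0 t) / d * V i0 * (B t * d))
      with (A t * (Te t * H0 - He * T0 t) * V i0) by (field; lra).
    assert (c1 := f_equal (fun y => He * y) htt); assert (c2 := f_equal (fun y => Te t * y) hh).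
    unfold d; cbv beta in c1, c2; lra. }
  split; [assumption|split].
  - rewrite <- ex, <- e3; assumption.
  - rewrite ex, e3 in hn. lra. }
intros hJ hJ'; destruct (key J hJ) as [p1 [e1 n1]], (key J' hJ') as [p2 [e2 n2]].
assert (E : J i0 = J' i0).
{ assert (nz : - A t + B t * (ce ^ 2 + c3 ^ 2) <> 0) by (intros z; rewrite z in n1; lra).
  assert (J i0 ^ 2 = J' i0 ^ 2) by (apply (Rmult_eq_reg_r _ _ _ (eq_trans n1 (eq_sym n2)) nz)).
  nra. }
rewrite e1, e2, E; reflexivity.
Qed.

(** Uniqueness turns the epsilon choice into an explicit vector: any solution of [is_J] is its
    value. *)
Lemma Jfield_axial t p H0 He H3 J : 0 < t < PI ->
  mean_curv N Y t p = axv H0 He H3 p ->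
  0 < - A t * H0 ^ 2 + B t * (He ^ 2 + H3 ^ 2) ->
  - A t * H0 * T0 t + B t * (He * Te t + H3 * T3 t) = 0 ->
  is_J N Y t p J -> Jfield N Y t p = J.
Proof.
intros ht hH hpos hHT hJ.
apply (is_J_unique t p H0 He H3); auto.
unfold Jfield; apply epsilon_spec; now exists J.
Qed.

Lemma locally_Ioo (t : R) (P : R -> Prop) : 0 < t < PI ->
  (forall s, 0 < s < PI -> P s) -> locally t P.
Proof.
intros ht h.
assert (lt : locally t (fun s => 0 < s < PI)).
{ apply filter_and; [apply (open_gt 0)|apply (open_lt PI)]; tauto. }
revert lt; apply filter_imp; assumption.
Qed.

(** The field [J] is known explicitly only between the poles; differentiation in theta is local, so
    agreement on the open interval is enough. *)
Lemma covd_ext a V V' t p : 0 < t < PI ->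
  (forall s q, 0 < s < PI -> V s q = V' s q) -> covd N Y a V t p = covd N Y a V' t p.
Proof.
intros ht h; unfold covd; apply functional_extensionality; intros k; f_equal.
- unfold vpd, pd; destruct a.
  + apply Derive_ext_loc; apply locally_Ioo; [assumption|]; intros s hs; now rewrite h.
  + apply Derive_ext; intros q; now rewrite h.
- now rewrite h.
Qed.

Lemma normal_connection_axial (w : tidx -> R) j0 je j3 t p H0 He H3 : 0 < t < PI ->
  mean_curv N Y t p = axv H0 He H3 p ->
  (forall s q, 0 < s < PI ->
     vscal (/ mean_curv_norm N Y s q) (Jfield N Y s q) = axv (j0 s) (je s) (j3 s) q) ->
  normal_connection N Y w t p = w Th * / mean_curv_norm N Y t p *
   (- A t * (Derive j0 t + gam0 (A t) (al t) (Ye t) (Y3 t) (T0 t) (Te t) (T3 t) (j0 t) (je t) (j3 t)) * H0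
    + B t * ((Derive je t + game (B t) (al t) (be t) (Ye t) (Y3 t) (T0 t) (Te t) (T3 t) (j0 t) (je t) (j3 t)) * He
    + (Derive j3 t + gam3 (B t) (al t) (be t) (Ye t) (Y3 t) (T0 t) (Te t) (T3 t) (j0 t) (je t) (j3 t)) * H3)).
Proof.
intros ht hH hJ; unfold normal_connection; cbv zeta.
rewrite hH; unfold sum2.
rewrite (covd_ext Th _ (ax j0 je j3)), (covd_ext Ph _ (ax j0 je j3)) by assumption.
rewrite covd_Th_ax, covd_Ph_ax by assumption.
set (mcn := mean_curv_norm N Y t p).
unfold ip, sum4; destruct (hN t p ht) as [_ [_ [h1 _]]]; rewrite h1; simpl; unfold vscal; simpl.
ring [(sin_sqr' p)].
Qed.

Lemma grad_axial f a t p : 0 < t < PI ->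
  grad N Y f a t p = match a with Th => / Eth t * pd Th f t p | Ph => / Gph t * pd Ph f t p end.
Proof.
intros ht; unfold grad, sum2; destruct a; rewrite !inv_induced_axial by assumption; ring.
Qed.

Lemma grad_sq_axial f t p : 0 < t < PI ->
  grad_sq N Y f t p = / Eth t * pd Th f t p ^ 2 + / Gph t * pd Ph f t p ^ 2.
Proof.
intros ht; unfold grad_sq, sum2; rewrite !grad_axial, !induced_axial by assumption.
specialize (hE t ht); specialize (hG t ht); field; lra.
Qed.

Lemma laplacian_axial f t p : 0 < t < PI ->
  laplacian N Y f t p = / sqrt (Eth t * Gph t) *
   (Derive (fun s => sqrt (Eth s * Gph s) * (/ Eth s * pd Th f s p)) t
    + Derive (fun q => sqrt (Eth t * Gph t) * (/ Gph t * pd Ph f t q)) p).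
Proof.
intros ht; unfold laplacian, sum2; rewrite area_axial by assumption.
f_equal; f_equal; unfold pd at 1.
- apply Derive_ext_loc, locally_Ioo; [assumption|]; intros s hs.
  now rewrite area_axial, grad_axial.
- apply Derive_ext; intros q; now rewrite area_axial, grad_axial.
Qed.

(** * Orthonormal frames of the normal bundle *)

Variables (m S n10 n1e n13 n20 n2e n23 : R -> R).
Let C t := sqrt (1 + S t ^ 2).

Definition dot (t a0 ae a3 c0 ce c3 : R) : R := - A t * a0 * c0 + B t * (ae * ce + a3 * c3).

Definition nabla0 (V0 Ve V3 : R -> R) (t : R) : R :=
  Derive V0 t + gam0 (A t) (al t) (Ye t) (Y3 t) (T0 t) (Te t) (T3 t) (V0 t) (Ve t) (V3 t).
Definition nablae (V0 Ve V3 : R -> R) (t : R) : R :=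
  Derive Ve t + game (B t) (al t) (be t) (Ye t) (Y3 t) (T0 t) (Te t) (T3 t) (V0 t) (Ve t) (V3 t).
Definition nabla3 (V0 Ve V3 : R -> R) (t : R) : R :=
  Derive V3 t + gam3 (B t) (al t) (be t) (Ye t) (Y3 t) (T0 t) (Te t) (T3 t) (V0 t) (Ve t) (V3 t).

(** In this section [A] and [B] are mere functions of the parameter. The chain rule along the
    meridian ties their derivatives to the gradients [al y] and [be y], and metric compatibility
    rests on it. *)
Definition metric_derivative : Prop := forall t, 0 < t < PI ->
  is_derive A t (al t * (Te t * Ye t + T3 t * Y3 t)) /\
  is_derive B t (be t * (Te t * Ye t + T3 t * Y3 t)).

(** The Leibniz rule along the meridian. For the frame vectors, whose products are constant, it says
    that the connection coefficients are antisymmetric. *)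
Lemma metric_compatible V0 Ve V3 W0 We W3 t c : metric_derivative -> 0 < t < PI ->
  ex_derive V0 t -> ex_derive Ve t -> ex_derive V3 t ->
  ex_derive W0 t -> ex_derive We t -> ex_derive W3 t ->
  (forall s, 0 < s < PI -> dot s (V0 s) (Ve s) (V3 s) (W0 s) (We s) (W3 s) = c) ->
  dot t (nabla0 V0 Ve V3 t) (nablae V0 Ve V3 t) (nabla3 V0 Ve V3 t) (W0 t) (We t) (W3 t)
  + dot t (V0 t) (Ve t) (V3 t) (nabla0 W0 We W3 t) (nablae W0 We W3 t) (nabla3 W0 We W3 t) = 0.
Proof.
intros hd ht d1 d2 d3 d4 d5 d6 hc.
destruct (hN t 0 ht) as [hA [hB _]]; destruct (hd t ht) as [dA dB].
assert (D0 : Derive (fun s => dot s (V0 s) (Ve s) (V3 s) (W0 s) (We s) (W3 s)) t = 0).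
{ rewrite <- (Derive_const c t); apply Derive_ext_loc, locally_Ioo; assumption. }
assert (D1 : is_derive (fun s => dot s (V0 s) (Ve s) (V3 s) (W0 s) (We s) (W3 s)) t
  (- Derive A t * V0 t * W0 t - A t * Derive V0 t * W0 t - A t * V0 t * Derive W0 t
   + Derive B t * (Ve t * We t + V3 t * W3 t)
   + B t * (Derive Ve t * We t + Ve t * Derive We t + Derive V3 t * W3 t + V3 t * Derive W3 t))).
{ unfold dot; auto_derive; [repeat split; try assumption; eexists; eassumption|].
  eta_Derive; ring. }
assert (D2 := eq_trans (eq_sym D0) (is_derive_unique _ _ _ D1)).
rewrite (is_derive_unique _ _ _ dA), (is_derive_unique _ _ _ dB) in D2.
rewrite D2; unfold dot, nabla0, nablae, nabla3, gam0, game, gam3; field; lra.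
Qed.

(** A spacelike unit normal [n1] and a timelike unit normal [n2] with [H = m (S n2 - C n1)]. Thus
    [m] is [|H|], [S] and [C] are the hyperbolic sine and cosine of the rapidity, and [J / |H|] has
    to be [C n2 - S n1]; the positivity of its time component makes it future directed. *)
Definition adapted_frame : Prop := forall t, 0 < t < PI ->
  dot t (n10 t) (n1e t) (n13 t) (n10 t) (n1e t) (n13 t) = 1 /\
  dot t (n20 t) (n2e t) (n23 t) (n20 t) (n2e t) (n23 t) = -1 /\
  dot t (n10 t) (n1e t) (n13 t) (n20 t) (n2e t) (n23 t) = 0 /\
  dot t (n10 t) (n1e t) (n13 t) (T0 t) (Te t) (T3 t) = 0 /\
  dot t (n20 t) (n2e t) (n23 t) (T0 t) (Te t) (T3 t) = 0 /\
  0 < m t /\ 0 < C t * n20 t - S t * n10 t /\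
  forall p, mean_curv N Y t p = axv (m t * (S t * n20 t - C t * n10 t))
    (m t * (S t * n2e t - C t * n1e t)) (m t * (S t * n23 t - C t * n13 t)) p.

Hypothesis hF : adapted_frame.

Lemma C_sqr t : C t ^ 2 = 1 + S t ^ 2.
Proof. apply pow2_sqrt; pose proof (pow2_ge_0 (S t)); lra. Qed.

Lemma C_pos t : 0 < C t.
Proof. apply sqrt_lt_R0; pose proof (pow2_ge_0 (S t)); lra. Qed.

Lemma frame_norm t : 0 < t < PI ->
  - A t * (m t * (S t * n20 t - C t * n10 t)) ^ 2
  + B t * ((m t * (S t * n2e t - C t * n1e t)) ^ 2 + (m t * (S t * n23 t - C t * n13 t)) ^ 2)
  = m t ^ 2.
Proof.
intros ht; destruct (hF t ht) as [f1 [f2 [f3 _]]].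
transitivity (m t ^ 2 * (S t ^ 2 * dot t (n20 t) (n2e t) (n23 t) (n20 t) (n2e t) (n23 t)
  - 2 * S t * C t * dot t (n10 t) (n1e t) (n13 t) (n20 t) (n2e t) (n23 t)
  + C t ^ 2 * dot t (n10 t) (n1e t) (n13 t) (n10 t) (n1e t) (n13 t))).
- unfold dot; ring.
- rewrite f1, f2, f3, C_sqr; ring.
Qed.

Lemma mean_curv_norm_frame t p : 0 < t < PI -> mean_curv_norm N Y t p = m t.
Proof.
intros ht; destruct (hF t ht) as [_ [_ [_ [_ [_ [hm [_ hH]]]]]]].
rewrite (mean_curv_norm_axial _ _ _ _ _ ht (hH p)), frame_norm by assumption.
apply sqrt_pow2; lra.
Qed.

Lemma spacelike_frame t p : 0 < t < PI ->
  spacelike_surface N Y t p /\ spacelike_mean_curv N Y t p.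
Proof.
intros ht; destruct (hF t ht) as [_ [_ [_ [_ [_ [hm [_ hH]]]]]]]; split.
- unfold spacelike_surface; rewrite detind_axial, induced_axial by assumption.
  specialize (hE t ht); specialize (hG t ht); split; [assumption|now apply Rmult_lt_0_compat].
- unfold spacelike_mean_curv; rewrite hH, ip_ax_ax by assumption.
  assert (h := frame_norm t ht); assert (0 < m t ^ 2) by (apply pow_lt; lra). lra.
Qed.

Lemma Jfield_frame t p : 0 < t < PI -> vscal (/ mean_curv_norm N Y t p) (Jfield N Y t p) =
  axv (C t * n20 t - S t * n10 t) (C t * n2e t - S t * n1e t) (C t * n23 t - S t * n13 t) p.
Proof.
intros ht; rewrite mean_curv_norm_frame by assumption.
destruct (hF t ht) as [f1 [f2 [f3 [f4 [f5 [hm [hj hH]]]]]]].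
assert (fn := frame_norm t ht).
assert (0 < m t ^ 2) by (apply pow_lt; lra).
rewrite (Jfield_axial t p _ _ _ (axv (m t * (C t * n20 t - S t * n10 t))
   (m t * (C t * n2e t - S t * n1e t)) (m t * (C t * n23 t - S t * n13 t)) p) ht (hH p)).
- apply vec_ext; unfold vscal; simpl; field; lra.
- rewrite fn; assumption.
- transitivity (m t * (S t * dot t (n20 t) (n2e t) (n23 t) (T0 t) (Te t) (T3 t)
    - C t * dot t (n10 t) (n1e t) (n13 t) (T0 t) (Te t) (T3 t))).
  + unfold dot; ring.
  + rewrite f4, f5; ring.
- apply (is_J_axv _ _ _ _ _ _ _ _ ht (hH p)).
  + rewrite fn; assumption.
  + now apply Rmult_lt_0_compat.
  + transitivity (m t * (C t * dot t (n20 t) (n2e t) (n23 t) (T0 t) (Te t) (T3 t)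
    - S t * dot t (n10 t) (n1e t) (n13 t) (T0 t) (Te t) (T3 t))).
    * unfold dot; ring.
    * rewrite f4, f5; ring.
  + transitivity (m t ^ 2 * (C t * S t * dot t (n20 t) (n2e t) (n23 t) (n20 t) (n2e t) (n23 t)
     + C t * S t * dot t (n10 t) (n1e t) (n13 t) (n10 t) (n1e t) (n13 t)
     - (C t ^ 2 + S t ^ 2) * dot t (n10 t) (n1e t) (n13 t) (n20 t) (n2e t) (n23 t))).
    * unfold dot; ring.
    * rewrite f1, f2, f3; ring.
  + rewrite fn.
    transitivity (- m t ^ 2 * (C t ^ 2 * dot t (n20 t) (n2e t) (n23 t) (n20 t) (n2e t) (n23 t)
     + S t ^ 2 * dot t (n10 t) (n1e t) (n13 t) (n10 t) (n1e t) (n13 t)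
     - 2 * C t * S t * dot t (n10 t) (n1e t) (n13 t) (n20 t) (n2e t) (n23 t))).
    * unfold dot; ring.
    * rewrite f1, f2, f3, C_sqr; ring.
Qed.

(* Only the rapidity [arcsinh S] of the mean curvature vector relative to the frame and
   the connection form of the frame itself contribute. *)
Lemma normal_connection_frame (w : tidx -> R) t p : 0 < t < PI -> metric_derivative ->
  ex_derive S t ->
  ex_derive n10 t -> ex_derive n1e t -> ex_derive n13 t ->
  ex_derive n20 t -> ex_derive n2e t -> ex_derive n23 t ->
  normal_connection N Y w t p = w Th * (Derive S t / sqrt (1 + S t ^ 2)
    - dot t (nabla0 n20 n2e n23 t) (nablae n20 n2e n23 t) (nabla3 n20 n2e n23 t)
        (n10 t) (n1e t) (n13 t)).
Proof.
intros ht hd dS d1 d2 d3 d4 d5 d6.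
assert (hF' := hF).
destruct (hF t ht) as [f1 [f2 [f3 [f4 [f5 [hm [hj hH]]]]]]].
rewrite (normal_connection_axial w (fun t => C t * n20 t - S t * n10 t)
  (fun t => C t * n2e t - S t * n1e t) (fun t => C t * n23 t - S t * n13 t) t p _ _ _ ht (hH p)).
2:{ intros s q hs; now apply Jfield_frame. }
rewrite mean_curv_norm_frame by assumption.
assert (cp := C_pos t); assert (c2 := C_sqr t).
assert (dC : is_derive C t (S t * Derive S t / C t)).
{ unfold C; auto_derive.
  - split; [assumption|split; [|easy]]. pose proof (pow2_ge_0 (S t)); simpl in *; lra.
  - eta_Derive; simpl. unfold C. simpl in *. field. unfold C in cp; simpl in cp; lra. }
assert (exC : ex_derive C t) by (eexists; exact dC).
assert (D : forall n2 n1 : R -> R, ex_derive n1 t -> ex_derive n2 t ->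
  Derive (fun t => C t * n2 t - S t * n1 t) t =
  S t * Derive S t / C t * n2 t + C t * Derive n2 t - Derive S t * n1 t - S t * Derive n1 t).
{ intros n2 n1 e1 e2; apply is_derive_unique; auto_derive; [repeat split; assumption|].
  eta_Derive; rewrite (is_derive_unique _ _ _ dC); ring. }
rewrite !D by assumption; clear D.
assert (c11 := metric_compatible n10 n1e n13 n10 n1e n13 t 1 hd ht d1 d2 d3 d1 d2 d3
  (fun s hs => proj1 (hF' s hs))).
assert (c22 := metric_compatible n20 n2e n23 n20 n2e n23 t (-1) hd ht d4 d5 d6 d4 d5 d6
  (fun s hs => proj1 (proj2 (hF' s hs)))).
assert (c12 := metric_compatible n10 n1e n13 n20 n2e n23 t 0 hd ht d1 d2 d3 d4 d5 d6
  (fun s hs => proj1 (proj2 (proj2 (hF' s hs))))).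
set (D2 := dot t (nabla0 n20 n2e n23 t) (nablae n20 n2e n23 t) (nabla3 n20 n2e n23 t)
        (n10 t) (n1e t) (n13 t)).
set (q11 := dot t (nabla0 n10 n1e n13 t) (nablae n10 n1e n13 t) (nabla3 n10 n1e n13 t)
        (n10 t) (n1e t) (n13 t)).
set (q12 := dot t (nabla0 n10 n1e n13 t) (nablae n10 n1e n13 t) (nabla3 n10 n1e n13 t)
        (n20 t) (n2e t) (n23 t)).
set (q22 := dot t (nabla0 n20 n2e n23 t) (nablae n20 n2e n23 t) (nabla3 n20 n2e n23 t)
        (n20 t) (n2e t) (n23 t)).
assert (sym : forall a b c a' b' c', dot t a b c a' b' c' = dot t a' b' c' a b c)
  by (intros; unfold dot; ring).
rewrite (sym (n10 t)) in c11; fold q11 in c11.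
rewrite (sym (n20 t)) in c22; fold q22 in c22.
rewrite (sym (n10 t)) in c12; fold q12 D2 in c12.
change (sqrt (1 + S t ^ 2)) with (C t).
transitivity (w Th * / m t * (m t * (
   (S t * Derive S t / C t) * (S t * dot t (n20 t) (n2e t) (n23 t) (n20 t) (n2e t) (n23 t)
       - C t * dot t (n10 t) (n1e t) (n13 t) (n20 t) (n2e t) (n23 t))
   - Derive S t * (S t * dot t (n10 t) (n1e t) (n13 t) (n20 t) (n2e t) (n23 t)
       - C t * dot t (n10 t) (n1e t) (n13 t) (n10 t) (n1e t) (n13 t))
   + C t * (S t * q22 - C t * D2) - S t * (S t * q12 - C t * q11)))).
- f_equal; unfold D2, q11, q12, q22, dot, nabla0, nablae, nabla3, gam0, game, gam3.
  destruct (hN t 0 ht) as [hA [hB _]]; field; lra.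
(* Differentiating the orthonormality relations gives [q11 = q22 = 0] and [q12 = - D2], so the frame
   enters only through [D2], with coefficient [C^2 - S^2 = 1] up to sign. *)
- rewrite f1, f2, f3. replace q22 with 0 by lra; replace q11 with 0 by lra.
  replace q12 with (- D2) by lra.
  replace (C t * (S t * 0 - C t * D2) - S t * (S t * - D2 - C t * 0))
    with (- (C t ^ 2 - S t ^ 2) * D2) by ring.
  transitivity (w Th * (Derive S t * (C t ^ 2 - S t ^ 2) / C t - (C t ^ 2 - S t ^ 2) * D2)).
  + field; lra.
  + rewrite c2; field; lra.
Qed.

End Axial.

(** * The Schwarzschild connection *)

Lemma is_derive_rho p i : i <> i0 -> 0 < rho p ->
  is_derive (fun t => rho (upd p i t)) (p i) (p i / rho p).
Proof.
intros hi hr.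
assert (h : 0 < p i1 ^ 2 + p i2 ^ 2 + p i3 ^ 2).
{ destruct (Rle_lt_dec (p i1 ^ 2 + p i2 ^ 2 + p i3 ^ 2) 0) as [l|l]; [|assumption].
  unfold rho in hr; rewrite sqrt_neg_0 in hr; lra. }
unfold rho in *; destruct i; [easy| | |]; unfold upd; simpl idx_eqb; cbv iota; auto_derive;
  try (simpl in *; repeat split; lra); simpl in *; field; lra.
Qed.

(** With [conf], the literal unfolding of [1 / Fsq] and [1 / Gsq] as functions of the radius, so
    that radial derivatives transfer to [schwarzschild] by conversion. *)
Definition lapse_sqr (M x : R) : R :=
  1 / ((1 + M / (2 * x)) ^ 2 / (1 - M / (2 * x)) ^ 2).
Definition conf (M x : R) : R := 1 / (1 / (1 + M / (2 * x)) ^ 4).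

Lemma half_mass_pos M x : 0 < M -> 0 < x -> 0 < M / (2 * x).
Proof. intros; apply Rdiv_lt_0_compat; lra. Qed.

Lemma is_derive_lapse_sqr M x : 0 < M -> 0 < x -> 0 < 1 - M / (2 * x) ->
  is_derive (lapse_sqr M) x
   (2 * M * (1 - M / (2 * x)) / (x ^ 2 * (1 + M / (2 * x)) ^ 3)).
Proof.
intros hM hx hm; assert (hp := half_mass_pos M x hM hx).
apply (is_derive_ext_loc (fun x => ((1 - M / (2 * x)) / (1 + M / (2 * x))) ^ 2)).
{ assert (l : locally x (fun y => M / 2 < y)).
  { apply (open_gt (M / 2)).
    apply (Rmult_lt_reg_r (/ x)); [now apply Rinv_0_lt_compat|].
    replace (M / 2 * / x) with (M / (2 * x)) by (field; lra).
    rewrite Rinv_r; lra. }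
  revert l; apply filter_imp; intros y hy; unfold lapse_sqr.
  assert (0 < M / (2 * y)) by (apply half_mass_pos; lra).
  assert (M / (2 * y) < 1).
  { apply (Rmult_lt_reg_r (2 * y)); [lra|].
    replace (M / (2 * y) * (2 * y)) with M by (field; lra). lra. }
  set (m := M / (2 * y)) in *.
  match goal with |- @eq _ ?a ?c => change (@eq R a c) end; field; lra. }
auto_derive; [repeat split; lra|].
assert (0 < 2 * x + M) by lra.
field; repeat split; lra.
Qed.

Lemma is_derive_conf M x : 0 < M -> 0 < x ->
  is_derive (conf M) x (- 2 * M * (1 + M / (2 * x)) ^ 3 / x ^ 2).
Proof.
intros hM hx; assert (hp := half_mass_pos M x hM hx).
apply (is_derive_ext_loc (fun x => (1 + M / (2 * x)) ^ 4)).
{ assert (l : locally x (fun y => 0 < y)) by now apply (open_gt 0).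
  revert l; apply filter_imp; intros y hy; unfold conf.
  assert (0 < M / (2 * y)) by (apply half_mass_pos; lra).
  set (m := M / (2 * y)) in *.
  match goal with |- @eq _ ?a ?c => change (@eq R a c) end; field; lra. }
auto_derive; [lra|].
field; lra.
Qed.

Lemma dgcomp_schwarzschild M p i j k : 0 < M -> 0 < rho p -> 0 < 1 - M / (2 * rho p) ->
  dgcomp (schwarzschild M) i j k p = if idx_eqb j k then
    match j with
    | i0 => - (2 * M * (1 - M / (2 * rho p)) / (rho p ^ 3 * (1 + M / (2 * rho p)) ^ 3)) * spatial p i
    | _ => - 2 * M * (1 + M / (2 * rho p)) ^ 3 / rho p ^ 3 * spatial p i
    end else 0.
Proof.
intros hM hr hm; assert (hp := half_mass_pos M (rho p) hM hr).
assert (U : upd p i (p i) = p).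
{ apply vec_ext; destruct i; reflexivity. }
unfold dgcomp, gcomp; destruct (idx_eqb j k); [|apply Derive_const].
assert (E0 : i = i0 -> forall t, rho (upd p i t) = rho p) by (intros ->; reflexivity).
destruct (idx_eqb i i0) eqn:ei.
{ assert (i = i0) as -> by (destruct i; easy).
  transitivity 0; [|destruct j; simpl; ring].
  rewrite <- (Derive_const (schwarzschild M p j) (p i0)); apply Derive_ext.
  intros t; unfold schwarzschild, Fsq, Gsq; now rewrite E0. }
assert (hi : i <> i0) by (destruct i; easy).
assert (hs : spatial p i = p i) by (destruct i; easy); rewrite hs.
assert (dr := is_derive_rho p i hi hr).
assert (C : is_derive (fun t => conf M (rho (upd p i t))) (p i)
  (- 2 * M * (1 + M / (2 * rho p)) ^ 3 / rho p ^ 3 * p i)).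
{ assert (d := is_derive_conf M (rho p) hM hr).
  rewrite <- U in d at 1.
  assert (dc := is_derive_comp (conf M) (fun t => rho (upd p i t)) _ _ _ d dr).
  replace (- 2 * M * (1 + M / (2 * rho p)) ^ 3 / rho p ^ 3 * p i) with
    (p i / rho p * (- 2 * M * (1 + M / (2 * rho p)) ^ 3 / rho p ^ 2)); [exact dc|].
  set (q := M / (2 * rho p)); field; lra. }
assert (L : is_derive (fun t => - lapse_sqr M (rho (upd p i t))) (p i)
  (- (2 * M * (1 - M / (2 * rho p)) / (rho p ^ 3 * (1 + M / (2 * rho p)) ^ 3)) * p i)).
{ assert (d := is_derive_lapse_sqr M (rho p) hM hr hm).
  rewrite <- U in d at 1.
  assert (dc := is_derive_opp _ _ _ (is_derive_comp (lapse_sqr M) (fun t => rho (upd p i t)) _ _ _ d dr)).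
  replace (- (2 * M * (1 - M / (2 * rho p)) / (rho p ^ 3 * (1 + M / (2 * rho p)) ^ 3)) * p i) with
    (- (p i / rho p * (2 * M * (1 - M / (2 * rho p)) / (rho p ^ 2 * (1 + M / (2 * rho p)) ^ 3))));
    [exact dc|].
  set (q := M / (2 * rho p)) in *; field; lra. }
destruct j; apply is_derive_unique; assumption.
Qed.

(** * The energy density as a function of the mean curvatures *)

(* [y] and [x] stand for the norms of the mean curvature vectors in Minkowski space and in [N],
   [n] for the normal component of the spatial part of the observer. *)
Definition Psi (A n y x : R) : R :=
  y * A - sqrt (x ^ 2 * (A ^ 2 - n ^ 2) + (n * y) ^ 2)
  - n * y * (arcsinh (n / sqrt (A ^ 2 - n ^ 2)) - arcsinh (n * y / (sqrt (A ^ 2 - n ^ 2) * x))).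

Lemma is_derive_arcsinh x : is_derive arcsinh x (/ sqrt (x ^ 2 + 1)).
Proof. apply is_derive_Reals, derivable_pt_lim_arcsinh. Qed.

(** The share of one mean curvature in the energy density, for [w = sqrt (1 + |grad tau|^2)] and
    [l = lap tau]. At fixed [l] its derivative in [h] is algebraic: the inverse hyperbolic sine
    drops out. *)
Definition phi (w l h : R) : R := sqrt (h ^ 2 * w ^ 2 + l ^ 2) - l * arcsinh (l / (w * h)).

Lemma is_derive_phi w l h : 0 < w -> 0 < h ->
  is_derive (phi w l) h (sqrt (h ^ 2 * w ^ 2 + l ^ 2) / h).
Proof.
intros hw hh.
assert (wh : 0 < w * h) by now apply Rmult_lt_0_compat.
assert (p : 0 < h ^ 2 * w ^ 2 + l ^ 2).
{ pose proof (pow2_ge_0 l); assert (0 < h ^ 2 * w ^ 2); [|lra].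
  apply Rmult_lt_0_compat; apply pow_lt; assumption. }
assert (s0 := sqrt_lt_R0 _ p).
assert (E : sqrt ((l / (w * h)) ^ 2 + 1) = sqrt (h ^ 2 * w ^ 2 + l ^ 2) / (w * h)).
{ replace ((l / (w * h)) ^ 2 + 1) with ((h ^ 2 * w ^ 2 + l ^ 2) * (/ (w * h)) ^ 2) by (field; lra).
  rewrite sqrt_mult, sqrt_pow2; [reflexivity| |lra|apply pow2_ge_0].
  now apply Rlt_le, Rinv_0_lt_compat. }
unfold phi; auto_derive.
- split; [simpl in *; lra|split; [eexists; apply is_derive_arcsinh|split; [lra|easy]]].
- replace (Derive (fun x => arcsinh x) (l * / (w * h))) with
    (/ (sqrt (h ^ 2 * w ^ 2 + l ^ 2) / (w * h))).
  2:{ symmetry; apply is_derive_unique; rewrite <- E; apply is_derive_arcsinh. }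
  assert (S : sqrt (h ^ 2 * w ^ 2 + l ^ 2) ^ 2 = h ^ 2 * w ^ 2 + l ^ 2) by (apply pow2_sqrt; lra).
  replace (sqrt (h * (h * 1) * (w * (w * 1)) + l * (l * 1))) with
    (sqrt (h ^ 2 * w ^ 2 + l ^ 2)) by (f_equal; ring).
  set (T := sqrt (h ^ 2 * w ^ 2 + l ^ 2)) in *.
  field_simplify_eq; [|lra]. replace (T ^ 2) with (h ^ 2 * w ^ 2 + l ^ 2). ring.
Qed.

Lemma Psi_phi A n y x : 0 <= A -> n ^ 2 < A ^ 2 -> 0 < y -> 0 < x ->
  Psi A n y x = phi (sqrt (A ^ 2 - n ^ 2)) (n * y) y - phi (sqrt (A ^ 2 - n ^ 2)) (n * y) x.
Proof.
intros hA hn hy hx; unfold Psi, phi.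
assert (w0 : 0 < sqrt (A ^ 2 - n ^ 2)) by (apply sqrt_lt_R0; lra).
rewrite pow2_sqrt by lra.
replace (y ^ 2 * (A ^ 2 - n ^ 2) + (n * y) ^ 2) with ((y * A) ^ 2) by ring.
rewrite sqrt_pow2 by (apply Rmult_le_pos; lra).
replace (n * y / (sqrt (A ^ 2 - n ^ 2) * y)) with (n / sqrt (A ^ 2 - n ^ 2)) by (field; lra).
ring.
Qed.

(** By the mean value theorem [Psi] is [y - x] times the slope of [phi] at some [h] between [x] and
    [y]. At [h = y] that slope would be exactly [A], because [w^2 + n^2 = A^2], and
    [|y - h| <= |y - x|] makes the error quadratic. *)
Lemma Psi_bound A n y x : 1 <= A -> n ^ 2 < A ^ 2 -> 1 <= y <= 3 -> 1 <= x <= 3 ->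
  Rabs (Psi A n y x - A * (y - x)) <= 6 * A ^ 2 * (y - x) ^ 2.
Proof.
intros hA hn hy hx; rewrite Psi_phi by lra.
set (w := sqrt (A ^ 2 - n ^ 2)).
assert (w0 : 0 < w) by (apply sqrt_lt_R0; lra).
assert (w2 : w ^ 2 = A ^ 2 - n ^ 2) by (apply pow2_sqrt; lra).
assert (mm : 1 <= Rmin x y) by (apply Rmin_glb; lra).
assert (mM : Rmax x y <= 3) by (apply Rmax_lub; lra).
destruct (MVT_gen (phi w (n * y)) x y (fun h => sqrt (h ^ 2 * w ^ 2 + (n * y) ^ 2) / h))
  as [h [hh eq]].
- intros h hh; apply is_derive_phi; lra.
- intros h hh; apply continuity_pt_filterlim, (ex_derive_continuous (V := R_NormedModule)).
  eexists; apply is_derive_phi; lra.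
- rewrite eq.
  replace (sqrt (h ^ 2 * w ^ 2 + (n * y) ^ 2) / h * (y - x) - A * (y - x)) with
    ((sqrt (h ^ 2 * w ^ 2 + (n * y) ^ 2) / h - A) * (y - x)) by ring.
  assert (Hh : 1 <= h <= 3) by lra.
  set (T := sqrt (h ^ 2 * w ^ 2 + (n * y) ^ 2)).
  assert (P0 : 0 <= h ^ 2 * w ^ 2 + (n * y) ^ 2).
  { apply Rplus_le_le_0_compat; [apply Rmult_le_pos|]; apply pow2_ge_0. }
  assert (T0 : 0 <= T) by apply sqrt_pos.
  assert (T2 : T ^ 2 = h ^ 2 * w ^ 2 + (n * y) ^ 2) by now apply pow2_sqrt.
  (* Rationalizing [T - A h] exhibits the factor [y - h]. The constant 6 comes from [y + h <= 6],
     while the denominator is at least 1. *)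
  assert (D : (T / h - A) = n ^ 2 * (y + h) / (h * (T + A * h)) * (y - h)).
  { assert (T2' : T * T = h ^ 2 * (A ^ 2 - n ^ 2) + n ^ 2 * y ^ 2) by (rewrite <- w2; lra).
    assert (0 < T + A * h) by nra.
    apply (Rmult_eq_reg_r (h * (T + A * h))); [|nra].
    replace ((T / h - A) * (h * (T + A * h))) with (T * T - A ^ 2 * h ^ 2) by (field; lra).
    rewrite T2'; field; lra. }
  rewrite D.
  assert (yh : Rabs (y - h) <= Rabs (y - x)).
  { destruct (Rle_dec x y).
    - rewrite Rmin_left, Rmax_right in hh by lra. rewrite !Rabs_pos_eq by lra. lra.
    - rewrite Rmin_right, Rmax_left in hh by lra. rewrite !Rabs_left1 by lra. lra. }
  assert (c0 : 0 <= n ^ 2 * (y + h) / (h * (T + A * h)) <= 6 * A ^ 2).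
  { pose proof (pow2_ge_0 n). assert (1 <= h * (T + A * h)) by nra. split.
    - apply Rmult_le_pos; [nra|]. apply Rlt_le, Rinv_0_lt_compat; lra.
    - apply (Rmult_le_reg_r (h * (T + A * h))); [lra|].
      replace (n ^ 2 * (y + h) / (h * (T + A * h)) * (h * (T + A * h))) with (n ^ 2 * (y + h))
        by (field; nra).
      apply (Rle_trans _ (A ^ 2 * 6)); [apply Rmult_le_compat; lra|].
      nra. }
  rewrite 2!Rabs_mult, (Rabs_pos_eq _ (proj1 c0)).
  replace ((y - x) ^ 2) with (Rabs (y - x) * Rabs (y - x)) by (rewrite <- Rabs_mult, Rabs_pos_eq; [ring|apply Rle_0_sqr]).
  rewrite <- Rmult_assoc; apply Rmult_le_compat_r; [apply Rabs_pos|].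
  apply Rmult_le_compat; [tauto|apply Rabs_pos|tauto|assumption].
Qed.

(** * Joint continuity, integrals with a parameter, and signs of nonvanishing functions *)

Lemma continuity_2d_fst f x y : continuous f x -> continuity_2d_pt (fun t _ => f t) x y.
Proof.
intros h; apply (continuity_1d_2d_pt_comp f (fun t _ => t)); [|apply continuity_2d_pt_id1].
now apply continuity_pt_filterlim.
Qed.

Lemma continuity_2d_snd f x y : continuous f y -> continuity_2d_pt (fun _ p => f p) x y.
Proof.
intros h; apply (continuity_1d_2d_pt_comp f (fun _ p => p)); [|apply continuity_2d_pt_id2].
now apply continuity_pt_filterlim.
Qed.

Lemma continuity_2d_section f x y : continuity_2d_pt f x y -> continuous (f x) y.
Proof.
intros h; apply continuity_2d_pt_filterlim in h.
apply (continuous_comp_2 (fun _ => x) (fun p => p) f).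
- apply continuous_const.
- apply continuous_id.
- exact h.
Qed.

Lemma continuity_2d_Psi A (n : R -> R -> R) (k h : R -> R) t p :
  continuity_2d_pt n t p -> continuous k t -> continuous h t ->
  n t p ^ 2 < A ^ 2 -> 0 < h t ->
  continuity_2d_pt (fun t p => Psi A (n t p) (k t) (h t)) t p.
Proof.
intros hn hk hh hA h0; unfold Psi.
assert (cn2 : continuity_2d_pt (fun t p => A ^ 2 - n t p ^ 2) t p).
{ apply continuity_2d_pt_minus; [apply continuity_2d_pt_const|].
  apply (continuity_2d_pt_ext (fun t p => n t p * n t p)); [intros; ring|].
  now apply continuity_2d_pt_mult. }
assert (csq : forall f, continuity_2d_pt f t p -> 0 <= f t p ->
  continuity_2d_pt (fun t p => sqrt (f t p)) t p).
{ intros f hf f0; apply (continuity_1d_2d_pt_comp sqrt f); [|assumption].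
  now apply continuity_pt_sqrt. }
assert (cas : forall f, continuity_2d_pt f t p -> continuity_2d_pt (fun t p => arcsinh (f t p)) t p).
{ intros f hf; apply (continuity_1d_2d_pt_comp arcsinh f); [|assumption].
  apply continuity_pt_filterlim, (ex_derive_continuous (V := R_NormedModule)).
  eexists; apply is_derive_arcsinh. }
assert (ck := continuity_2d_fst k t p hk); assert (ch := continuity_2d_fst h t p hh).
assert (w0 : 0 < sqrt (A ^ 2 - n t p ^ 2)) by (apply sqrt_lt_R0; lra).
assert (cw := csq _ cn2 ltac:(lra)).
assert (cnk := continuity_2d_pt_mult _ _ _ _ hn ck).
apply continuity_2d_pt_minus; [apply continuity_2d_pt_minus|].
- apply (continuity_2d_pt_mult (fun t _ => k t) (fun _ _ => A)); [assumption|apply continuity_2d_pt_const].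
- apply csq.
  + apply continuity_2d_pt_plus.
    * apply (continuity_2d_pt_mult (fun t _ => h t ^ 2)); [|assumption].
      apply (continuity_2d_pt_ext (fun t _ => h t * h t)); [intros; ring|].
      now apply continuity_2d_pt_mult.
    * apply (continuity_2d_pt_ext (fun t p => n t p * k t * (n t p * k t))); [intros; ring|].
      now apply continuity_2d_pt_mult.
  + apply Rplus_le_le_0_compat; [apply Rmult_le_pos; [|lra]|]; apply pow2_ge_0.
- apply continuity_2d_pt_mult; [assumption|].
  apply continuity_2d_pt_minus; apply cas; unfold Rdiv; apply continuity_2d_pt_mult; try assumption.
  + apply continuity_2d_pt_inv; [assumption|lra].
  + apply continuity_2d_pt_inv; [now apply continuity_2d_pt_mult|].
    apply Rmult_integral_contrapositive; lra.
Qed.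

Lemma ex_RInt_cont (f : R -> R) a b : (forall x, continuous f x) -> ex_RInt f a b.
Proof. intros h; apply (ex_RInt_continuous (V := R_CompleteNormedModule)); auto. Qed.

Lemma RInt_abs_le (f : R -> R) a b K : a <= b -> ex_RInt f a b ->
  (forall x, a < x < b -> Rabs (f x) <= K) -> Rabs (RInt f a b) <= K * (b - a).
Proof.
intros hab hf hK; apply Rabs_le; split.
- replace (- (K * (b - a))) with (RInt (fun _ => - K) a b).
  + apply RInt_le; [assumption|apply ex_RInt_const|assumption|].
    intros x hx; specialize (hK x hx); apply Rabs_le_between in hK; lra.
  + rewrite RInt_const; unfold scal; simpl; unfold mult; simpl; ring.
- replace (K * (b - a)) with (RInt (fun _ => K) a b).
  + apply RInt_le; [assumption|assumption|apply ex_RInt_const|].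
    intros x hx; specialize (hK x hx); apply Rabs_le_between in hK; lra.
  + rewrite RInt_const; unfold scal; simpl; unfold mult; simpl; ring.
Qed.

Lemma RInt_sub (f g : R -> R) a b : ex_RInt f a b -> ex_RInt g a b ->
  RInt (fun x => f x - g x) a b = RInt f a b - RInt g a b.
Proof. intros; now apply (RInt_minus (V := R_CompleteNormedModule)). Qed.

Lemma continuous_RInt_param f a b t : a < b ->
  (forall x y, continuity_2d_pt f x y) -> continuous (fun t => RInt (f t) a b) t.
Proof.
intros hab hf; apply continuity_pt_filterlim; intros eps heps.
assert (e0 : 0 < eps / 2 / (b - a)) by (apply Rdiv_lt_0_compat; lra).
destruct (uniform_continuity_2d_1d' f a b t (fun x _ => hf t x) (mkposreal _ e0)) as [d hd].
exists d; split; [apply cond_pos|].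
intros s [_ hs]; unfold Rlimit.dist, R_met, R_dist in *; simpl in hs |- *.
assert (ci : forall s, ex_RInt (f s) a b).
{ intros s'; apply ex_RInt_cont; intros x; now apply continuity_2d_section. }
rewrite <- RInt_sub by auto.
apply (Rle_lt_trans _ (eps / 2 / (b - a) * (b - a))).
- apply RInt_abs_le; [lra| |].
  + apply (ex_RInt_minus (V := R_NormedModule)); auto.
  + intros x hx. apply Rabs_lt_between in hs. apply Rlt_le.
    apply (hd x t x s); try lra.
    rewrite Rminus_diag, Rabs_R0; apply cond_pos.
- replace (eps / 2 / (b - a) * (b - a)) with (eps / 2) by (field; lra). lra.
Qed.

Lemma ulim_RInt F F0 a b : a <= b -> ulim F F0 -> (forall x, continuous F0 x) ->
  exists C e0, 0 <= C /\ 0 < e0 /\ forall e, 0 < e < e0 ->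
    Rabs (RInt (F e) a b - RInt F0 a b) <= C * e.
Proof.
intros hab [C [e0 [h1 [h2 [h3 h4]]]]] hc.
exists (C * (b - a)), e0; split; [apply Rmult_le_pos; lra|split; [assumption|]].
intros e he.
assert (c1 : ex_RInt (F e) a b) by (apply ex_RInt_cont; intros x; now apply h4).
assert (c2 : ex_RInt F0 a b) by now apply ex_RInt_cont.
rewrite <- RInt_sub by assumption.
replace (C * (b - a) * e) with (C * e * (b - a)) by ring.
apply RInt_abs_le; [assumption|now apply (ex_RInt_minus (V := R_NormedModule))|].
intros x _; now apply h4.
Qed.

Lemma nonvanishing_pos (f : R -> R) a b x0 : a < x0 < b ->
  (forall x, a < x < b -> continuous f x) -> (forall x, a < x < b -> f x <> 0) ->
  0 < f x0 -> forall x, a < x < b -> 0 < f x.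
Proof.
intros h0 hc hn hp x hx.
destruct (Rlt_le_dec 0 (f x)) as [l|l]; [assumption|exfalso].
assert (l' : f x < 0) by (destruct l as [l|l]; [assumption|now apply hn in l]).
destruct (Rtotal_order x x0) as [o|[o|o]].
- destruct (Ranalysis5.IVT_interv f x x0) as [z [hz z0]]; try assumption.
  + intros y hy; apply continuity_pt_filterlim, hc; lra.
  + apply (hn z); [lra|assumption].
- subst; lra.
- destruct (Ranalysis5.IVT_interv (fun y => - f y) x0 x) as [z [hz z0]]; try lra.
  + intros y hy; apply continuity_pt_opp, continuity_pt_filterlim, hc; lra.
  + apply (hn z); lra.
Qed.

(** * Expansions on the boosted spheres *)

Section Profile.

(* [b] is [beta * gamma], [e] is [M / (2 r0)] and [zz] is [r0 / rho], so that [FF] and [GG] are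
   [1 / F^2] and [1 / G^2] on the sphere, with radial derivatives [e fh rho / r0^2] and
   [e gh rho / r0^2]. The embedding is [u = r0 uh], [v' = - r0 VV], the induced metric is
   [r0^2 (EE dtheta^2 + uh^2 dphi^2)], and [kk], [hh] are [r0 |H0|], [r0 |H|]. [W0], [sWe / sin],
   [W3] are the components of the trace of [nabla dX] times [r0]. *)
Variables b ga : R.

Definition zz (t : R) : R := / sqrt (1 + b ^ 2 * cos t ^ 2).
Definition PP (e t : R) : R := 1 + e * zz t.
Definition MM (e t : R) : R := 1 - e * zz t.
Definition iP (e t : R) : R := / PP e t.
Definition FF (e t : R) : R := MM e t ^ 2 * iP e t ^ 2.
Definition GG (e t : R) : R := PP e t ^ 4.
Definition iF (e t : R) : R := / FF e t.
Definition iG (e t : R) : R := / GG e t.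
Definition fh (e t : R) : R := 4 * MM e t * iP e t ^ 3 * zz t ^ 3.
Definition gh (e t : R) : R := -4 * PP e t ^ 3 * zz t ^ 3.
(** The theta derivative of [PP] divided by [sin t]; splitting off the sine makes the factor [sin^2]
    of [EE - uh'^2] visible. *)
Definition e1 (e t : R) : R := e * b ^ 2 * cos t * zz t ^ 3.
Definition e1' (e t : R) : R :=
  e * b ^ 2 * sin t * zz t ^ 3 * (-1 + 3 * b ^ 2 * cos t ^ 2 * zz t ^ 2).
Definition EE (e t : R) : R := GG e t + b ^ 2 * sin t ^ 2 * (GG e t - FF e t).
Definition DD (e t : R) : R := GG e t + b ^ 2 * (GG e t - FF e t).
Definition iE (e t : R) : R := / EE e t.
Definition rE (e t : R) : R := / sqrt (EE e t).
Definition uh (e t : R) : R := sin t * PP e t ^ 2.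
Definition uh' (e t : R) : R :=
  cos t * PP e t ^ 2 + 2 * sin t ^ 2 * PP e t * e1 e t.
Definition uh'' (e t : R) : R :=
  - sin t * PP e t ^ 2 + 6 * sin t * cos t * PP e t * e1 e t
  + 2 * sin t ^ 3 * e1 e t ^ 2 + 2 * sin t ^ 2 * PP e t * e1' e t.
(** The quotient of [EE - uh'^2] by [sin^2], carried out by hand with [sin^2 = 1 - cos^2]. Without
    the double zeros at the poles its square root is differentiable everywhere, which gives
    [VV = sin * sqrt KK]. *)
Definition KK (e t : R) : R :=
  DD e t - 4 * cos t * PP e t ^ 3 * e1 e t - 4 * sin t ^ 2 * PP e t ^ 2 * e1 e t ^ 2.
(* On the slice [d f / d t = - b^2 sin cos e fh], and likewise for [GG] and [gh]. *)
Definition KK' (e t : R) : R :=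
  - b ^ 2 * sin t * cos t * e * (gh e t + b ^ 2 * (gh e t - fh e t))
  + 4 * sin t * PP e t ^ 3 * e1 e t - 12 * cos t * sin t * PP e t ^ 2 * e1 e t ^ 2
  - 4 * cos t * PP e t ^ 3 * e1' e t
  - 8 * sin t * cos t * PP e t ^ 2 * e1 e t ^ 2
  - 8 * sin t ^ 3 * PP e t * e1 e t ^ 3
  - 8 * sin t ^ 2 * PP e t ^ 2 * e1 e t * e1' e t.
Definition rK (e t : R) : R := sqrt (KK e t).
Definition irK (e t : R) : R := / rK e t.
Definition VV (e t : R) : R := sin t * rK e t.
Definition VV' (e t : R) : R := cos t * rK e t + sin t * (/ 2 * KK' e t * irK e t).
(** The sum of the two principal curvatures of a surface of revolution. The orthoradial one is
    [VV / (uh sqrt EE)], in which the sine cancels. *)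
Definition kk (e t : R) : R :=
  rK e t * iP e t ^ 2 * rE e t + (uh' e t * VV' e t - uh'' e t * VV e t) * rE e t ^ 3.

Definition W0 (e t : R) : R :=
  iE e t * (- b * cos t + e * fh e t * iF e t * b ^ 3 * sin t ^ 2 * cos t).
Definition sWe (e t : R) : R :=
  sin t ^ 2 * iE e t * (-1 + / 2 * iG e t * e * (fh e t * b ^ 2 * sin t ^ 2
     - (1 + b ^ 2 * sin t ^ 2) * gh e t - 2 * b ^ 2 * cos t ^ 2 * gh e t))
  - iG e t * (1 + / 2 * sin t ^ 2 * e * gh e t * iG e t).
Definition W3 (e t : R) : R :=
  iE e t * (- ga * cos t + / 2 * iG e t * e * ga * cos t * (fh e t * b ^ 2 * sin t ^ 2
     - (1 + b ^ 2 * sin t ^ 2) * gh e t + 2 * b ^ 2 * sin t ^ 2 * gh e t))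
  - / 2 * iG e t ^ 2 * e * gh e t * ga * cos t.
(* [h1], [h2] are [r0] times the products of the mean curvature vector with the normal vectors
   [(b GG cos, sin DD, ga GG cos)] and [(ga GG, 0, b FF)], whose squared norms are [1 / iN1] and
   [- 1 / rN2^2]; [e conn2e] is the connection form of this pair. *)
Definition h1 (e t : R) : R :=
  - FF e t * (b * GG e t * cos t) * W0 e t + GG e t * DD e t * sWe e t
  + GG e t * (ga * GG e t * cos t) * W3 e t.
(** The second normal is orthogonal to the boosted slice for every [e], and the second coordinate
    derivatives of the sphere are tangent to that slice. Only Christoffel terms are left in its
    product with the trace, and these carry a factor [e], which is divided out here. *)
Definition h2e (e t : R) : R :=
  - ga * GG e t * iE e t * fh e t * b ^ 3 * sin t ^ 2 * cos t
  + GG e t * b * FF e t * (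
    iE e t * (/ 2 * iG e t * ga * cos t * (fh e t * b ^ 2 * sin t ^ 2
     - (1 + b ^ 2 * sin t ^ 2) * gh e t + 2 * b ^ 2 * sin t ^ 2 * gh e t))
    - / 2 * iG e t ^ 2 * gh e t * ga * cos t).
Definition h2 (e t : R) : R := e * h2e e t.
Definition iN1 (e t : R) : R := / (GG e t * DD e t * EE e t).
Definition rN2 (e t : R) : R := / sqrt (FF e t * GG e t * DD e t).
Definition rN12 (e t : R) : R :=
  / sqrt (GG e t * DD e t * EE e t * (FF e t * GG e t * DD e t)).
Definition hh2 (e t : R) : R := h1 e t ^ 2 * iN1 e t - h2 e t ^ 2 * rN2 e t ^ 2.
Definition hh (e t : R) : R := sqrt (hh2 e t).
Definition ihh (e t : R) : R := / hh e t.
Definition S1 (e t : R) : R := - h2e e t * rN2 e t * ihh e t.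
Definition conn2e (e t : R) : R :=
  let VW := - ga * sin t * (b * FF e t) in
  let Wy := b * FF e t * (ga * cos t) in
  let Vy := - b ^ 2 * sin t * cos t in
  let V0 := - b * sin t in
  let N0 := ga * GG e t in
  - FF e t * (ga * (Vy * gh e t) + / 2 * fh e t * iF e t * (V0 * Wy + N0 * Vy))
    * (b * GG e t * cos t)
  + GG e t * ((/ 2 * iG e t * (fh e t * V0 * N0 * sin t
       + gh e t * (cos t * Wy - VW * sin t))) * (sin t * DD e t)
     + (b * (Vy * fh e t) + / 2 * iG e t * (fh e t * V0 * N0 * (ga * cos t)
       + gh e t * (- ga * sin t * Wy + b * FF e t * Vy - VW * (ga * cos t))))
       * (ga * GG e t * cos t)).
Definition cn (e t : R) : R := conn2e e t * rN12 e t.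

Lemma q_pos t : 1 <= 1 + b ^ 2 * cos t ^ 2.
Proof.
assert (0 <= b ^ 2 * cos t ^ 2) by (apply Rmult_le_pos; apply pow2_ge_0); lra.
Qed.

Lemma zz_pos t : 0 < zz t <= 1.
Proof.
assert (h := q_pos t); unfold zz; split.
- apply Rinv_0_lt_compat, sqrt_lt_R0; lra.
- apply (Rle_trans _ (/ 1)); [|lra]; apply Rinv_le_contravar; [lra|].
  apply (Rle_trans _ (sqrt 1)); [rewrite sqrt_1; lra|apply sqrt_le_1; lra].
Qed.

Lemma zz_sqr t : b ^ 2 * cos t ^ 2 * zz t ^ 2 = 1 - zz t ^ 2.
Proof.
assert (h := q_pos t).
assert (H : zz t ^ 2 * (1 + b ^ 2 * cos t ^ 2) = 1); [|lra].
unfold zz; rewrite <- (pow2_sqrt (1 + b ^ 2 * cos t ^ 2)) at 2 by lra.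
field; apply Rgt_not_eq, sqrt_lt_R0; lra.
Qed.

Lemma sin_sqr t : sin t ^ 2 = 1 - cos t ^ 2.
Proof. pose proof (sin2_cos2 t) as h; unfold Rsqr in h; nra. Qed.

Lemma is_derive_zz t : is_derive zz t (b ^ 2 * cos t * sin t * zz t ^ 3).
Proof.
assert (h := q_pos t); assert (0 < sqrt (1 + b ^ 2 * cos t ^ 2)) by (apply sqrt_lt_R0; lra).
unfold zz; auto_derive.
- simpl in *; repeat split; lra.
- simpl; replace (b * (b * 1)) with (b ^ 2) by ring.
  replace (cos t * (cos t * 1)) with (cos t ^ 2) by ring.
  field; lra.
Qed.

Lemma jet_sin : jet (fun _ t => sin t) (fun t => sin t) (fun _ => 0).
Proof.
apply (jet_theta sin cos 1).
- intros t; apply Rabs_le, SIN_bound.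
- intros t; apply Rabs_le, COS_bound.
- intros t; apply is_derive_Reals, derivable_pt_lim_sin.
- intros t; apply continuity_pt_filterlim, continuity_cos.
Qed.

Lemma jet_cos : jet (fun _ t => cos t) (fun t => cos t) (fun _ => 0).
Proof.
apply (jet_theta cos (fun t => - sin t) 1).
- intros t; apply Rabs_le, COS_bound.
- intros t; rewrite Rabs_Ropp; apply Rabs_le, SIN_bound.
- intros t; apply is_derive_Reals, derivable_pt_lim_cos.
- intros t; apply (continuous_opp (V := R_NormedModule)).
  apply continuity_pt_filterlim, continuity_sin.
Qed.

Lemma jet_zz : jet (fun _ t => zz t) (fun t => zz t) (fun _ => 0).
Proof.
apply (jet_theta zz (fun t => b ^ 2 * cos t * sin t * zz t ^ 3) (1 + b ^ 2)).
- intros t; destruct (zz_pos t); assert (0 <= b ^ 2) by apply pow2_ge_0.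
  rewrite Rabs_pos_eq; lra.
- intros t; destruct (zz_pos t); assert (0 <= b ^ 2) by apply pow2_ge_0.
  assert (Rabs (b ^ 2 * cos t * sin t * zz t ^ 3) <= b ^ 2 * 1 * 1 * 1); [|lra].
  apply Rabs_mult_le; [apply Rabs_mult_le; [apply Rabs_mult_le|]|].
  + rewrite Rabs_pos_eq; [lra|apply pow2_ge_0].
  + apply Rabs_le, COS_bound.
  + apply Rabs_le, SIN_bound.
  + rewrite Rabs_pos_eq by (apply pow_le; lra).
    replace 1 with (1 ^ 3) by ring; apply pow_incr; lra.
- apply is_derive_zz.
- intros t; apply (ex_derive_continuous (V := R_NormedModule)).
  auto_derive; repeat split; try easy.
  exists (b ^ 2 * cos t * sin t * zz t ^ 3); apply is_derive_zz.
Qed.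

(** A hook that is redefined as more profile functions receive an expansion. The tactic [jets]
    follows the syntax of an expression and composes the rules; [jet_finish] then compares the
    coefficients modulo the trigonometric relation and [zz_sqr]. *)
Ltac jet_base F := fail.
Ltac jets := lazymatch goal with
  | |- jet (fun _ t => sin t) _ _ => apply jet_sin
  | |- jet (fun _ t => cos t) _ _ => apply jet_cos
  | |- jet (fun _ t => zz t) _ _ => apply jet_zz
  | |- jet (fun e _ => e) _ _ => apply jet_e
  | |- jet (fun _ _ => ?k) _ _ => apply (jet_const k)
  | |- jet (fun e t => @?F e t ^ 4) _ _ => eapply (jet_pow4 F); jets
  | |- jet (fun e t => @?F e t ^ 3) _ _ => eapply (jet_pow3 F); jets
  | |- jet (fun e t => @?F e t ^ 2) _ _ => eapply (jet_pow2 F); jets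
  | |- jet (fun e t => @?F e t * @?G e t) _ _ => eapply (jet_mult F G); [jets|jets]
  | |- jet (fun e t => @?F e t + @?G e t) _ _ => eapply (jet_plus F G); [jets|jets]
  | |- jet (fun e t => @?F e t - @?G e t) _ _ => eapply (jet_minus F G); [jets|jets]
  | |- jet (fun e t => - @?F e t) _ _ => eapply (jet_opp F); jets
  | |- jet (fun e t => ?F e t) _ _ => jet_base F
  | |- jet ?F _ _ => jet_base F
  end.
Ltac jet_finish t :=
  intros t; generalize (sin_sqr t) (zz_sqr t); generalize (sin t) (cos t) (zz t);
  intros S C Z hs hz; cbv beta; try (field [hs hz]).
Ltac jet_prove := eapply jet_ext; [jets| |]; let t := fresh in jet_finish t.

Lemma jet_PP : jet PP (fun _ => 1) (fun t => zz t).
Proof. unfold PP; jet_prove. Qed.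

Lemma jet_MM : jet MM (fun _ => 1) (fun t => - zz t).
Proof. unfold MM; jet_prove. Qed.

Lemma jet_inv1 F F1 : jet F (fun _ => 1) F1 ->
  jet (fun e t => / F e t) (fun _ => 1) (fun t => - F1 t).
Proof.
intros h; eapply jet_ext; [apply (jet_inv _ _ _ 1 Rlt_0_1 h); intros; lra| |];
  intros; simpl; field.
Qed.

Lemma jet_sqrt1 F F1 : jet F (fun _ => 1) F1 ->
  jet (fun e t => sqrt (F e t)) (fun _ => 1) (fun t => F1 t / 2).
Proof.
intros h; eapply jet_ext; [apply (jet_sqrt _ _ _ 1 Rlt_0_1 h); intros; lra| |];
  intros; simpl; rewrite sqrt_1; field.
Qed.

Lemma jet_iP : jet iP (fun _ => 1) (fun t => - zz t).
Proof. apply (jet_inv1 _ _ jet_PP). Qed.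

Ltac jet_base F ::= lazymatch F with
  | PP => apply jet_PP
  | MM => apply jet_MM
  | iP => apply jet_iP
  end.

Lemma jet_FF : jet FF (fun _ => 1) (fun t => -4 * zz t).
Proof. unfold FF; jet_prove. Qed.

Lemma jet_GG : jet GG (fun _ => 1) (fun t => 4 * zz t).
Proof. unfold GG; jet_prove. Qed.

Lemma jet_iF : jet iF (fun _ => 1) (fun t => - (-4 * zz t)).
Proof. apply (jet_inv1 _ _ jet_FF). Qed.

Lemma jet_iG : jet iG (fun _ => 1) (fun t => - (4 * zz t)).
Proof. apply (jet_inv1 _ _ jet_GG). Qed.

Lemma jet_e1 : jet e1 (fun _ => 0) (fun t => b ^ 2 * cos t * zz t ^ 3).
Proof. unfold e1; jet_prove. Qed.

Ltac jet_base F ::= lazymatch F with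
  | PP => apply jet_PP
  | MM => apply jet_MM
  | iP => apply jet_iP
  | FF => apply jet_FF
  | GG => apply jet_GG
  | iF => apply jet_iF
  | iG => apply jet_iG
  | e1 => apply jet_e1
  end.

Lemma jet_EE : jet EE (fun _ => 1) (fun t => 4 * zz t + 8 * b ^ 2 * sin t ^ 2 * zz t).
Proof. unfold EE; jet_prove. Qed.

Lemma jet_DD : jet DD (fun _ => 1) (fun t => 4 * zz t + 8 * b ^ 2 * zz t).
Proof. unfold DD; jet_prove. Qed.

Lemma jet_iE : jet iE (fun _ => 1)
  (fun t => - (4 * zz t + 8 * b ^ 2 * sin t ^ 2 * zz t)).
Proof. apply (jet_inv1 _ _ jet_EE). Qed.

Lemma jet_rE : jet rE (fun _ => 1)
  (fun t => - ((4 * zz t + 8 * b ^ 2 * sin t ^ 2 * zz t) / 2)).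
Proof. apply (jet_inv1 _ _ (jet_sqrt1 _ _ jet_EE)). Qed.

Ltac jet_base F ::= lazymatch F with
  | PP => apply jet_PP
  | MM => apply jet_MM
  | iP => apply jet_iP
  | FF => apply jet_FF
  | GG => apply jet_GG
  | iF => apply jet_iF
  | iG => apply jet_iG
  | e1 => apply jet_e1
  | EE => apply jet_EE
  | DD => apply jet_DD
  | iE => apply jet_iE
  | rE => apply jet_rE
  end.

Lemma jet_KK : jet KK (fun _ => 1)
  (fun t => 4 * zz t + 8 * b ^ 2 * zz t - 4 * b ^ 2 * cos t ^ 2 * zz t ^ 3).
Proof. unfold KK; jet_prove. Qed.

Lemma jet_rK : jet rK (fun _ => 1)
  (fun t => (4 * zz t + 8 * b ^ 2 * zz t - 4 * b ^ 2 * cos t ^ 2 * zz t ^ 3) / 2).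
Proof. apply (jet_sqrt1 _ _ jet_KK). Qed.

Lemma jet_irK : jet irK (fun _ => 1)
  (fun t => - ((4 * zz t + 8 * b ^ 2 * zz t - 4 * b ^ 2 * cos t ^ 2 * zz t ^ 3) / 2)).
Proof. apply (jet_inv1 _ _ jet_rK). Qed.

Ltac jet_base F ::= lazymatch F with
  | PP => apply jet_PP
  | MM => apply jet_MM
  | iP => apply jet_iP
  | FF => apply jet_FF
  | GG => apply jet_GG
  | iF => apply jet_iF
  | iG => apply jet_iG
  | e1 => apply jet_e1
  | EE => apply jet_EE
  | DD => apply jet_DD
  | iE => apply jet_iE
  | rE => apply jet_rE
  | rK => apply jet_rK
  | irK => apply jet_irK
  end.

Lemma jet_uh : jet uh (fun t => sin t) (fun t => 2 * sin t * zz t).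
Proof. unfold uh; jet_prove. Qed.

Lemma jet_VV : jet VV (fun t => sin t)
  (fun t => sin t * ((4 * zz t + 8 * b ^ 2 * zz t - 4 * b ^ 2 * cos t ^ 2 * zz t ^ 3) / 2)).
Proof. unfold VV; jet_prove. Qed.

Lemma jet_kk : jet kk (fun _ => 2)
  (fun t => zz t * (-4 + 12 * b ^ 2 * cos t ^ 2 - 4 * b ^ 2 * sin t ^ 2 - 4 * b ^ 2)
   + zz t ^ 3 * (-4 * b ^ 2 * cos t ^ 2 + 4 * b ^ 4 * sin t ^ 2 * cos t ^ 2
       + 2 * b ^ 2 * sin t ^ 2)
   - 6 * b ^ 4 * cos t ^ 2 * sin t ^ 2 * zz t ^ 5).
Proof.
unfold kk, uh', uh'', VV, VV', KK', e1', gh, fh; jet_prove.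
Qed.

Lemma jet_fh : jet fh (fun t => 4 * zz t ^ 3) (fun t => -16 * zz t ^ 4).
Proof. unfold fh; jet_prove. Qed.

Lemma jet_gh : jet gh (fun t => -4 * zz t ^ 3) (fun t => -12 * zz t ^ 4).
Proof. unfold gh; jet_prove. Qed.

Lemma jet_iN1 : jet iN1 (fun _ => 1)
  (fun t => - (12 * zz t + 8 * b ^ 2 * zz t + 8 * b ^ 2 * sin t ^ 2 * zz t)).
Proof.
apply (jet_inv1 (fun e t => GG e t * DD e t * EE e t)); jet_prove.
Qed.

Lemma jet_rN2 : jet rN2 (fun _ => 1) (fun t => - ((4 * zz t + 8 * b ^ 2 * zz t) / 2)).
Proof.
apply (jet_inv1 (fun e t => sqrt (FF e t * GG e t * DD e t))).
apply (jet_sqrt1 (fun e t => FF e t * GG e t * DD e t)); jet_prove.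
Qed.

Lemma jet_rN12 : jet rN12 (fun _ => 1)
  (fun t => - ((16 * zz t + 16 * b ^ 2 * zz t + 8 * b ^ 2 * sin t ^ 2 * zz t) / 2)).
Proof.
apply (jet_inv1 (fun e t => sqrt (GG e t * DD e t * EE e t * (FF e t * GG e t * DD e t)))).
apply (jet_sqrt1 (fun e t => GG e t * DD e t * EE e t * (FF e t * GG e t * DD e t))).
jet_prove.
Qed.

Ltac jet_base F ::= lazymatch F with
  | PP => apply jet_PP
  | MM => apply jet_MM
  | iP => apply jet_iP
  | FF => apply jet_FF
  | GG => apply jet_GG
  | iF => apply jet_iF
  | iG => apply jet_iG
  | e1 => apply jet_e1
  | EE => apply jet_EE
  | DD => apply jet_DD
  | iE => apply jet_iE
  | rE => apply jet_rE
  | rK => apply jet_rK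
  | irK => apply jet_irK
  | fh => apply jet_fh
  | gh => apply jet_gh
  | iN1 => apply jet_iN1
  | rN2 => apply jet_rN2
  | rN12 => apply jet_rN12
  end.

Hypothesis hga : ga ^ 2 = 1 + b ^ 2.

Ltac jet_finish_ga t :=
  intros t; generalize (sin_sqr t) (zz_sqr t) hga; generalize (sin t) (cos t) (zz t);
  intros S C Z hs hz hg; cbv beta; field [hs hz hg].
Ltac jet_prove_ga := eapply jet_ext; [jets| |]; let t := fresh in jet_finish_ga t.

Lemma jet_h1 : jet h1 (fun _ => -2)
  (fun t => - (zz t * (4 + 4 * b ^ 2 + 12 * b ^ 2 * cos t ^ 2)
               + 8 * b ^ 4 * sin t ^ 2 * cos t ^ 2 * zz t ^ 3)).
Proof. unfold h1, W0, sWe, W3; jet_prove_ga. Qed.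

(** Only the leading coefficient is made explicit, since [h2] has one more factor [e]; the next one
    is left to unification. *)
Lemma jet_h2e : exists F1,
  jet h2e (fun t => 4 * b * ga * cos t * zz t ^ 3 * (1 - b ^ 2 * sin t ^ 2)) F1.
Proof.
eexists; unfold h2e; eapply jet_ext; [jets| |]; [|reflexivity].
let t := fresh in jet_finish_ga t.
Qed.

Lemma jet_h2 : jet h2 (fun _ => 0)
  (fun t => 4 * b * ga * cos t * zz t ^ 3 * (1 - b ^ 2 * sin t ^ 2)).
Proof.
destruct jet_h2e as [F1 h]; unfold h2.
eapply jet_ext; [eapply (jet_mult (fun e _ => e)); [apply jet_e|exact h]| |];
  intros; simpl; ring.
Qed.

Lemma jet_hh2 : jet hh2 (fun _ => 4)
  (fun t => 4 * (zz t * (-8 - 4 * b ^ 2 + 12 * b ^ 2 * cos t ^ 2 - 8 * b ^ 2 * sin t ^ 2)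
            + 8 * b ^ 4 * sin t ^ 2 * cos t ^ 2 * zz t ^ 3)).
Proof.
pose proof jet_h1 as j1; pose proof jet_h2 as j2.
unfold hh2; eapply jet_ext.
- apply (jet_minus (fun e t => h1 e t ^ 2 * iN1 e t) (fun e t => h2 e t ^ 2 * rN2 e t ^ 2)).
  + apply (jet_mult (fun e t => h1 e t ^ 2)); [apply (jet_pow2 _ _ _ j1)|apply jet_iN1].
  + apply (jet_mult (fun e t => h2 e t ^ 2)); [apply (jet_pow2 _ _ _ j2)|].
    apply (jet_pow2 _ _ _ jet_rN2).
- intros t; cbv beta; ring.
- let t := fresh in jet_finish_ga t.
Qed.

Lemma sqrt_4 : sqrt 4 = 2.
Proof. replace 4 with (2 ^ 2) by ring; apply sqrt_pow2; lra. Qed.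

Lemma jet_hh : jet hh (fun _ => 2)
  (fun t => zz t * (-8 - 4 * b ^ 2 + 12 * b ^ 2 * cos t ^ 2 - 8 * b ^ 2 * sin t ^ 2)
            + 8 * b ^ 4 * sin t ^ 2 * cos t ^ 2 * zz t ^ 3).
Proof.
eapply jet_ext; [apply (jet_sqrt _ _ _ 4 ltac:(lra) jet_hh2); intros; lra| |];
  intros; simpl; rewrite sqrt_4; field.
Qed.

Lemma jet_ihh : exists F1, jet ihh (fun _ => / 2) F1.
Proof.
eexists; apply (jet_inv _ _ _ 2 ltac:(lra) jet_hh); intros; lra.
Qed.

Lemma jet_S1 : exists F1,
  jet S1 (fun t => -2 * b * ga * cos t * zz t ^ 3 * (1 - b ^ 2 * sin t ^ 2)) F1.
Proof.
destruct jet_h2e as [F1 h]; destruct jet_ihh as [F2 h'].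
eexists; unfold S1; eapply jet_ext.
- apply (jet_mult (fun e t => - h2e e t * rN2 e t)); [|exact h'].
  apply (jet_mult (fun e t => - h2e e t)); [apply (jet_opp _ _ _ h)|apply jet_rN2].
- intros; cbv beta; field.
- reflexivity.
Qed.

Lemma jet_cn : exists F1, jet cn (fun t => -4 * b * ga * sin t * zz t) F1.
Proof.
eexists; unfold cn; eapply jet_ext.
- apply (jet_mult conn2e rN12); [|apply jet_rN12]. unfold conn2e; cbv zeta; jets.
- let t := fresh in jet_finish_ga t.
- reflexivity.
Qed.

(** The first order coefficient of [r0 (|H0| - |H|)]. The various powers of [zz] in the two
    expansions collapse to the fifth power by [zz_sqr]; for [b = 0] it is the constant 4 of a round
    sphere. *)
Definition L1 (t : R) : R := zz t ^ 5 * (4 + 6 * b ^ 2 - 2 * b ^ 2 * cos t ^ 2).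

Lemma jet_kk_hh : jet (fun e t => kk e t - hh e t) (fun _ => 0) L1.
Proof.
eapply jet_ext; [apply (jet_minus _ _ _ _ _ _ jet_kk jet_hh)| |].
- intros; cbv beta; ring.
- unfold L1; intros t; generalize (sin_sqr t) (zz_sqr t); generalize (sin t) (cos t) (zz t);
  intros S C Z hs hz; cbv beta; ring [hs hz].
Qed.

(** * Geometry of the boosted spheres *)

Hypothesis gap : 0 < ga.

(** The open conditions on a small [e]: the sphere lies outside the horizon, the induced metric and
    the profile curve are nondegenerate, and both mean curvature vectors are spacelike. The last
    inequality is, up to a positive factor, the positivity of the time component of [J]. *)
Definition good (e : R) : Prop := 0 < e /\ forall t,
  0 < MM e t /\ 0 < DD e t /\ 0 < EE e t /\ 0 < KK e t /\ h1 e t < 0 /\ 0 < hh2 e t /\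
  0 < kk e t /\ 0 < - h1 e t * ga + h2 e t * (b * cos t) /\ ex_derive (S1 e) t.

Lemma eventually_good : exists e0, 0 < e0 /\ forall e, 0 < e < e0 -> good e.
Proof.
destruct (jet_S1) as [F1 js].
assert (j8 : exists F1, jet (fun e t => - h1 e t * ga + h2 e t * (b * cos t)) (fun _ => 2 * ga) F1).
{ eexists; eapply jet_ext.
  - apply jet_plus; apply jet_mult.
    + apply jet_opp, jet_h1.
    + apply jet_const.
    + apply (jet_h2).
    + apply (jet_mult (fun _ _ => b)); [apply jet_const|apply jet_cos].
  - intros; simpl; ring.
  - reflexivity. }
destruct j8 as [F8 j8].
destruct (ulim_eventually_gt _ _ 1 0 (jet_ulim _ _ _ jet_MM)) as [a1 [p1 q1]]; [intros; lra|lra|].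
destruct (ulim_eventually_gt _ _ 1 0 (jet_ulim _ _ _ jet_DD)) as [a2 [p2 q2]]; [intros; lra|lra|].
destruct (ulim_eventually_gt _ _ 1 0 (jet_ulim _ _ _ jet_EE)) as [a3 [p3 q3]]; [intros; lra|lra|].
destruct (ulim_eventually_gt _ _ 1 0 (jet_ulim _ _ _ jet_KK)) as [a4 [p4 q4]]; [intros; lra|lra|].
destruct (ulim_eventually_gt _ _ 2 0 (jet_ulim _ _ _ (jet_opp _ _ _ jet_h1))) as [a5 [p5 q5]];
  [intros; lra|lra|].
destruct (ulim_eventually_gt _ _ 4 0 (jet_ulim _ _ _ (jet_hh2))) as [a6 [p6 q6]]; [intros; lra|lra|].
destruct (ulim_eventually_gt _ _ 2 0 (jet_ulim _ _ _ jet_kk)) as [a7 [p7 q7]]; [intros; lra|lra|].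
destruct (ulim_eventually_gt _ _ (2 * ga) 0 (jet_ulim _ _ _ j8)) as [a8 [p8 q8]]; [intros; lra|lra|].
destruct (jet_Derive _ _ _ js) as [_ [a9 [p9 q9]]].
exists (Rmin a1 (Rmin a2 (Rmin a3 (Rmin a4 (Rmin a5 (Rmin a6 (Rmin a7 (Rmin a8 a9)))))))).
split; [repeat apply Rmin_glb_lt; assumption|].
intros e [he hm].
apply Rmin_Rgt_l in hm as [k1 hm]; apply Rmin_Rgt_l in hm as [k2 hm].
apply Rmin_Rgt_l in hm as [k3 hm]; apply Rmin_Rgt_l in hm as [k4 hm].
apply Rmin_Rgt_l in hm as [k5 hm]; apply Rmin_Rgt_l in hm as [k6 hm].
apply Rmin_Rgt_l in hm as [k7 hm]; apply Rmin_Rgt_l in hm as [k8 k9].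
split; [assumption|]; intros t.
repeat split; [apply q1|apply q2|apply q3|apply q4| |apply q6|apply q7|apply q8|apply q9]; try (split; assumption).
specialize (q5 e (conj he k5) t); cbv beta in q5; lra.
Qed.

Section Good.

Variable e : R.
Hypothesis ge : good e.

Lemma PP_pos t : 0 < PP e t.
Proof.
destruct ge as [he _]; destruct (zz_pos t); unfold PP.
assert (0 < e * zz t) by (apply Rmult_lt_0_compat; assumption); lra.
Qed.

Lemma GG_pos t : 0 < GG e t.
Proof. apply pow_lt, PP_pos. Qed.

Lemma MM_pos t : 0 < MM e t. Proof. apply ge. Qed.
Lemma DD_pos t : 0 < DD e t. Proof. apply ge. Qed.
Lemma EE_pos t : 0 < EE e t. Proof. apply ge. Qed.
Lemma KK_pos t : 0 < KK e t. Proof. apply ge. Qed.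
Lemma hh2_pos t : 0 < hh2 e t. Proof. apply ge. Qed.
Lemma kk_pos t : 0 < kk e t. Proof. apply ge. Qed.
Lemma hh_pos t : 0 < hh e t. Proof. apply sqrt_lt_R0, hh2_pos. Qed.

Lemma FF_pos t : 0 < FF e t.
Proof.
unfold FF; apply Rmult_lt_0_compat; apply pow_lt; [apply MM_pos|].
apply Rinv_0_lt_compat, PP_pos.
Qed.

Lemma is_derive_PP t : is_derive (PP e) t (sin t * e1 e t).
Proof.
unfold PP; auto_derive.
- eexists; apply is_derive_zz.
- eta_Derive; rewrite (is_derive_unique _ _ _ (is_derive_zz t)); unfold e1; ring.
Qed.

Lemma is_derive_GG t : is_derive (GG e) t (- b ^ 2 * sin t * cos t * e * gh e t).
Proof.
unfold GG; auto_derive.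
- eexists; apply is_derive_PP.
- eta_Derive; rewrite (is_derive_unique _ _ _ (is_derive_PP t)).
  unfold e1, gh; ring.
Qed.

Lemma is_derive_FF t : is_derive (FF e) t (- b ^ 2 * sin t * cos t * e * fh e t).
Proof.
assert (p := PP_pos t); unfold FF, iP, MM; auto_derive.
- split; [eexists; apply is_derive_zz|split; [eexists; apply is_derive_PP|split; [|easy]]].
  lra.
- eta_Derive; rewrite (is_derive_unique _ _ _ (is_derive_PP t)),
   (is_derive_unique _ _ _ (is_derive_zz t)).
  unfold e1, fh, iP, MM.
  assert (hp : PP e t = 1 + e * zz t) by reflexivity.
  set (P := PP e t) in *; set (Z := zz t) in *.
  (* Eliminating [e] through [e * Z = P - 1] makes the claim a rational identity with [P] as only
     denominator. *)
  replace (e * Z) with (P - 1) by lra.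
  replace (- b ^ 2 * sin t * cos t * e * (4 * (1 - (P - 1)) * (/ P) ^ 3 * Z ^ 3)) with
    (- b ^ 2 * sin t * cos t * (4 * (1 - (P - 1)) * (/ P) ^ 3 * (e * Z) * Z ^ 2)) by ring.
  replace (sin t * (e * b ^ 2 * cos t * Z ^ 3)) with (b ^ 2 * sin t * cos t * (e * Z) * Z ^ 2) by ring.
  replace (e * (1 * (b ^ 2 * cos t * sin t * Z ^ 3))) with (b ^ 2 * sin t * cos t * (e * Z) * Z ^ 2) by ring.
  replace (e * Z) with (P - 1) by lra.
  field; lra.
Qed.

Lemma is_derive_e1 t : is_derive (e1 e) t (e1' e t).
Proof.
unfold e1; auto_derive.
- eexists; apply is_derive_zz.
- eta_Derive; rewrite (is_derive_unique _ _ _ (is_derive_zz t)); unfold e1'; ring.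
Qed.

Ltac ex_known := repeat split; lazymatch goal with
  | |- ex_derive (fun x => PP _ x) _ => eexists; apply is_derive_PP
  | |- ex_derive (fun x => GG _ x) _ => eexists; apply is_derive_GG
  | |- ex_derive (fun x => FF _ x) _ => eexists; apply is_derive_FF
  | |- ex_derive (fun x => e1 _ x) _ => eexists; apply is_derive_e1
  end.

Lemma is_derive_uh t : is_derive (uh e) t (uh' e t).
Proof.
unfold uh; auto_derive.
- eexists; apply is_derive_PP.
- eta_Derive; rewrite (is_derive_unique _ _ _ (is_derive_PP t)); unfold uh'; ring.
Qed.

Lemma is_derive_uh' t : is_derive (uh' e) t (uh'' e t).
Proof.
unfold uh'; auto_derive.
- ex_known.
- eta_Derive; rewrite (is_derive_unique _ _ _ (is_derive_PP t)),
   (is_derive_unique _ _ _ (is_derive_e1 t)); unfold uh''; ring.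
Qed.

Lemma is_derive_DD t : is_derive (DD e) t
  (- b ^ 2 * sin t * cos t * e * (gh e t + b ^ 2 * (gh e t - fh e t))).
Proof.
unfold DD; auto_derive.
- ex_known.
- eta_Derive; rewrite (is_derive_unique _ _ _ (is_derive_GG t)),
   (is_derive_unique _ _ _ (is_derive_FF t)); ring.
Qed.

Ltac ex_known ::= repeat split; lazymatch goal with
  | |- ex_derive (fun x => PP _ x) _ => eexists; apply is_derive_PP
  | |- ex_derive (fun x => GG _ x) _ => eexists; apply is_derive_GG
  | |- ex_derive (fun x => FF _ x) _ => eexists; apply is_derive_FF
  | |- ex_derive (fun x => e1 _ x) _ => eexists; apply is_derive_e1
  | |- ex_derive (fun x => DD _ x) _ => eexists; apply is_derive_DD
  end.

Lemma ex_derive_EE t : ex_derive (EE e) t.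
Proof.
unfold EE; auto_derive.
ex_known.
Qed.

Lemma is_derive_KK t : is_derive (KK e) t (KK' e t).
Proof.
unfold KK; auto_derive.
- ex_known.
- eta_Derive; rewrite (is_derive_unique _ _ _ (is_derive_PP t)),
   (is_derive_unique _ _ _ (is_derive_e1 t)), (is_derive_unique _ _ _ (is_derive_DD t)).
  unfold KK'; ring.
Qed.

Lemma rK_pos t : 0 < rK e t.
Proof. apply sqrt_lt_R0, KK_pos. Qed.

Lemma is_derive_VV t : is_derive (VV e) t (VV' e t).
Proof.
assert (k := KK_pos t); assert (r := rK_pos t); unfold VV, rK; auto_derive.
- split; [eexists; apply is_derive_KK|split; [assumption|easy]].
- eta_Derive; rewrite (is_derive_unique _ _ _ (is_derive_KK t)).
  unfold VV', irK, rK in *; field; lra.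
Qed.

Lemma uh'_VV_sqr t : uh' e t ^ 2 + VV e t ^ 2 = EE e t.
Proof.
unfold VV; replace ((sin t * rK e t) ^ 2) with (sin t ^ 2 * rK e t ^ 2) by ring.
unfold rK; rewrite pow2_sqrt by (apply Rlt_le, KK_pos).
unfold uh', KK, DD, EE, GG; generalize (sin_sqr t); generalize (sin t) (cos t).
intros s c hs; ring [hs].
Qed.

Definition rN1 (t : R) : R := / sqrt (GG e t * DD e t * EE e t).
Definition nu10 (t : R) : R := b * GG e t * cos t * rN1 t.
Definition nu1e (t : R) : R := sin t * DD e t * rN1 t.
Definition nu13 (t : R) : R := ga * GG e t * cos t * rN1 t.
Definition nu20 (t : R) : R := ga * GG e t * rN2 e t.
Definition nu23 (t : R) : R := b * FF e t * rN2 e t.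
Definition SS (t : R) : R := e * S1 e t.

Lemma N1_pos t : 0 < GG e t * DD e t * EE e t.
Proof.
apply Rmult_lt_0_compat; [apply Rmult_lt_0_compat|]; [apply GG_pos|apply DD_pos|apply EE_pos].
Qed.

Lemma N2_pos t : 0 < FF e t * GG e t * DD e t.
Proof.
apply Rmult_lt_0_compat; [apply Rmult_lt_0_compat|]; [apply FF_pos|apply GG_pos|apply DD_pos].
Qed.

Lemma rN1_pos t : 0 < rN1 t.
Proof. apply Rinv_0_lt_compat, sqrt_lt_R0, N1_pos. Qed.

Lemma rN2_pos t : 0 < rN2 e t.
Proof. apply Rinv_0_lt_compat, sqrt_lt_R0, N2_pos. Qed.

Lemma inv_sqrt_sqr x : 0 < x -> (/ sqrt x) ^ 2 = / x.
Proof. intros h; rewrite pow_inv, pow2_sqrt; lra. Qed.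

Lemma rN1_sqr t : rN1 t ^ 2 = / (GG e t * DD e t * EE e t).
Proof. apply inv_sqrt_sqr, N1_pos. Qed.

Lemma rN2_sqr t : rN2 e t ^ 2 = / (FF e t * GG e t * DD e t).
Proof. apply inv_sqrt_sqr, N2_pos. Qed.

Lemma rN12E t : rN12 e t = rN1 t * rN2 e t.
Proof.
unfold rN12, rN1, rN2; rewrite sqrt_mult by (apply Rlt_le; [apply N1_pos || apply N2_pos]).
now rewrite Rinv_mult.
Qed.

Lemma hh_sqr t : hh e t ^ 2 = hh2 e t.
Proof. apply pow2_sqrt, Rlt_le, hh2_pos. Qed.

Lemma SS_h2 t : SS t = - h2 e t * rN2 e t * ihh e t.
Proof. unfold SS, S1, h2; ring. Qed.

(** By definition [hh^2 = (h1 rN1)^2 - (h2 rN2)^2], so after division by [hh] the two components are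
    the hyperbolic cosine and sine of the rapidity. The sign of the root comes from [h1 < 0]. *)
Lemma sqrt_SS t : sqrt (1 + SS t ^ 2) = - h1 e t * rN1 t * ihh e t.
Proof.
assert (p1 := rN1_pos t); assert (ph := hh_pos t); assert (p2 := rN2_pos t).
assert (hn : h1 e t < 0) by apply ge.
assert (q1 := rN1_sqr t); assert (q2 := rN2_sqr t); assert (qh := hh_sqr t).
assert (pi : 0 < ihh e t) by (apply Rinv_0_lt_compat, hh_pos).
assert (X : 1 + SS t ^ 2 = (- h1 e t * rN1 t * ihh e t) ^ 2).
{ rewrite SS_h2; unfold ihh.
  apply (Rmult_eq_reg_r (hh e t ^ 2)); [|apply pow_nonzero; lra].
  replace ((- h1 e t * rN1 t * / hh e t) ^ 2 * hh e t ^ 2) with (h1 e t ^ 2 * rN1 t ^ 2)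
    by (field; lra).
  replace ((1 + (- h2 e t * rN2 e t * / hh e t) ^ 2) * hh e t ^ 2) with
    (hh e t ^ 2 + h2 e t ^ 2 * rN2 e t ^ 2) by (field; lra).
  rewrite qh, q1; unfold hh2, iN1; ring. }
rewrite X; apply sqrt_pow2.
apply Rmult_le_pos; [apply Rmult_le_pos|]; lra.
Qed.

(** * The boosted sphere in the Schwarzschild metric *)

Section Schwarzschild.

Variables M r : R.
Hypothesis hM : 0 < M.
Hypothesis hr : 0 < r.
Hypothesis he : e = M / (2 * r).

Definition Y0 (t : R) : R := b * r * cos t.
Definition Ye (t : R) : R := r * sin t.
Definition Y3 (t : R) : R := ga * r * cos t.
Definition al (t : R) : R := e * fh e t / r ^ 2.
Definition be (t : R) : R := e * gh e t / r ^ 2.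

Lemma Derive_Y0 t : Derive Y0 t = - b * r * sin t.
Proof. apply is_derive_unique; unfold Y0; auto_derive; [easy|ring]. Qed.
Lemma Derive_Ye t : Derive Ye t = r * cos t.
Proof. apply is_derive_unique; unfold Ye; auto_derive; [easy|ring]. Qed.
Lemma Derive_Y3 t : Derive Y3 t = - ga * r * sin t.
Proof. apply is_derive_unique; unfold Y3; auto_derive; [easy|ring]. Qed.
Lemma Derive2_Y0 t : Derive (Derive Y0) t = - b * r * cos t.
Proof.
rewrite (Derive_ext _ _ _ Derive_Y0); apply is_derive_unique; auto_derive; [easy|ring].
Qed.
Lemma Derive2_Ye t : Derive (Derive Ye) t = - r * sin t.
Proof.
rewrite (Derive_ext _ _ _ Derive_Ye); apply is_derive_unique; auto_derive; [easy|ring].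
Qed.
Lemma Derive2_Y3 t : Derive (Derive Y3) t = - ga * r * cos t.
Proof.
rewrite (Derive_ext _ _ _ Derive_Y3); apply is_derive_unique; auto_derive; [easy|ring].
Qed.

Lemma rho_sphere t p : rho (ax Y0 Ye Y3 t p) = r / zz t.
Proof.
assert (q := q_pos t); unfold rho, ax, axv, Y0, Ye, Y3, zz; simpl vec4.
replace ((r * sin t * sin p) ^ 2 + (r * sin t * cos p) ^ 2 + (ga * r * cos t) ^ 2)
  with (r ^ 2 * (1 + b ^ 2 * cos t ^ 2)).
- rewrite sqrt_mult, sqrt_pow2 by (try apply pow2_ge_0; lra).
  field; apply Rgt_not_eq, sqrt_lt_R0; lra.
- replace ((ga * r * cos t) ^ 2) with (ga ^ 2 * r ^ 2 * cos t ^ 2) by ring; rewrite hga.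
  generalize (sin_sqr' p) (sin_sqr t); intros s1 s2; ring [s1 s2].
Qed.

Lemma half_mass_sphere t p : M / (2 * rho (ax Y0 Ye Y3 t p)) = e * zz t.
Proof.
destruct (zz_pos t); rewrite rho_sphere, he; field; lra.
Qed.

Lemma schwarzschild_axial : axial_metric (schwarzschild M) Y0 Ye Y3 (FF e) (GG e) al be.
Proof.
intros t p ht; split; [apply FF_pos|split; [apply GG_pos|]].
assert (P0 := PP_pos t); assert (M0 := MM_pos t); destruct (zz_pos t) as [z0 _].
assert (R0 : 0 < rho (ax Y0 Ye Y3 t p)).
{ rewrite rho_sphere; apply Rdiv_lt_0_compat; lra. }
split.
- unfold schwarzschild, Fsq, Gsq; rewrite half_mass_sphere.
  unfold FF, GG, MM, iP, PP in *.
  apply vec_ext; simpl; field; lra.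
- intros i j k; rewrite (dgcomp_schwarzschild M) by (rewrite ?half_mass_sphere; assumption).
  rewrite half_mass_sphere, rho_sphere.
  replace (1 + e * zz t) with (PP e t) by reflexivity.
  replace (1 - e * zz t) with (MM e t) by reflexivity.
  assert (M1 : M = 2 * r * e) by (rewrite he; field; lra).
  unfold al, be, fh, gh, iP.
  destruct (idx_eqb j k); [|reflexivity].
  destruct j; rewrite M1; field; lra.
Qed.

Lemma Eth_sphere t :
  - FF e t * Derive Y0 t ^ 2 + GG e t * (Derive Ye t ^ 2 + Derive Y3 t ^ 2) = r ^ 2 * EE e t.
Proof.
rewrite Derive_Y0, Derive_Ye, Derive_Y3; unfold EE.
replace ((- ga * r * sin t) ^ 2) with (ga ^ 2 * r ^ 2 * sin t ^ 2) by ring; rewrite hga.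
generalize (sin_sqr t); intros s; ring [s].
Qed.

Lemma Gph_sphere t : GG e t * Ye t ^ 2 = r ^ 2 * uh e t ^ 2.
Proof. unfold GG, Ye, uh; ring. Qed.

Lemma sin_pos t : 0 < t < PI -> 0 < sin t.
Proof. intros; apply sin_gt_0; lra. Qed.

Lemma uh_pos t : 0 < t < PI -> 0 < uh e t.
Proof.
intros; apply Rmult_lt_0_compat; [now apply sin_pos|apply pow_lt, PP_pos].
Qed.

Lemma Eth_sphere_pos t : 0 < t < PI ->
  0 < - FF e t * Derive Y0 t ^ 2 + GG e t * (Derive Ye t ^ 2 + Derive Y3 t ^ 2).
Proof.
intros; rewrite Eth_sphere; apply Rmult_lt_0_compat; [apply pow_lt; lra|apply EE_pos].
Qed.

Lemma Gph_sphere_pos t : 0 < t < PI -> 0 < GG e t * Ye t ^ 2.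
Proof.
intros; rewrite Gph_sphere; apply Rmult_lt_0_compat; apply pow_lt; [lra|now apply uh_pos].
Qed.

Lemma metric_derivative_sphere : metric_derivative Ye Y3 (FF e) (GG e) al be.
Proof.
intros t ht.
assert (X : Derive Ye t * Ye t + Derive Y3 t * Y3 t = - b ^ 2 * sin t * cos t * r ^ 2).
{ rewrite Derive_Ye, Derive_Y3; unfold Ye, Y3.
  replace (- ga * r * sin t * (ga * r * cos t)) with (- ga ^ 2 * r ^ 2 * sin t * cos t) by ring.
  rewrite hga; ring. }
rewrite X; unfold al, be; split.
- replace (e * fh e t / r ^ 2 * (- b ^ 2 * sin t * cos t * r ^ 2)) with
    (- b ^ 2 * sin t * cos t * e * fh e t) by (field; lra); apply is_derive_FF.
- replace (e * gh e t / r ^ 2 * (- b ^ 2 * sin t * cos t * r ^ 2)) with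
    (- b ^ 2 * sin t * cos t * e * gh e t) by (field; lra); apply is_derive_GG.
Qed.

Lemma h2E t : h2 e t = - FF e t * (ga * GG e t) * W0 e t + GG e t * (b * FF e t) * W3 e t.
Proof.
assert (F0 := FF_pos t); assert (G0 := GG_pos t).
unfold h2, h2e, W0, W3, iF, iG; field; lra.
Qed.

Lemma tr0_sphere t : tr0 Y0 Ye Y3 (FF e) (GG e) al t = W0 e t / r.
Proof.
assert (F0 := FF_pos t); assert (E0 := EE_pos t).
unfold tr0, gam0; rewrite Eth_sphere, Derive2_Y0, Derive_Y0, Derive_Ye, Derive_Y3.
replace (r * cos t * Ye t + - ga * r * sin t * Y3 t) with (- b ^ 2 * sin t * cos t * r ^ 2).
2:{ unfold Ye, Y3; replace (- ga * r * sin t * (ga * r * cos t))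
     with (- ga ^ 2 * r ^ 2 * sin t * cos t) by ring; rewrite hga; ring. }
unfold al, W0, iE, iF; field; lra.
Qed.

Lemma tre_sphere t : 0 < t < PI ->
  tre Y0 Ye Y3 (FF e) (GG e) al be t = sWe e t / (r * sin t).
Proof.
intros ht; assert (s0 := sin_pos t ht).
assert (F0 := FF_pos t); assert (E0 := EE_pos t); assert (G0 := GG_pos t).
unfold tre, game; rewrite Eth_sphere, Derive2_Ye, Derive_Y0, Derive_Ye, Derive_Y3.
replace (r * cos t * Ye t + - ga * r * sin t * Y3 t) with (- b ^ 2 * sin t * cos t * r ^ 2).
2:{ unfold Ye, Y3; replace (- ga * r * sin t * (ga * r * cos t))
     with (- ga ^ 2 * r ^ 2 * sin t * cos t) by ring; rewrite hga; ring. }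
replace (r * cos t * (r * cos t) + - ga * r * sin t * (- ga * r * sin t))
  with (r ^ 2 * (1 + b ^ 2 * sin t ^ 2)).
2:{ replace (- ga * r * sin t * (- ga * r * sin t))
     with (ga ^ 2 * r ^ 2 * sin t ^ 2) by ring; rewrite hga.
  generalize (sin_sqr t); intros s; ring [s]. }
unfold al, be, sWe, iE, iG, Ye; field; lra.
Qed.

Lemma tr3_sphere t : 0 < t < PI ->
  tr3 Y0 Ye Y3 (FF e) (GG e) al be t = W3 e t / r.
Proof.
intros ht; assert (s0 := sin_pos t ht).
assert (F0 := FF_pos t); assert (E0 := EE_pos t); assert (G0 := GG_pos t).
unfold tr3, gam3; rewrite Eth_sphere, Derive2_Y3, Derive_Y0, Derive_Ye, Derive_Y3.
replace (r * cos t * Ye t + - ga * r * sin t * Y3 t) with (- b ^ 2 * sin t * cos t * r ^ 2).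
2:{ unfold Ye, Y3; replace (- ga * r * sin t * (ga * r * cos t))
     with (- ga ^ 2 * r ^ 2 * sin t * cos t) by ring; rewrite hga; ring. }
replace (r * cos t * (r * cos t) + - ga * r * sin t * (- ga * r * sin t))
  with (r ^ 2 * (1 + b ^ 2 * sin t ^ 2)).
2:{ replace (- ga * r * sin t * (- ga * r * sin t))
     with (ga ^ 2 * r ^ 2 * sin t ^ 2) by ring; rewrite hga.
  generalize (sin_sqr t); intros s; ring [s]. }
unfold al, be, W3, iE, iG, Ye, Y3; field; lra.
Qed.

(* The meridian direction is [(- b s, c, - ga s)]; [(b g c, s D, ga g c)] and [(ga g, 0, b f)]
   span the normal plane and have squared norms [g D E] and [- f g D]. *)
Lemma normal_decomposition f g s c w0 we w3 D E :
  ga ^ 2 = 1 + b ^ 2 -> s ^ 2 = 1 - c ^ 2 ->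
  D = g + b ^ 2 * (g - f) -> E = g + b ^ 2 * s ^ 2 * (g - f) ->
  f <> 0 -> g <> 0 -> D <> 0 -> E <> 0 ->
  let m := (- f * w0 * (- b * s) + g * (we * c + w3 * (- ga * s))) / E in
  let x1 := (- f * (b * g * c) * w0 + g * D * (s * we) + g * (ga * g * c) * w3) / (g * D * E) in
  let x2 := (- f * (ga * g) * w0 + g * (b * f) * w3) / (f * g * D) in
  w0 - m * (- b * s) = x1 * (b * g * c) - x2 * (ga * g) /\
  we - m * c = x1 * (s * D) /\
  w3 - m * (- ga * s) = x1 * (ga * g * c) - x2 * (b * f).
Proof.
intros hg hs hD hE f0 g0 D0 E0 m x1 x2; unfold m, x1, x2; clear m x1 x2.
repeat split; field_simplify_eq; try tauto; rewrite hE, hD; ring [hs hg].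
Qed.

Ltac ex_known ::= repeat split; lazymatch goal with
  | |- ex_derive (fun x => PP _ x) _ => eexists; apply is_derive_PP
  | |- ex_derive (fun x => GG _ x) _ => eexists; apply is_derive_GG
  | |- ex_derive (fun x => FF _ x) _ => eexists; apply is_derive_FF
  | |- ex_derive (fun x => e1 _ x) _ => eexists; apply is_derive_e1
  | |- ex_derive (fun x => DD _ x) _ => eexists; apply is_derive_DD
  | |- ex_derive (fun x => EE _ x) _ => apply ex_derive_EE
  | |- True => exact I
  | |- _ => idtac
  end.

Lemma ex_derive_rN1 t : ex_derive rN1 t.
Proof.
assert (n := N1_pos t); assert (q := sqrt_lt_R0 _ n).
unfold rN1; auto_derive; ex_known; try assumption; lra.
Qed.

Lemma ex_derive_rN2 t : ex_derive (rN2 e) t.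
Proof.
assert (n := N2_pos t); assert (q := sqrt_lt_R0 _ n).
unfold rN2; auto_derive; ex_known; try assumption; lra.
Qed.

Lemma ex_derive_nu t : ex_derive nu10 t /\ ex_derive nu1e t /\ ex_derive nu13 t /\
  ex_derive nu20 t /\ ex_derive nu23 t.
Proof.
unfold nu10, nu1e, nu13, nu20, nu23; repeat split; auto_derive; ex_known;
  (apply ex_derive_rN1 || apply ex_derive_rN2).
Qed.

Lemma nu_orthonormal t :
  dot (FF e) (GG e) t (nu10 t) (nu1e t) (nu13 t) (nu10 t) (nu1e t) (nu13 t) = 1 /\
  dot (FF e) (GG e) t (nu20 t) 0 (nu23 t) (nu20 t) 0 (nu23 t) = -1 /\
  dot (FF e) (GG e) t (nu10 t) (nu1e t) (nu13 t) (nu20 t) 0 (nu23 t) = 0.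
Proof.
assert (F0 := FF_pos t); assert (G0 := GG_pos t); assert (D0 := DD_pos t); assert (E0 := EE_pos t).
assert (q1 := rN1_sqr t); assert (q2 := rN2_sqr t).
unfold dot, nu10, nu1e, nu13, nu20, nu23; repeat split.
- transitivity (rN1 t ^ 2 * (GG e t * (DD e t ^ 2 * sin t ^ 2
   + GG e t * cos t ^ 2 * (ga ^ 2 * GG e t - b ^ 2 * FF e t)))); [ring|].
  rewrite q1, hga; apply (Rmult_eq_reg_r (GG e t * DD e t * EE e t));
    [|apply Rgt_not_eq, N1_pos].
  transitivity (GG e t * (DD e t ^ 2 * sin t ^ 2
   + GG e t * cos t ^ 2 * ((1 + b ^ 2) * GG e t - b ^ 2 * FF e t))); [field; lra|].
  unfold EE, DD; generalize (sin_sqr t); intros s; ring [s].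
- transitivity (rN2 e t ^ 2 * (- FF e t * GG e t * (ga ^ 2 * GG e t - b ^ 2 * FF e t))); [ring|].
  rewrite q2, hga.
  replace ((1 + b ^ 2) * GG e t - b ^ 2 * FF e t) with (DD e t) by (unfold DD; ring).
  field; lra.
- ring.
Qed.

Lemma adapted_frame_sphere : adapted_frame (schwarzschild M) Y0 Ye Y3 (FF e) (GG e)
  (fun t => hh e t / r) SS nu10 nu1e nu13 nu20 (fun _ => 0) nu23.
Proof.
intros t ht.
assert (F0 := FF_pos t); assert (G0 := GG_pos t); assert (D0 := DD_pos t); assert (E0 := EE_pos t).
assert (p1 := rN1_pos t); assert (p2 := rN2_pos t); assert (ph := hh_pos t).
assert (q1 := rN1_sqr t); assert (q2 := rN2_sqr t).
assert (s0 := sin_pos t ht).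
destruct (nu_orthonormal t) as [o1 [o2 o3]].
split; [assumption|split; [assumption|split; [assumption|]]].
split; [|split; [|split; [|split]]].
- rewrite Derive_Y0, Derive_Ye, Derive_Y3; unfold dot, nu10, nu1e, nu13.
  transitivity (r * sin t * cos t * GG e t * rN1 t * (b ^ 2 * FF e t + DD e t - ga ^ 2 * GG e t));
    [ring|].
  rewrite hga; unfold DD; ring.
- rewrite Derive_Y0, Derive_Ye, Derive_Y3; unfold dot, nu20, nu23; ring.
- apply Rdiv_lt_0_compat; lra.
(* The time component of [J / |H|] factors into positive terms and the last inequality in [good]. *)
- rewrite sqrt_SS, SS_h2; unfold nu20, nu10.
  replace (- h1 e t * rN1 t * ihh e t * (ga * GG e t * rN2 e t) -
    - h2 e t * rN2 e t * ihh e t * (b * GG e t * cos t * rN1 t)) with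
   (rN1 t * rN2 e t * ihh e t * GG e t * (- h1 e t * ga + h2 e t * (b * cos t))) by ring.
  assert (0 < ihh e t) by now apply Rinv_0_lt_compat.
  destruct (proj2 ge t) as [_ [_ [_ [_ [_ [_ [_ [hfut _]]]]]]]].
  repeat (first [assumption | apply Rmult_lt_0_compat]).
- intros p; rewrite (mean_curv_axial _ _ _ _ _ _ _ _ schwarzschild_axial
    Eth_sphere_pos Gph_sphere_pos) by assumption.
  rewrite sqrt_SS, SS_h2; unfold trt.
  rewrite Eth_sphere, tr0_sphere, tre_sphere, tr3_sphere, Derive_Y0, Derive_Ye, Derive_Y3 by assumption.
  assert (nd := normal_decomposition (FF e t) (GG e t) (sin t) (cos t) (W0 e t)
    (sWe e t / sin t) (W3 e t) (DD e t) (EE e t) hga (sin_sqr t) eq_refl eq_refl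
    ltac:(lra) ltac:(lra) ltac:(lra) ltac:(lra)).
  cbv zeta in nd.
  replace (sin t * (sWe e t / sin t)) with (sWe e t) in nd by (field; lra).
  fold (h1 e t) in nd; rewrite <- h2E in nd.
  destruct nd as [nd0 [nde nd3]].
  unfold ihh, nu10, nu1e, nu13, nu20, nu23.
  (* The factor [hh] cancels against [ihh], and the squares of [rN1] and [rN2] are the inverse
     squared norms in [normal_decomposition]. *)
  assert (X : forall n1 n2, hh e t / r * (- h2 e t * rN2 e t * / hh e t * (n2 * rN2 e t)
     - - h1 e t * rN1 t * / hh e t * (n1 * rN1 t)) =
     / r * (h1 e t / (GG e t * DD e t * EE e t) * n1 - h2 e t / (FF e t * GG e t * DD e t) * n2)).
  { intros n1 n2.
    transitivity (/ r * (h1 e t * rN1 t ^ 2 * n1 - h2 e t * rN2 e t ^ 2 * n2)); [field; lra|].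
    rewrite q1, q2; unfold Rdiv; ring. }
  (* The radial component of the second normal is zero; this shape lets [X] apply to it like to the
     other two. *)
  replace 0 with (0 * rN2 e t) at 1 by ring.
  rewrite !X; f_equal.
  + rewrite <- nd0; field; lra.
  + rewrite Rmult_0_r, Rminus_0_r, <- nde; field; lra.
  + rewrite <- nd3; field; lra.
Qed.

(** Differentiating the normalization [rN2] only adds a multiple of the second normal, which is
    orthogonal to the first; hence no derivative of [rN2] appears in [conn2e]. *)
Lemma frame_connection t :
  dot (FF e) (GG e) t
    (nabla0 Y0 Ye Y3 (FF e) al nu20 (fun _ => 0) nu23 t)
    (nablae Y0 Ye Y3 (GG e) al be nu20 (fun _ => 0) nu23 t)
    (nabla3 Y0 Ye Y3 (GG e) al be nu20 (fun _ => 0) nu23 t)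
    (nu10 t) (nu1e t) (nu13 t) = e * cn e t.
Proof.
assert (F0 := FF_pos t); assert (G0 := GG_pos t).
assert (dn : forall (f : R -> R) k l, is_derive f t l ->
  Derive (fun s => k * f s * rN2 e s) t = k * l * rN2 e t + k * f t * Derive (rN2 e) t).
{ intros f k l hf; apply is_derive_unique; auto_derive.
  - repeat split; [eexists; exact hf|apply ex_derive_rN2].
  - eta_Derive; rewrite (is_derive_unique _ _ _ hf); ring. }
unfold dot, nabla0, nablae, nabla3, gam0, game, gam3.
rewrite Derive_Y0, Derive_Ye, Derive_Y3.
replace (Derive nu20 t) with (Derive (fun s => ga * GG e s * rN2 e s) t) by reflexivity.
replace (Derive nu23 t) with (Derive (fun s => b * FF e s * rN2 e s) t) by reflexivity.
rewrite (dn _ _ _ (is_derive_GG t)), (dn _ _ _ (is_derive_FF t)), Derive_const.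
replace (r * cos t * Ye t + - ga * r * sin t * Y3 t) with (- b ^ 2 * sin t * cos t * r ^ 2).
2:{ unfold Ye, Y3; replace (- ga * r * sin t * (ga * r * cos t))
     with (- ga ^ 2 * r ^ 2 * sin t * cos t) by ring; rewrite hga; ring. }
unfold cn, conn2e; cbv zeta; rewrite rN12E.
unfold nu10, nu1e, nu13, nu20, nu23, al, be, Ye, Y3, iF, iG.
field; lra.
Qed.

Lemma normal_connection_sphere (w : tidx -> R) t p : 0 < t < PI ->
  normal_connection (schwarzschild M) (ax Y0 Ye Y3) w t p =
  w Th * (Derive SS t / sqrt (1 + SS t ^ 2) - e * cn e t).
Proof.
intros ht; destruct (ex_derive_nu t) as [d1 [d2 [d3 [d4 d5]]]].
rewrite (normal_connection_frame _ _ _ _ _ _ _ _ schwarzschild_axial Eth_sphere_pos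
  Gph_sphere_pos _ _ _ _ _ _ _ _ adapted_frame_sphere); auto.
- now rewrite frame_connection.
- apply metric_derivative_sphere.
- unfold SS; auto_derive; destruct ge as [_ g]; apply g.
- apply ex_derive_const.
Qed.

(** Differentiated through the profile curve instead of [FF] and [GG], the form that matches the
    curvature and the Laplacian of the embedded surface. *)
Lemma is_derive_EE t : is_derive (EE e) t (2 * (uh' e t * uh'' e t + VV e t * VV' e t)).
Proof.
apply (is_derive_ext (fun t => uh' e t ^ 2 + VV e t ^ 2)); [exact uh'_VV_sqr|].
auto_derive.
- repeat split; [eexists; apply is_derive_uh'|eexists; apply is_derive_VV].
- eta_Derive; rewrite (is_derive_unique _ _ _ (is_derive_uh' t)),
    (is_derive_unique _ _ _ (is_derive_VV t)); ring.
Qed.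

Lemma rE_pos t : 0 < rE e t.
Proof. apply Rinv_0_lt_compat, sqrt_lt_R0, EE_pos. Qed.

Lemma rE_sqr t : rE e t ^ 2 * EE e t = 1.
Proof.
assert (E0 := EE_pos t); unfold rE; rewrite inv_sqrt_sqr by assumption; field; lra.
Qed.

Lemma sqrt_EE t : sqrt (EE e t) = / rE e t.
Proof. unfold rE; now rewrite Rinv_inv. Qed.

Lemma is_derive_rE t :
  is_derive (rE e) t (- (uh' e t * uh'' e t + VV e t * VV' e t) * rE e t ^ 3).
Proof.
assert (E0 := EE_pos t); assert (q := sqrt_lt_R0 _ E0).
unfold rE; auto_derive.
- split; [eexists; apply is_derive_EE|split; [assumption|split; [lra|easy]]].
- eta_Derive; rewrite (is_derive_unique _ _ _ (is_derive_EE t)).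
  field; lra.
Qed.

(** * The embedded surface in Minkowski space and the energy integrand *)

Section Embedding.

Variables u v : R -> R.
Hypothesis hu : forall t, 0 < t < PI -> u t = r * uh e t.
Hypothesis hv : forall t, 0 < t < PI -> is_derive v t (- r * VV e t).

Lemma is_derive_u t : 0 < t < PI -> is_derive u t (r * uh' e t).
Proof.
intros ht; apply (is_derive_ext_loc (fun t => r * uh e t)).
- apply locally_Ioo; [assumption|]; intros s hs; symmetry; auto.
- apply is_derive_scal, is_derive_uh.
Qed.

Lemma Derive_u t : 0 < t < PI -> Derive u t = r * uh' e t.
Proof. intros; now apply is_derive_unique, is_derive_u. Qed.

Lemma Derive_v t : 0 < t < PI -> Derive v t = - r * VV e t.
Proof. intros; now apply is_derive_unique, hv. Qed.

Lemma Derive2_u t : 0 < t < PI -> Derive (Derive u) t = r * uh'' e t.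
Proof.
intros ht; rewrite (Derive_ext_loc _ (fun t => r * uh' e t)).
- apply is_derive_unique, is_derive_scal, is_derive_uh'.
- apply locally_Ioo; [assumption|exact Derive_u].
Qed.

Lemma Derive2_v t : 0 < t < PI -> Derive (Derive v) t = - r * VV' e t.
Proof.
intros ht; rewrite (Derive_ext_loc _ (fun t => - r * VV e t)).
- apply is_derive_unique, is_derive_scal, is_derive_VV.
- apply locally_Ioo; [assumption|exact Derive_v].
Qed.

Lemma minkowski_axial : axial_metric minkowski (fun _ => 0) u v
  (fun _ => 1) (fun _ => 1) (fun _ => 0) (fun _ => 0).
Proof.
intros t p ht; split; [lra|split; [lra|split]].
- apply vec_ext; simpl; ring.
- intros i j k; unfold dgcomp, gcomp, minkowski.
  rewrite Derive_const; destruct (idx_eqb j k); [destruct j; ring|reflexivity].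
Qed.

Lemma Eth_embedding t : 0 < t < PI ->
  - 1 * Derive (fun _ => 0) t ^ 2 + 1 * (Derive u t ^ 2 + Derive v t ^ 2) = r ^ 2 * EE e t.
Proof.
intros ht; rewrite Derive_const, Derive_u, Derive_v, <- uh'_VV_sqr by assumption; ring.
Qed.

Lemma Eth_embedding_pos t : 0 < t < PI ->
  0 < - 1 * Derive (fun _ => 0) t ^ 2 + 1 * (Derive u t ^ 2 + Derive v t ^ 2).
Proof.
intros; rewrite Eth_embedding by assumption.
apply Rmult_lt_0_compat; [apply pow_lt; lra|apply EE_pos].
Qed.

Lemma Gph_embedding_pos t : 0 < t < PI -> 0 < 1 * u t ^ 2.
Proof.
intros; rewrite hu by assumption; apply Rmult_lt_0_compat; [lra|].
apply pow_lt, Rmult_lt_0_compat; [lra|now apply uh_pos].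
Qed.

Lemma rK_uh t : 0 < t < PI -> rK e t * iP e t ^ 2 = VV e t / uh e t.
Proof.
intros ht; assert (s0 := sin_pos t ht); assert (P0 := PP_pos t).
unfold VV, uh, iP; field; lra.
Qed.

(** The frame consists of the outward normal in [R^3] and the time direction. The mean curvature
    vector lies in [R^3], so the rapidity is zero. *)
Lemma adapted_frame_embedding : adapted_frame minkowski (fun _ => 0) u v
  (fun _ => 1) (fun _ => 1) (fun t => kk e t / r) (fun _ => 0)
  (fun _ => 0) (fun t => VV e t * rE e t) (fun t => uh' e t * rE e t)
  (fun _ => 1) (fun _ => 0) (fun _ => 0).
Proof.
intros t ht.
assert (R0 := rE_pos t); assert (R2 := rE_sqr t); rewrite <- uh'_VV_sqr in R2.
assert (C1 : sqrt (1 + 0 ^ 2) = 1) by (replace (1 + 0 ^ 2) with 1 by ring; apply sqrt_1).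
rewrite C1, (Derive_const 0 t), Derive_u, Derive_v by assumption.
unfold dot.
split; [|split; [|split; [|split; [|split; [|split; [|split]]]]]]; try (ring || lra).
- apply Rdiv_lt_0_compat; [apply kk_pos|assumption].
- intros p; rewrite (mean_curv_axial _ _ _ _ _ _ _ _ minkowski_axial
    Eth_embedding_pos Gph_embedding_pos) by assumption.
  assert (u0 := uh_pos t ht); assert (E0 := EE_pos t); assert (E1 := uh'_VV_sqr t).
  assert (D0 : Derive (Derive (fun _ : R => 0)) t = 0).
  { rewrite (Derive_ext _ (fun _ => 0)); [apply Derive_const|intros; apply Derive_const]. }
  unfold trt, tr0, tre, tr3, gam0, game, gam3.
  rewrite !Eth_embedding, D0, !(Derive_const 0 t), !Derive2_u, !Derive2_v, !Derive_u, !Derive_v,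
    !hu by assumption.
  unfold kk; rewrite rK_uh by assumption.
  assert (X : forall c, (VV e t / uh e t * rE e t + (uh' e t * VV' e t - uh'' e t * VV e t) * rE e t ^ 3)
     / r * (0 * 0 - 1 * (c * rE e t)) =
     - c / r * (VV e t / uh e t / EE e t + (uh' e t * VV' e t - uh'' e t * VV e t) / EE e t ^ 2)).
  { intros c; assert (R3 : rE e t ^ 2 = / EE e t).
    { apply (Rmult_eq_reg_r (EE e t)); [|lra]. rewrite rE_sqr; field; lra. }
    transitivity (- c / r * (VV e t / uh e t * rE e t ^ 2
      + (uh' e t * VV' e t - uh'' e t * VV e t) * (rE e t ^ 2) ^ 2)); [field; lra|].
    rewrite R3; field; lra. }
  rewrite !X; rewrite <- E1 in *; f_equal; field; lra.
Qed.

Lemma mean_curv_norm_embedding t p : 0 < t < PI ->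
  mean_curv_norm minkowski (ax (fun _ => 0) u v) t p = kk e t / r.
Proof.
exact (mean_curv_norm_frame _ _ _ _ _ _ _ _ minkowski_axial _ _ _ _ _ _ _ _ adapted_frame_embedding t p).
Qed.

Lemma mean_curv_norm_sphere t p : 0 < t < PI ->
  mean_curv_norm (schwarzschild M) (ax Y0 Ye Y3) t p = hh e t / r.
Proof.
exact (mean_curv_norm_frame _ _ _ _ _ _ _ _ schwarzschild_axial _ _ _ _ _ _ _ _ adapted_frame_sphere t p).
Qed.

Lemma normal_connection_embedding (w : tidx -> R) t p : 0 < t < PI ->
  normal_connection minkowski (ax (fun _ => 0) u v) w t p = 0.
Proof.
intros ht.
rewrite (normal_connection_frame _ _ _ _ _ _ _ _ minkowski_axial Eth_embedding_pos
  Gph_embedding_pos _ _ _ _ _ _ _ _ adapted_frame_embedding w t p ht);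
  [| |apply ex_derive_const|apply ex_derive_const| | |apply ex_derive_const
   |apply ex_derive_const|apply ex_derive_const].
- unfold dot, nabla0, nablae, nabla3, gam0, game, gam3.
  rewrite !(Derive_const _ t); unfold Rdiv; ring.
- intros s hs; split.
  + replace (0 * (Derive u s * u s + Derive v s * v s)) with 0 by ring.
    apply (is_derive_const (V := R_NormedModule)).
  + replace (0 * (Derive u s * u s + Derive v s * v s)) with 0 by ring.
    apply (is_derive_const (V := R_NormedModule)).
- auto_derive; split; [eexists; apply is_derive_VV|split; [eexists; apply is_derive_rE|easy]].
- auto_derive; split; [eexists; apply is_derive_uh'|split; [eexists; apply is_derive_rE|easy]].
Qed.

Variables a1 a2 a3 : R.

Definition ww (p : R) : R := a1 * sin p + a2 * cos p.
Definition ww' (p : R) : R := a1 * cos p - a2 * sin p.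
Definition asqr : R := a1 ^ 2 + a2 ^ 2 + a3 ^ 2.
Definition nu (t p : R) : R := (VV e t * ww p + uh' e t * a3) * rE e t.

Let tau := time_function (rotational u v) (observer a1 a2 a3).

Lemma tauE t p : tau t p = - (u t * ww p + v t * a3).
Proof.
unfold tau, time_function, ip, sum4, minkowski, observer, rotational, ww; simpl; ring.
Qed.

Lemma tau_Th t p : 0 < t < PI ->
  pd Th tau t p = - r * (uh' e t * ww p - VV e t * a3).
Proof.
intros ht; unfold pd; rewrite (Derive_ext _ _ _ (fun t => tauE t p)).
apply is_derive_unique; auto_derive.
- split; [eexists; now apply is_derive_u|split; [eexists; now apply hv|easy]].
- eta_Derive; rewrite Derive_u, Derive_v by assumption; ring.
Qed.

Lemma tau_Ph t p : 0 < t < PI -> pd Ph tau t p = - r * uh e t * ww' p.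
Proof.
intros ht; unfold pd; rewrite (Derive_ext _ _ _ (fun p => tauE t p)).
apply is_derive_unique; unfold ww, ww'; rewrite hu by assumption; auto_derive; [easy|ring].
Qed.

Lemma grad_sq_tau t p : 0 < t < PI ->
  grad_sq (schwarzschild M) (ax Y0 Ye Y3) tau t p = asqr - nu t p ^ 2.
Proof.
intros ht; rewrite (grad_sq_axial _ _ _ _ _ _ _ _ schwarzschild_axial Eth_sphere_pos
  Gph_sphere_pos) by assumption.
rewrite Eth_sphere, Gph_sphere, tau_Th, tau_Ph by assumption.
assert (u0 := uh_pos t ht); assert (E0 := EE_pos t); assert (E1 := uh'_VV_sqr t).
assert (R3 : rE e t ^ 2 = / EE e t).
{ apply (Rmult_eq_reg_r (EE e t)); [|lra]. rewrite rE_sqr; field; lra. }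
assert (w2 : ww' p ^ 2 = a1 ^ 2 + a2 ^ 2 - ww p ^ 2).
{ unfold ww', ww; generalize (sin_sqr p); intros s; ring [s]. }
unfold nu; replace (((VV e t * ww p + uh' e t * a3) * rE e t) ^ 2) with
  ((VV e t * ww p + uh' e t * a3) ^ 2 * rE e t ^ 2) by ring.
rewrite R3; replace ((- r * uh e t * ww' p) ^ 2) with (r ^ 2 * uh e t ^ 2 * ww' p ^ 2) by ring.
rewrite w2; unfold asqr; rewrite <- E1 in *; field; lra.
Qed.

Lemma sqrt_area t : 0 < t < PI ->
  sqrt (r ^ 2 * EE e t * (r ^ 2 * uh e t ^ 2)) = r ^ 2 * uh e t * / rE e t.
Proof.
intros ht; assert (u0 := uh_pos t ht); assert (E0 := EE_pos t); rewrite <- sqrt_EE.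
replace (r ^ 2 * EE e t * (r ^ 2 * uh e t ^ 2)) with ((r ^ 2 * uh e t) ^ 2 * EE e t) by ring.
assert (0 < r ^ 2 * uh e t) by (apply Rmult_lt_0_compat; [apply pow_lt|]; lra).
rewrite sqrt_mult, sqrt_pow2 by (try apply pow2_ge_0; lra); reflexivity.
Qed.

(** An instance of [lap X = H_0] with [H_0 = - |H_0|] times the outward normal, obtained here from
    the divergence form and the profile curve. The induced metrics agree, so the Laplacian of the
    sphere is that of the embedded surface. *)
Lemma laplacian_tau t p : 0 < t < PI ->
  laplacian (schwarzschild M) (ax Y0 Ye Y3) tau t p = kk e t / r * nu t p.
Proof.
intros ht; rewrite (laplacian_axial _ _ _ _ _ _ _ _ schwarzschild_axial Eth_sphere_pos
  Gph_sphere_pos) by assumption.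
assert (u0 := uh_pos t ht); assert (E0 := EE_pos t); assert (E1 := uh'_VV_sqr t).
assert (R0 := rE_pos t); assert (R2 := rE_sqr t).
rewrite Eth_sphere, Gph_sphere, sqrt_area by assumption.
rewrite (Derive_ext_loc _ (fun s => - r * uh e s * rE e s * (uh' e s * ww p - VV e s * a3))).
2:{ apply locally_Ioo; [assumption|]; intros s hs.
  rewrite Eth_sphere, Gph_sphere, sqrt_area, tau_Th by assumption.
  assert (R2' := rE_sqr s); assert (R0' := rE_pos s); assert (E0' := EE_pos s).
  assert (R3' : / rE e s = EE e s * rE e s).
  { apply (Rmult_eq_reg_r (rE e s)); [|lra]. rewrite Rinv_l by lra. lra. }
  rewrite R3'; field; lra. }
rewrite (is_derive_unique _ t
  (- r * (uh' e t * rE e t * (uh' e t * ww p - VV e t * a3)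
   + uh e t * (- (uh' e t * uh'' e t + VV e t * VV' e t) * rE e t ^ 3) * (uh' e t * ww p - VV e t * a3)
   + uh e t * rE e t * (uh'' e t * ww p - VV' e t * a3)))).
2:{ auto_derive.
  - repeat split; [eexists; apply is_derive_uh|eexists; apply is_derive_rE|
      eexists; apply is_derive_uh'|eexists; apply is_derive_VV].
  - eta_Derive; rewrite (is_derive_unique _ _ _ (is_derive_uh t)),
    (is_derive_unique _ _ _ (is_derive_uh' t)), (is_derive_unique _ _ _ (is_derive_VV t)),
    (is_derive_unique _ _ _ (is_derive_rE t)); ring. }
rewrite (Derive_ext _ (fun q => - r * / rE e t * ww' q)).
2:{ intros q; rewrite tau_Ph by assumption; field; lra. }
replace (Derive (fun q => - r * / rE e t * ww' q) p) with (r * / rE e t * ww p).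
2:{ symmetry; apply is_derive_unique; unfold ww', ww; auto_derive; [easy|ring]. }
unfold nu, kk; rewrite rK_uh by assumption.
rewrite <- E1 in R2.
assert (R3 : rE e t ^ 2 * uh' e t ^ 2 = 1 - rE e t ^ 2 * VV e t ^ 2) by lra.
field_simplify_eq; [|lra]. ring [R3].
Qed.

Lemma asqr_pos : 0 <= asqr.
Proof. unfold asqr; pose proof (pow2_ge_0 a1); pose proof (pow2_ge_0 a2); pose proof (pow2_ge_0 a3); lra. Qed.

Lemma nu_sqr t p : nu t p ^ 2 <= asqr.
Proof.
assert (R2 := rE_sqr t); rewrite <- uh'_VV_sqr in R2.
assert (w2 : ww' p ^ 2 = a1 ^ 2 + a2 ^ 2 - ww p ^ 2).
{ unfold ww', ww; generalize (sin_sqr p); intros s; ring [s]. }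
(* The spatial part of the observer is split into its normal, orthoradial and meridian
   components. *)
assert (asqr - nu t p ^ 2 = ww' p ^ 2 + (rE e t * (VV e t * a3 - uh' e t * ww p)) ^ 2).
{ rewrite w2; unfold asqr, nu.
  assert (R3 : rE e t ^ 2 * uh' e t ^ 2 = 1 - rE e t ^ 2 * VV e t ^ 2) by lra.
  ring [R3]. }
pose proof (pow2_ge_0 (ww' p)); pose proof (pow2_ge_0 (rE e t * (VV e t * a3 - uh' e t * ww p))); lra.
Qed.

Lemma energy_integrandE t p : 0 < t < PI ->
  energy_integrand (schwarzschild M) (ax Y0 Ye Y3) (rotational u v) (observer a1 a2 a3) t p =
  r * uh e t * sqrt (EE e t) * Psi (sqrt (1 + asqr)) (nu t p) (kk e t) (hh e t)
  - r * uh e t * rE e t * (uh' e t * ww p - VV e t * a3)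
    * (Derive SS t / sqrt (1 + SS t ^ 2) - e * cn e t).
Proof.
intros ht; unfold energy_integrand, energy_density; cbv zeta; fold tau.
change (rotational u v) with (ax (fun _ => 0) u v).
rewrite normal_connection_embedding, normal_connection_sphere, mean_curv_norm_embedding,
  mean_curv_norm_sphere, grad_sq_tau, laplacian_tau by assumption.
rewrite (grad_axial _ _ _ _ _ _ _ _ schwarzschild_axial Eth_sphere_pos Gph_sphere_pos) by assumption.
rewrite (area_axial _ _ _ _ _ _ _ _ schwarzschild_axial) by assumption.
rewrite Eth_sphere, Gph_sphere, sqrt_area, tau_Th by assumption.
assert (u0 := uh_pos t ht); assert (E0 := EE_pos t).
assert (R0 := rE_pos t); assert (R2 := rE_sqr t).
assert (k0 := kk_pos t); assert (x0 := hh_pos t); assert (n0 := nu_sqr t p); assert (as0 := asqr_pos).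
rewrite sqrt_EE.
unfold Psi; rewrite pow2_sqrt by lra.
set (n := nu t p) in *; set (g2 := 1 + asqr - n ^ 2).
replace (1 + (asqr - n ^ 2)) with g2 by (unfold g2; ring).
assert (g0 : 0 < g2) by (unfold g2; lra); assert (sg := sqrt_lt_R0 _ g0).
(* Since [|grad tau|^2 = |a|^2 - nu^2] and [lap tau = |H0| nu], the normal component cancels under
   the first root, which becomes [|H0| sqrt (1 + |a|^2)]. *)
replace ((kk e t / r) ^ 2 * g2 + (kk e t / r * n) ^ 2) with ((kk e t / r) ^ 2 * (1 + asqr))
  by (unfold g2; ring).
assert (0 < kk e t / r) by (apply Rdiv_lt_0_compat; lra).
rewrite (sqrt_mult ((kk e t / r) ^ 2)), sqrt_pow2 by (try apply pow2_ge_0; lra).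
replace ((hh e t / r) ^ 2 * g2 + (kk e t / r * n) ^ 2) with
  ((/ r) ^ 2 * (hh e t ^ 2 * g2 + (n * kk e t) ^ 2)) by (field; lra).
assert (0 < / r) by now apply Rinv_0_lt_compat.
rewrite (sqrt_mult ((/ r) ^ 2)), sqrt_pow2; [|lra|apply pow2_ge_0|].
2:{ apply Rplus_le_le_0_compat; [|apply pow2_ge_0]; apply Rmult_le_pos; [apply pow2_ge_0|lra]. }
replace (kk e t / r * n / (sqrt g2 * (kk e t / r))) with (n / sqrt g2) by (field; lra).
replace (kk e t / r * n / (sqrt g2 * (hh e t / r))) with (n * kk e t / (sqrt g2 * hh e t)) by (field; lra).
assert (R3 : / (r ^ 2 * EE e t) = rE e t ^ 2 / r ^ 2).
{ apply (Rmult_eq_reg_r (r ^ 2 * EE e t)).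
  - rewrite Rinv_l by (apply Rgt_not_eq, Rmult_lt_0_compat; [apply pow_lt|]; lra).
    rewrite <- R2; field; lra.
  - apply Rgt_not_eq, Rmult_lt_0_compat; [apply pow_lt|]; lra. }
assert (c0 : 0 < sqrt (1 + SS t ^ 2)) by (apply sqrt_lt_R0; pose proof (pow2_ge_0 (SS t)); lra).
rewrite R3; set (D := Derive SS t / sqrt (1 + SS t ^ 2)); clearbody D.
field; repeat split; lra.
Qed.

End Embedding.

End Schwarzschild.

End Good.

(** * The limit of the energy *)

Section Limit.

Variables M a1 a2 a3 : R.
Hypothesis hM : 0 < M.

Let A := sqrt (1 + asqr a1 a2 a3).

Definition JJ (e t : R) : R :=
  RInt (fun p => Psi A (nu e a1 a2 a3 t p) (kk e t) (hh e t)) 0 (2 * PI).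

Definition S0 (t : R) : R := -2 * b * ga * cos t * zz t ^ 3 * (1 - b ^ 2 * sin t ^ 2).
Definition dS0 (t : R) : R := -2 * b * ga *
  (- sin t * zz t ^ 3 * (1 - b ^ 2 * sin t ^ 2)
   + 3 * b ^ 2 * cos t ^ 2 * sin t * zz t ^ 5 * (1 - b ^ 2 * sin t ^ 2)
   - 2 * b ^ 2 * cos t ^ 2 * sin t * zz t ^ 3).

(** The energy integrand integrated over [phi]. The prefactor [r] is [M / (2 e)]: it leaves [/ e] in
    front of [JJ] and cancels the factor [e] of the connection terms. The part linear in [ww] has
    mean zero and is gone. *)
Definition dens (e t : R) : R :=
  M / 2 * (uh e t * sqrt (EE e t)) * (/ e * JJ e t)
  + PI * M * a3 * (uh e t * rE e t * VV e t
     * (Derive (S1 e) t * / sqrt (1 + SS e t ^ 2) - cn e t)).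
Definition dens0 (t : R) : R :=
  PI * M * A * (sin t * L1 t)
  + PI * M * a3 * (sin t ^ 2 * (dS0 t + 4 * b * ga * sin t * zz t)).

Lemma A_ge_1 : 1 <= A.
Proof.
rewrite <- sqrt_1; apply sqrt_le_1; pose proof (asqr_pos a1 a2 a3); lra.
Qed.

Lemma A_sqr : A ^ 2 = 1 + asqr a1 a2 a3.
Proof. apply pow2_sqrt; pose proof (asqr_pos a1 a2 a3); lra. Qed.

Lemma continuity_2d_nu e t p : good e -> continuity_2d_pt (nu e a1 a2 a3) t p.
Proof.
intros ge; unfold nu.
apply (continuity_2d_pt_mult _ (fun t _ => rE e t)).
- apply continuity_2d_pt_plus.
  + apply (continuity_2d_pt_mult (fun t _ => VV e t) (fun _ p => ww a1 a2 p)).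
    * apply continuity_2d_fst; eapply is_derive_continuous, is_derive_VV, ge.
    * apply continuity_2d_snd, (ex_derive_continuous (V := R_NormedModule)).
      unfold ww; auto_derive; easy.
  + apply (continuity_2d_pt_mult (fun t _ => uh' e t) (fun _ _ => a3)).
    * apply continuity_2d_fst; eapply is_derive_continuous, is_derive_uh'.
    * apply continuity_2d_pt_const.
- apply continuity_2d_fst; eapply is_derive_continuous, is_derive_rE, ge.
Qed.

Lemma continuity_2d_Psi_nu e t p : good e -> continuous (kk e) t -> continuous (hh e) t ->
  continuity_2d_pt (fun t p => Psi A (nu e a1 a2 a3 t p) (kk e t) (hh e t)) t p.
Proof.
intros ge hk hh'; apply continuity_2d_Psi; try assumption.
- now apply continuity_2d_nu.
- rewrite A_sqr; pose proof (nu_sqr e ge a1 a2 a3 t p); lra.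
- now apply hh_pos.
Qed.

(** By [Psi_bound] the integrand is [A (kk - hh)] up to order [e^2], so division by [e] leaves
    [A * L1]; the dependence on [phi] through [nu] disappears in the limit. *)
Lemma ulim_JJ : ulim (fun e t => / e * JJ e t) (fun t => 2 * PI * A * L1 t).
Proof.
destruct eventually_good as [g0 [g0p hg]].
destruct (jet_ulim _ _ _ jet_kk) as [Ck [k0 [Ck0 [k0p [_ hk]]]]].
destruct (jet_ulim _ _ _ (jet_hh)) as [Ch [x0 [Ch0 [x0p [_ hh']]]]].
destruct jet_kk_hh as [F' [F0' [_ [_ [C [d0 [C0 [d0p [hL hd]]]]]]]]].
assert (Pi := PI_RGT_0); assert (A1 := A_ge_1).
(* The two inverses keep [kk] and [hh] within 1 of their common limit 2, the range required by
   [Psi_bound]. *)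
set (m := Rmin (Rmin 1 (Rmin (/ (Ck + 1)) (/ (Ch + 1)))) (Rmin (Rmin g0 k0) (Rmin x0 d0))).
assert (ck : 0 < / (Ck + 1)) by (apply Rinv_0_lt_compat; lra).
assert (ch : 0 < / (Ch + 1)) by (apply Rinv_0_lt_compat; lra).
exists (2 * PI * A * C + 12 * PI * A ^ 2 * (C + C) ^ 2 + 2 * PI * A * C), m.
assert (0 <= 2 * PI * A * C) by (apply Rmult_le_pos; [nra|lra]).
assert (0 <= 12 * PI * A ^ 2 * (C + C) ^ 2).
{ apply Rmult_le_pos; [apply Rmult_le_pos; [lra|]|]; apply pow2_ge_0. }
split; [lra|split; [unfold m; repeat apply Rmin_glb_lt; lra|split]].
- intros t; apply (Rle_trans _ (2 * PI * A * C)); [|lra].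
  apply Rabs_mult_le; [rewrite Rabs_pos_eq; [lra|nra]|apply hL].
- intros e [ep em] t.
  apply Rmin_Rgt_l in em as [em em']; apply Rmin_Rgt_l in em as [m1 em].
  apply Rmin_Rgt_l in em as [m2 m3]; apply Rmin_Rgt_l in em' as [em em'].
  apply Rmin_Rgt_l in em as [m4 m5]; apply Rmin_Rgt_l in em' as [m6 m7].
  assert (ge := hg e (conj ep m4)).
  assert (kr : forall t, continuous (kk e) t /\ 1 <= kk e t <= 3).
  { intros s; destruct (hk e (conj ep m5) s) as [c1 c2]; split; [assumption|].
    assert (Ck * e <= 1); [|apply Rabs_le_between in c2; lra].
    apply (Rle_trans _ ((Ck + 1) * / (Ck + 1))); [apply Rmult_le_compat; lra|].
    rewrite Rinv_r; lra. }
  assert (hr : forall t, continuous (hh e) t /\ 1 <= hh e t <= 3).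
  { intros s; destruct (hh' e (conj ep m6) s) as [c1 c2]; split; [assumption|].
    assert (Ch * e <= 1); [|apply Rabs_le_between in c2; lra].
    apply (Rle_trans _ ((Ch + 1) * / (Ch + 1))); [apply Rmult_le_compat; lra|].
    rewrite Rinv_r; lra. }
  assert (c2d : forall s p, continuity_2d_pt
    (fun t p => Psi A (nu e a1 a2 a3 t p) (kk e t) (hh e t)) s p).
  { intros s p; apply continuity_2d_Psi_nu; [assumption|apply kr|apply hr]. }
  split.
  + apply (continuous_mult (K := R_AbsRing)); [apply continuous_const|].
    apply (continuous_RInt_param (fun t p => Psi A (nu e a1 a2 a3 t p) (kk e t) (hh e t)));
      [lra|assumption].
  + destruct (hd e (conj ep m7) t) as [_ d1]; rewrite Rminus_0_r in d1.
    destruct (hL t) as [_ l1].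
    set (D := kk e t - hh e t) in *.
    assert (D1 : Rabs D <= (C + C) * e).
    { replace D with ((D - e * L1 t) + e * L1 t) by ring; rewrite Rmult_plus_distr_r.
      apply Rabs_plus_le.
      - apply (Rle_trans _ _ _ d1). apply Rmult_le_compat_l; nra.
      - rewrite (Rmult_comm C); apply Rabs_mult_le; [rewrite Rabs_pos_eq; lra|assumption]. }
    assert (D2 : D ^ 2 <= (C + C) ^ 2 * e ^ 2).
    { rewrite <- Rpow_mult_distr, <- (pow2_abs D); apply pow_incr; split; [apply Rabs_pos|assumption]. }
    assert (exP : ex_RInt (fun p => Psi A (nu e a1 a2 a3 t p) (kk e t) (hh e t)) 0 (2 * PI)).
    { apply ex_RInt_cont; intros p.
      apply (continuity_2d_section (fun t p => Psi A (nu e a1 a2 a3 t p) (kk e t) (hh e t))), c2d. }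
    assert (J : Rabs (JJ e t - 2 * PI * A * D) <= 12 * PI * A ^ 2 * (C + C) ^ 2 * e ^ 2).
    { replace (2 * PI * A * D) with (RInt (fun _ => A * D) 0 (2 * PI)).
      2:{ rewrite RInt_const; unfold scal; simpl; unfold mult; simpl; ring. }
      unfold JJ; rewrite <- RInt_sub by (assumption || apply ex_RInt_const).
      apply (Rle_trans _ (6 * A ^ 2 * D ^ 2 * (2 * PI - 0))).
      - apply RInt_abs_le; [lra|apply (ex_RInt_minus (V := R_NormedModule)); [assumption|apply ex_RInt_const]|].
        intros p _; apply Psi_bound; [assumption| |apply kr|apply hr].
        rewrite A_sqr; pose proof (nu_sqr e ge a1 a2 a3 t p); lra.
      - replace (6 * A ^ 2 * D ^ 2 * (2 * PI - 0)) with (12 * PI * A ^ 2 * D ^ 2) by ring.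
        rewrite (Rmult_assoc _ ((C + C) ^ 2)); apply Rmult_le_compat_l; [|assumption].
        apply Rmult_le_pos; [lra|apply pow2_ge_0]. }
    replace (/ e * JJ e t - 2 * PI * A * L1 t) with
      (/ e * (JJ e t - 2 * PI * A * D) + 2 * PI * A * / e * (D - e * L1 t)) by (field; lra).
    assert (ie : 0 < / e) by now apply Rinv_0_lt_compat.
    apply (Rle_trans _ (/ e * (12 * PI * A ^ 2 * (C + C) ^ 2 * e ^ 2)
      + 2 * PI * A * / e * (C * e ^ 2))).
    * apply Rabs_plus_le; apply Rabs_mult_le; try assumption; rewrite Rabs_pos_eq; try lra.
      apply Rmult_le_pos; [nra|lra].
    * replace (/ e * (12 * PI * A ^ 2 * (C + C) ^ 2 * e ^ 2) + 2 * PI * A * / e * (C * e ^ 2))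
        with ((12 * PI * A ^ 2 * (C + C) ^ 2 + 2 * PI * A * C) * e) by (field; lra).
      apply Rmult_le_compat_r; lra.
Qed.

Lemma is_derive_S0 t : is_derive S0 t (dS0 t).
Proof.
unfold S0; auto_derive; [eexists; apply is_derive_zz|].
eta_Derive; rewrite (is_derive_unique _ _ _ (is_derive_zz t)); unfold dS0; ring.
Qed.

Lemma ulim_dens : ulim dens dens0.
Proof.
destruct jet_S1 as [F1 js]; destruct jet_cn as [F2 jc].
destruct (jet_Derive _ _ _ js) as [uD _].
assert (jq : exists F3, jet (fun e t => / sqrt (1 + SS e t ^ 2)) (fun _ => 1) F3).
{ eexists; apply (jet_inv1 (fun e t => sqrt (1 + SS e t ^ 2))).
  apply (jet_sqrt1 (fun e t => 1 + SS e t ^ 2)); unfold SS; eapply jet_ext.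
  - apply (jet_plus (fun _ _ => 1)); [apply jet_const|].
    apply (jet_pow2 (fun e t => e * S1 e t)), (jet_mult (fun e _ => e)); [apply jet_e|exact js].
  - intros; cbv beta; ring.
  - reflexivity. }
destruct jq as [F3 jq].
apply (ulim_ext dens _ (fun t => (M / 2) * (sin t * 1) * (2 * PI * A * L1 t)
  + PI * M * a3 * (sin t * 1 * sin t * (Derive S0 t * 1 - -4 * b * ga * sin t * zz t)))).
- unfold dens; apply ulim_plus.
  + apply (ulim_mult (fun e t => M / 2 * (uh e t * sqrt (EE e t))) (fun e t => / e * JJ e t));
      [|apply ulim_JJ].
    apply (ulim_mult (fun _ _ => M / 2)); [apply ulim_const|].
    apply (ulim_mult uh); [apply (jet_ulim _ _ _ jet_uh)|].
    apply (jet_ulim _ _ _ (jet_sqrt1 _ _ jet_EE)).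
  + apply (ulim_mult (fun _ _ => PI * M * a3)); [apply ulim_const|].
    apply (ulim_mult (fun e t => uh e t * rE e t * VV e t)).
    * apply (ulim_mult (fun e t => uh e t * rE e t)); [|apply (jet_ulim _ _ _ jet_VV)].
      apply (ulim_mult uh); [apply (jet_ulim _ _ _ jet_uh)|apply (jet_ulim _ _ _ jet_rE)].
    * apply ulim_minus; [|apply (jet_ulim _ _ _ jc)].
      apply ulim_mult; [exact uD|apply (jet_ulim _ _ _ jq)].
- reflexivity.
- intros t; rewrite (is_derive_unique _ _ _ (is_derive_S0 t)); unfold dens0; field.
Qed.

Lemma continuous_dens0 t : continuous dens0 t.
Proof.
apply (ex_derive_continuous (V := R_NormedModule)).
unfold dens0, L1, dS0; auto_derive; repeat split; eexists; apply is_derive_zz.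
Qed.

(** By [zz_sqr], [(cos zz)' = - sin zz^3] and [(cos zz^3)' = 2 sin zz^3 - 3 sin zz^5], while
    [L1 = 6 ga^2 zz^5 - 2 zz^3]. The term [sin^2 S0] integrates the derivative of the rapidity by
    parts and vanishes at both poles. *)
Definition primitive (t : R) : R :=
  PI * M * (- A * ((2 + 4 * b ^ 2) * (cos t * zz t) + 2 * ga ^ 2 * (cos t * zz t ^ 3))
            + a3 * (sin t ^ 2 * S0 t - 4 * b * ga * (cos t * zz t))).

Lemma is_derive_primitive t : is_derive primitive t (dens0 t).
Proof.
unfold primitive, S0; auto_derive; [repeat split; eexists; apply is_derive_zz|].
eta_Derive; rewrite (is_derive_unique _ _ _ (is_derive_zz t)).
unfold dens0, L1, dS0; generalize (sin_sqr t) (zz_sqr t) hga; generalize (sin t) (cos t) (zz t).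
intros s c z hs hz hg.
ring [hs hz hg].
Qed.

Lemma RInt_dens0 : RInt dens0 0 PI = 8 * PI * (A * ga * M + a3 * b * M).
Proof.
assert (Pi := PI_RGT_0).
assert (z0 : zz 0 = / ga).
{ unfold zz; rewrite cos_0; replace (1 + b ^ 2 * 1 ^ 2) with (ga ^ 2) by lra.
  now rewrite sqrt_pow2 by lra. }
assert (z1 : zz PI = / ga).
{ unfold zz; rewrite cos_PI; replace (1 + b ^ 2 * (-1) ^ 2) with (ga ^ 2) by lra.
  now rewrite sqrt_pow2 by lra. }
rewrite (is_RInt_unique dens0 0 PI (primitive PI - primitive 0)).
- match goal with |- @eq _ ?x ?y => change (@eq R x y) end.
  transitivity (PI * M * (A * ((4 * (1 + b ^ 2) + 4 * ga ^ 2) * / ga) + 8 * a3 * b)).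
  + unfold primitive, S0; rewrite z0, z1, cos_0, cos_PI, sin_0, sin_PI.
    rewrite <- hga; replace (2 + 4 * b ^ 2) with (4 * ga ^ 2 - 2) by lra; field; lra.
  + rewrite <- hga; field; lra.
- exact (is_RInt_derive primitive dens0 0 PI (fun x _ => is_derive_primitive x)
    (fun x _ => continuous_dens0 x)).
Qed.

End Limit.

(** * The embedding determined by its isometry and asymptotics, and the energy of one sphere *)

Section Sphere.

Variables M r : R.
Hypothesis hM : 0 < M.
Hypothesis hr : 0 < r.

Let e := M / (2 * r).
Hypothesis ge : good e.

Variables u v : R -> R.
Hypothesis hX : isometric_embedding (schwarzschild M)
  (ax (Y0 r) (Ye r) (Y3 r)) (rotational u v).
Variable C : R.
Hypothesis hC : 2 * C < r.
Hypothesis hu : forall t, 0 <= t <= PI -> Rabs (u t - r * sin t) <= C.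
Hypothesis hv : forall t, 0 <= t <= PI -> Rabs (v t - r * cos t) <= C.

Lemma ex_derive_of_embedding t : 0 < t < PI ->
  ex_derive u t /\ ex_derive v t /\ continuous (Derive v) t.
Proof.
intros ht; destruct hX as [hs _]; split.
(* At [phi = PI / 2] the first horizontal component is [u] itself, and the order 1 case of
   [ex_diff_n] contains its partial derivative. *)
- destruct (hs i1) as [s1 _]; specialize (s1 t (PI / 2) ht 1%nat).
  destruct s1 as [_ [s1 _]]; simpl in s1; rewrite sin_PI2 in s1.
  apply (ex_derive_ext _ _ _ (fun z => Rmult_1_r (u z)) s1).
- destruct (hs i3) as [s3 _]; specialize (s3 t 0 ht 1%nat).
  destruct s3 as [_ [s3 [_ [[c3 _] _]]]]; split; [exact s3|].
  apply (continuous_comp_2 (fun x => x) (fun _ => 0)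
    (fun x y => Derive (fun z => rotational u v z y i3) x)).
  + apply continuous_id.
  + apply continuous_const.
  + now apply continuity_2d_pt_filterlim in c3.
Qed.

Lemma induced_embedding t : 0 < t < PI ->
  u t ^ 2 = r ^ 2 * uh e t ^ 2 /\ Derive u t ^ 2 + Derive v t ^ 2 = r ^ 2 * EE e t.
Proof.
intros ht; destruct hX as [_ [_ hi]].
assert (iX := fun a c => induced_axial _ _ _ _ _ _ _ _ (minkowski_axial u v) a c t 0 ht).
assert (iS := fun a c => induced_axial _ _ _ _ _ _ _ _
  (schwarzschild_axial e ge M r hM hr eq_refl) a c t 0 ht).
split.
- specialize (hi t 0 Ph Ph ht); change (rotational u v) with (ax (fun _ => 0) u v) in hi.
  rewrite iX, iS in hi; rewrite <- Gph_sphere, <- hi; ring.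
- specialize (hi t 0 Th Th ht); change (rotational u v) with (ax (fun _ => 0) u v) in hi.
  rewrite iX, iS, Eth_sphere, Derive_const in hi; rewrite <- hi; ring.
Qed.

(** The isometry in the [phi] direction gives [u^2]. As [u] is continuous without zeros between the
    poles, its sign is that at the equator, where [u >= r - C > 0]. *)
Lemma u_profile t : 0 < t < PI -> u t = r * uh e t.
Proof.
assert (Pi := PI_RGT_0).
assert (pos : forall s, 0 < s < PI -> 0 < u s).
{ apply (nonvanishing_pos u 0 PI (PI / 2)); [lra| | |].
  - intros s hs; apply (ex_derive_continuous (V := R_NormedModule)).
    now apply ex_derive_of_embedding.
  - intros s hs u0; destruct (induced_embedding s hs) as [h _]; rewrite u0 in h.
    assert (0 < r ^ 2 * uh e s ^ 2); [|lra].
    apply Rmult_lt_0_compat; apply pow_lt; [lra|now apply uh_pos].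
  - specialize (hu (PI / 2) ltac:(lra)); rewrite sin_PI2 in hu.
    apply Rabs_le_between in hu; lra. }
intros ht; destruct (induced_embedding t ht) as [h _]; specialize (pos t ht).
assert (0 < r * uh e t) by (apply Rmult_lt_0_compat; [lra|now apply uh_pos]).
apply Rsqr_inj; unfold Rsqr; lra.
Qed.

Lemma VV_pos t : 0 < t < PI -> 0 < VV e t.
Proof.
intros; apply Rmult_lt_0_compat; [now apply sin_pos|now apply rK_pos].
Qed.

Lemma v_profile t : 0 < t < PI -> is_derive v t (- r * VV e t).
Proof.
assert (Pi := PI_RGT_0).
assert (sq : forall s, 0 < s < PI -> Derive v s ^ 2 = (r * VV e s) ^ 2).
{ intros s hs; destruct (induced_embedding s hs) as [_ h].
  rewrite (Derive_u e r u u_profile s hs), <- uh'_VV_sqr in h by assumption. lra. }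
assert (nz : forall s, 0 < s < PI -> Derive v s <> 0).
{ intros s hs d0; assert (q := sq s hs); rewrite d0 in q.
  assert (0 < (r * VV e s) ^ 2); [|lra].
  apply pow_lt, Rmult_lt_0_compat; [lra|now apply VV_pos]. }
assert (neg : forall s, 0 < s < PI -> Derive v s < 0).
{ intros s0 hs0; destruct (Rlt_le_dec (Derive v s0) 0) as [l|l]; [assumption|exfalso].
  assert (pos : forall s, 0 < s < PI -> 0 < Derive v s).
  { apply (nonvanishing_pos (Derive v) 0 PI s0); try assumption.
    - intros s hs; now apply ex_derive_of_embedding.
    - destruct l as [l|l]; [assumption|symmetry in l; now apply nz in l]. }
  (* At these two angles [r cos] is [r / 2] and [- r / 2], so [v] drops by at least [r - 2 C > 0]
     between them, which is impossible for an increasing function. *)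
  destruct (MVT_gen v (PI / 3) (2 * (PI / 3)) (Derive v)) as [c [hc eq]].
  - intros x hx; rewrite Rmin_left, Rmax_right in hx by lra.
    apply Derive_correct, ex_derive_of_embedding; lra.
  - intros x hx; rewrite Rmin_left, Rmax_right in hx by lra.
    apply continuity_pt_filterlim, (ex_derive_continuous (V := R_NormedModule)).
    apply ex_derive_of_embedding; lra.
  - rewrite Rmin_left, Rmax_right in hc by lra.
    assert (h1' := hv (PI / 3) ltac:(lra)); assert (h2' := hv (2 * (PI / 3)) ltac:(lra)).
    rewrite cos_PI3 in h1'; rewrite cos_2PI3 in h2'.
    apply Rabs_le_between in h1'; apply Rabs_le_between in h2'.
    assert (0 < Derive v c * (2 * (PI / 3) - PI / 3)); [|lra].
    apply Rmult_lt_0_compat; [apply pos; lra|lra]. }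
intros ht; replace (- r * VV e t) with (Derive v t).
- apply Derive_correct, ex_derive_of_embedding; assumption.
- specialize (sq t ht); specialize (neg t ht).
  assert (0 < r * VV e t) by (apply Rmult_lt_0_compat; [lra|now apply VV_pos]).
  assert (Derive v t = - (r * VV e t)); [|lra].
  assert (- Derive v t = r * VV e t); [|lra].
  apply Rsqr_inj; unfold Rsqr; lra.
Qed.

Variables a1 a2 a3 : R.
Hypothesis hk : forall t, continuous (kk e) t.
Hypothesis hh' : forall t, continuous (hh e) t.
Hypothesis hd : forall t, continuous (dens M a1 a2 a3 e) t.

Let integrand := energy_integrand (schwarzschild M) (ax (Y0 r) (Ye r) (Y3 r))
  (rotational u v) (observer a1 a2 a3).

Lemma is_RInt_ww : is_RInt (ww a1 a2) 0 (2 * PI) 0.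
Proof.
replace 0 with ((fun p => - a1 * cos p + a2 * sin p) (2 * PI)
   - (fun p => - a1 * cos p + a2 * sin p) 0) at 2.
- apply (is_RInt_derive (fun p => - a1 * cos p + a2 * sin p) (ww a1 a2)).
  + intros x _; unfold ww; auto_derive; [easy|ring].
  + intros x _; apply (ex_derive_continuous (V := R_NormedModule)); unfold ww; auto_derive; easy.
- cbv beta; rewrite cos_2PI, sin_2PI, cos_0, sin_0; ring.
Qed.

Lemma is_RInt_integrand t : 0 < t < PI ->
  is_RInt (integrand t) 0 (2 * PI) (dens M a1 a2 a3 e t).
Proof.
intros ht.
assert (Pi := PI_RGT_0).
assert (ep : 0 < e) by apply ge.
set (al' := Derive (SS e) t / sqrt (1 + SS e t ^ 2) - e * cn e t).
set (P := fun p => Psi (sqrt (1 + asqr a1 a2 a3)) (nu e a1 a2 a3 t p) (kk e t) (hh e t)).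
assert (iP : is_RInt P 0 (2 * PI) (JJ a1 a2 a3 e t)).
{ apply (RInt_correct (V := R_CompleteNormedModule)), ex_RInt_cont; intros p.
  apply (continuity_2d_section (fun t p => Psi (sqrt (1 + asqr a1 a2 a3)) (nu e a1 a2 a3 t p) (kk e t) (hh e t))).
  now apply continuity_2d_Psi_nu. }
assert (ic := is_RInt_const 0 (2 * PI) (r * uh e t * rE e t * VV e t * a3 * al')).
assert (i1 := is_RInt_scal _ _ _ (r * uh e t * sqrt (EE e t)) _ iP).
(* The only term with a horizontal component of the observer outside [Psi]; it integrates to zero
   over a period. *)
assert (i2 := is_RInt_scal _ _ _ (- (r * uh e t * rE e t * uh' e t * al')) _ is_RInt_ww).
assert (i3 := is_RInt_plus _ _ _ _ _ _ (is_RInt_plus _ _ _ _ _ _ i1 i2) ic).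
assert (r1 : r = M / 2 * / e) by (unfold e; field; lra).
assert (dS : Derive (SS e) t = e * Derive (S1 e) t).
{ unfold SS; now rewrite Derive_scal. }
replace (dens M a1 a2 a3 e t) with
  (plus (plus (scal (r * uh e t * sqrt (EE e t)) (JJ a1 a2 a3 e t))
     (scal (- (r * uh e t * rE e t * uh' e t * al')) 0))
     (scal (2 * PI - 0) (r * uh e t * rE e t * VV e t * a3 * al'))).
- revert i3; apply is_RInt_ext; intros p _; unfold integrand.
  rewrite (energy_integrandE e ge M r hM hr eq_refl u v u_profile v_profile a1 a2 a3 t p ht).
  unfold P, al', plus, scal; simpl; unfold mult; simpl; ring.
- unfold dens, al'; rewrite dS; unfold plus, scal; simpl; unfold mult; simpl.
  replace (sqrt (1 + SS e t * (SS e t * 1))) with (sqrt (1 + SS e t ^ 2)) by reflexivity.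
  assert (c0 : 0 < sqrt (1 + SS e t ^ 2)) by (apply sqrt_lt_R0; pose proof (pow2_ge_0 (SS e t)); lra).
  set (q := sqrt (1 + SS e t ^ 2)) in *; clearbody q.
  set (J := JJ a1 a2 a3 e t); clearbody J.
  set (s := sqrt (EE e t)); clearbody s.
  rewrite r1; field; lra.
Qed.

Lemma energy_sphere :
  energy_defined (schwarzschild M) (ax (Y0 r) (Ye r) (Y3 r)) (rotational u v) (observer a1 a2 a3) /\
  quasilocal_energy (schwarzschild M) (ax (Y0 r) (Ye r) (Y3 r)) (rotational u v) (observer a1 a2 a3)
  = 1 / (8 * PI) * RInt (dens M a1 a2 a3 e) 0 PI.
Proof.
assert (Pi := PI_RGT_0).
assert (eq : forall t, 0 < t < PI -> dens M a1 a2 a3 e t = RInt (integrand t) 0 (2 * PI)).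
{ intros t ht; symmetry; apply is_RInt_unique; now apply is_RInt_integrand. }
split; [split; [|split]|].
- intros t p ht; split; [|split].
  + apply (spacelike_frame _ _ _ _ _ _ _ _ (schwarzschild_axial e ge M r hM hr eq_refl)
     (Eth_sphere_pos e ge r hr) (Gph_sphere_pos e ge r hr) _ _ _ _ _ _ _ _
     (adapted_frame_sphere e ge M r hM hr eq_refl) t p ht).
  + apply (spacelike_frame _ _ _ _ _ _ _ _ (schwarzschild_axial e ge M r hM hr eq_refl)
     (Eth_sphere_pos e ge r hr) (Gph_sphere_pos e ge r hr) _ _ _ _ _ _ _ _
     (adapted_frame_sphere e ge M r hM hr eq_refl) t p ht).
  + apply (spacelike_frame _ _ _ _ _ _ _ _ (minkowski_axial u v)
     (Eth_embedding_pos e ge r hr u v u_profile v_profile)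
     (Gph_embedding_pos e ge r hr u u_profile) _ _ _ _ _ _ _ _
     (adapted_frame_embedding e ge r hr u v u_profile v_profile) t p ht).
- intros t ht; eexists; now apply is_RInt_integrand.
- apply (ex_RInt_ext (dens M a1 a2 a3 e)).
  + intros t; rewrite Rmin_left, Rmax_right by lra; apply eq.
  + now apply ex_RInt_cont.
- unfold quasilocal_energy; f_equal; symmetry; apply RInt_ext.
  intros t; rewrite Rmin_left, Rmax_right by lra; apply eq.
Qed.

End Sphere.

End Profile.

(** * Passage to the limit and minimization over the observers *)

Lemma RInt_dens_estimate b ga M a1 a2 a3 : ga ^ 2 = 1 + b ^ 2 -> 0 < ga -> 0 < M ->
  exists C e0, 0 <= C /\ 0 < e0 /\ forall e, 0 < e < e0 -> good b ga e /\
    (forall t, continuous (kk b e) t) /\ (forall t, continuous (hh b ga e) t) /\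
    (forall t, continuous (dens b ga M a1 a2 a3 e) t) /\
    Rabs (RInt (dens b ga M a1 a2 a3 e) 0 PI -
      8 * PI * (sqrt (1 + asqr a1 a2 a3) * ga * M + a3 * b * M)) <= C * e.
Proof.
intros hga gap hM.
destruct (eventually_good b ga hga gap) as [g0 [g0p hg]].
destruct (jet_ulim _ _ _ (jet_kk b)) as [Ck [k0 [_ [k0p [_ hk]]]]].
destruct (jet_ulim _ _ _ (jet_hh b ga hga)) as [Cx [x0 [_ [x0p [_ hh']]]]].
assert (ud := ulim_dens b ga hga gap M a1 a2 a3).
destruct (ulim_RInt _ _ 0 PI (Rlt_le _ _ PI_RGT_0) ud (continuous_dens0 b ga M a1 a2 a3))
  as [C [c0 [C0 [c0p hC]]]].
destruct ud as [Cd [d0 [_ [d0p [_ hd]]]]].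
exists C, (Rmin (Rmin g0 k0) (Rmin x0 (Rmin c0 d0))).
split; [assumption|split; [repeat apply Rmin_glb_lt; assumption|]].
intros e [ep em].
apply Rmin_Rgt_l in em as [em em']; apply Rmin_Rgt_l in em as [m1 m2].
apply Rmin_Rgt_l in em' as [m3 em]; apply Rmin_Rgt_l in em as [m4 m5].
split; [apply hg; now split|split; [|split; [|split]]].
- intros t; apply (hk e (conj ep m2) t).
- intros t; apply (hh' e (conj ep m3) t).
- intros t; apply (hd e (conj ep m5) t).
- rewrite <- (RInt_dens0 b ga hga gap M a1 a2 a3); apply hC; now split.
Qed.

(** The reverse Cauchy-Schwarz inequality for future timelike unit vectors. The sum of squares [key]
    shows [s * ga >= 1 - a3 * b], and equality forces [a3 + b], [a1] and [a2] to vanish. *)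
Lemma observer_energy_min b ga M a1 a2 a3 : 0 < M -> 0 < ga -> ga ^ 2 = 1 + b ^ 2 ->
  let x := sqrt (1 + (a1 ^ 2 + a2 ^ 2 + a3 ^ 2)) * ga * M + a3 * b * M in
  M <= x /\ (x = M -> a1 = 0 /\ a2 = 0 /\ a3 = - b).
Proof.
intros hM hg hga; cbv zeta.
set (q := 1 + (a1 ^ 2 + a2 ^ 2 + a3 ^ 2)).
pose proof (pow2_ge_0 a1); pose proof (pow2_ge_0 a2); pose proof (pow2_ge_0 a3).
assert (hq : 0 <= q) by (unfold q; lra).
assert (s0 := sqrt_pos q); assert (s2 := pow2_sqrt q hq); set (s := sqrt q) in *.
assert (key : (s * ga) ^ 2 = (1 - a3 * b) ^ 2 + (a3 + b) ^ 2 + (a1 ^ 2 + a2 ^ 2) * ga ^ 2).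
{ rewrite Rpow_mult_distr, s2; unfold q; rewrite hga; ring. }
assert (g2 : 0 < ga ^ 2) by now apply pow_lt.
assert (n1 : 0 <= (a3 + b) ^ 2) by apply pow2_ge_0.
assert (n2 : 0 <= (a1 ^ 2 + a2 ^ 2) * ga ^ 2) by (apply Rmult_le_pos; lra).
assert (sg : 0 <= s * ga) by (apply Rmult_le_pos; lra).
assert (le : 1 - a3 * b <= s * ga) by nra.
split.
- assert (0 <= (s * ga + a3 * b - 1) * M) by (apply Rmult_le_pos; lra). lra.
- intros eq.
  assert (eq' : s * ga = 1 - a3 * b).
  { apply (Rmult_eq_reg_r M); lra. }
  rewrite eq' in key.
  assert (z1 : (a3 + b) ^ 2 = 0) by lra.
  assert (z2 : (a1 ^ 2 + a2 ^ 2) * ga ^ 2 = 0) by lra.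
  apply Rmult_integral in z2; destruct z2 as [z2|z2]; [|lra].
  assert (z : forall x, x ^ 2 = 0 -> x = 0).
  { intros x hx; apply Rsqr_0_uniq; unfold Rsqr; lra. }
  split; [|split]; [apply z; lra|apply z; lra|]. specialize (z _ z1); lra.
Qed.

Theorem mainTheorem4 (M beta gamma : R) (u v : R -> R -> R)
  (hM : 0 < M) (hgamma : 0 < gamma)
  (hbeta : gamma ^ 2 - beta ^ 2 * gamma ^ 2 = 1)
  (hX : exists R0, forall r0, R0 < r0 ->
     isometric_embedding (schwarzschild M) (boosted_sphere beta gamma r0)
       (rotational (u r0) (v r0)))
  (hu : exists R0 C, forall r0 th, R0 < r0 -> 0 <= th <= PI ->
     Rabs (u r0 th - r0 * sin th) <= C)
  (hv : exists R0 C, forall r0 th, R0 < r0 -> 0 <= th <= PI ->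
     Rabs (v r0 th - r0 * cos th) <= C) :
  let E := fun r0 => quasilocal_energy (schwarzschild M)
             (boosted_sphere beta gamma r0) (rotational (u r0) (v r0)) in
  let Elim := fun T0 => real (Lim (fun r0 => E r0 T0) p_infty) in
  (forall a1 a2 a3,
     (exists R0, forall r0, R0 < r0 ->
        energy_defined (schwarzschild M) (boosted_sphere beta gamma r0)
          (rotational (u r0) (v r0)) (observer a1 a2 a3)) /\
     is_lim (fun r0 => E r0 (observer a1 a2 a3)) p_infty
       (sqrt (1 + (a1 ^ 2 + a2 ^ 2 + a3 ^ 2)) * gamma * M + a3 * beta * gamma * M)) /\
  is_minimizer Elim (vec4 gamma 0 0 (- beta * gamma)) /\
  Elim (vec4 gamma 0 0 (- beta * gamma)) = M /\
  is_energy_momentum Elim (vscal M (vec4 gamma 0 0 (- beta * gamma))).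
Proof.
intros E Elim.
set (b := beta * gamma).
assert (hga : gamma ^ 2 = 1 + b ^ 2) by (unfold b; lra).
assert (Pi := PI_RGT_0).
assert (lim : forall a1 a2 a3,
     (exists R0, forall r0, R0 < r0 ->
        energy_defined (schwarzschild M) (boosted_sphere beta gamma r0)
          (rotational (u r0) (v r0)) (observer a1 a2 a3)) /\
     is_lim (fun r0 => E r0 (observer a1 a2 a3)) p_infty
       (sqrt (1 + (a1 ^ 2 + a2 ^ 2 + a3 ^ 2)) * gamma * M + a3 * beta * gamma * M)).
{ intros a1 a2 a3.
  destruct (RInt_dens_estimate b gamma M a1 a2 a3 hga hgamma hM) as [C [e0 [C0 [e0p he]]]].
  destruct hX as [R1 hX']; destruct hu as [R2 [C2 hu']]; destruct hv as [R3 [C3 hv']].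
  (* Beyond [Q] the radius exceeds twice the error of the asymptotics, which decides the signs of
     [u] and [v']; beyond [M / (2 * e0)] the parameter [M / (2 * r)] is smaller than [e0]. *)
  set (Q := Rmax 0 (2 * Rmax C2 C3)).
  set (R0 := Rmax (Rmax Q (M / (2 * e0))) (Rmax R1 (Rmax R2 R3))).
  assert (main : forall r, R0 < r -> 0 < r /\
    energy_defined (schwarzschild M) (boosted_sphere beta gamma r)
          (rotational (u r) (v r)) (observer a1 a2 a3) /\
    Rabs (E r (observer a1 a2 a3) -
      (sqrt (1 + (a1 ^ 2 + a2 ^ 2 + a3 ^ 2)) * gamma * M + a3 * beta * gamma * M))
      <= C * M / (16 * PI) * / r).
  { intros r hr.
    assert (b1 := Rmax_l (Rmax Q (M / (2 * e0))) (Rmax R1 (Rmax R2 R3))).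
    assert (b2 := Rmax_r (Rmax Q (M / (2 * e0))) (Rmax R1 (Rmax R2 R3))).
    assert (b3 := Rmax_l Q (M / (2 * e0))); assert (b4 := Rmax_r Q (M / (2 * e0))).
    assert (b5 := Rmax_l R1 (Rmax R2 R3)); assert (b6 := Rmax_r R1 (Rmax R2 R3)).
    assert (b7 := Rmax_l R2 R3); assert (b8 := Rmax_r R2 R3).
    assert (b9 := Rmax_l 0 (2 * Rmax C2 C3)); assert (b10 := Rmax_r 0 (2 * Rmax C2 C3)).
    assert (b11 := Rmax_l C2 C3); assert (b12 := Rmax_r C2 C3).
    fold Q in b9, b10; fold R0 in b1, b2.
    assert (rp : 0 < r) by lra.
    assert (ee : 0 < M / (2 * r) < e0).
    { split; [apply Rdiv_lt_0_compat; lra|].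
      assert (M / (2 * e0) < r) by lra.
      apply (Rmult_lt_reg_r (r / e0)); [apply Rdiv_lt_0_compat; lra|].
      replace (M / (2 * r) * (r / e0)) with (M / (2 * e0)) by (field; lra).
      replace (e0 * (r / e0)) with r by (field; lra). assumption. }
    destruct (he _ ee) as [ge [ck [ch [cd cb]]]].
    destruct (energy_sphere b gamma hga M r hM rp ge (u r) (v r) (hX' r ltac:(lra))
      (Rmax C2 C3) ltac:(lra)
      (fun t ht => Rle_trans _ _ _ (hu' r t ltac:(lra) ht) b11)
      (fun t ht => Rle_trans _ _ _ (hv' r t ltac:(lra) ht) b12)
      a1 a2 a3 ck ch cd) as [d1 d2].
    split; [assumption|split; [exact d1|]].
    (* With [b = beta * gamma], [boosted_sphere] is convertible to the surface [ax] built from [Y0],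
       [Ye], [Y3]. *)
    assert (d3 : E r (observer a1 a2 a3) =
      1 / (8 * PI) * RInt (dens b gamma M a1 a2 a3 (M / (2 * r))) 0 PI) by exact d2.
    rewrite d3; unfold asqr in cb.
    set (I := RInt (dens b gamma M a1 a2 a3 (M / (2 * r))) 0 PI) in *.
    set (s := sqrt (1 + (a1 ^ 2 + a2 ^ 2 + a3 ^ 2))) in *.
    replace (1 / (8 * PI) * I - (s * gamma * M + a3 * beta * gamma * M)) with
      (/ (8 * PI) * (I - 8 * PI * (s * gamma * M + a3 * b * M))) by (unfold b; field; lra).
    replace (C * M / (16 * PI) * / r) with (/ (8 * PI) * (C * (M / (2 * r)))) by (field; lra).
    apply Rabs_mult_le; [|exact cb].
    rewrite Rabs_pos_eq; [lra|]. apply Rlt_le, Rinv_0_lt_compat; lra. }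
  split; [exists R0; intros r hr; now apply main|].
  apply is_lim_spec; intros eps.
  set (K := C * M / (16 * PI)) in *.
  exists (Rmax R0 (K / eps)); intros r hr.
  assert (ep := cond_pos eps).
  assert (l1 := Rmax_l R0 (K / eps)); assert (l2 := Rmax_r R0 (K / eps)).
  destruct (main r ltac:(lra)) as [rp [_ bd]].
  apply (Rle_lt_trans _ _ _ bd).
  apply (Rmult_lt_reg_r (r / eps)); [apply Rdiv_lt_0_compat; lra|].
  replace (K * / r * (r / eps)) with (K / eps) by (field; lra).
  replace (eps * (r / eps)) with r by (field; lra). lra. }
assert (val : forall a1 a2 a3, Elim (observer a1 a2 a3) =
  sqrt (1 + (a1 ^ 2 + a2 ^ 2 + a3 ^ 2)) * gamma * M + a3 * b * M).
{ intros a1 a2 a3; unfold Elim; rewrite (is_lim_unique _ _ _ (proj2 (lim a1 a2 a3))).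
  unfold b; simpl; ring. }
assert (obs : vec4 gamma 0 0 (- beta * gamma) = observer 0 0 (- b)).
{ unfold observer; replace (1 + (0 ^ 2 + 0 ^ 2 + (- b) ^ 2)) with (gamma ^ 2) by lra.
  rewrite sqrt_pow2 by lra; unfold b; f_equal; ring. }
assert (eM : Elim (vec4 gamma 0 0 (- beta * gamma)) = M).
{ rewrite obs, val; replace (1 + (0 ^ 2 + 0 ^ 2 + (- b) ^ 2)) with (gamma ^ 2) by lra.
  rewrite sqrt_pow2 by lra.
  transitivity ((gamma ^ 2 - b ^ 2) * M); [ring|]. rewrite hga; ring. }
assert (mn : is_minimizer Elim (vec4 gamma 0 0 (- beta * gamma))).
{ split; [exists 0, 0, (- b); exact obs|].
  intros T [a1 [a2 [a3 ->]]]; rewrite eM, val; now apply observer_energy_min. }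
split; [exact lim|split; [exact mn|split; [exact eM|]]].
exists (vec4 gamma 0 0 (- beta * gamma)); split; [exact mn|split].
(* A second minimizer also has the value [M], and the equality case of [observer_energy_min]
   identifies its components. *)
- intros T [[a1 [a2 [a3 ->]]] hT].
  assert (le := hT _ (proj1 mn)); rewrite eM, val in le.
  destruct (observer_energy_min b gamma M a1 a2 a3 hM hgamma hga) as [m1 m2].
  destruct (m2 (Rle_antisym _ _ le m1)) as [-> [-> ->]]; symmetry; exact obs.
- now rewrite eM.
Qed.
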